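(* Suppose $(w,q)$ is a solution of the Navier-Stokes equations (as in the context) with $w\in L^{\infty}(0,\infty;H^3)$, $w_t,w_{tt}\in L^{\infty}(0,\infty;H^1)$, $q\in L^{\infty}(0,\infty;H^1)$, and denote $$C_w = \| w_{tt} \|^2_{L^{\infty}(0,\infty;H^{-1})}+ \| w_{t} \|_{L^{\infty}(0,\infty;L^2)}^2 \, \| w \|_{L^{\infty}(0,\infty;H^3)}^2 + \| \nabla w \|_{L^{\infty}(0,\infty;L^{\infty})},\qquad C_q = \| q\|_{L^{\infty}(0,\infty;H^1)}^2 .$$ Let $\{u^n,\tilde u^n\}$, $n=1,2,3,\dots$, denote the solution of the CDA-Projection algorithm (defined in the context), with $\Delta t\le 1$, $\mu\ge \Delta t^{-2}$, $\mu\ge C_w$, and $\mu H^2\le \frac{\nu}{2C_I^2}$. Then for every positive integer $n$, $$\|\tilde u^n-w^n\|\le \|u^n-w^n\|\le C\,\Delta t,$$ where $C$ depends on the problem data and the Navier-Stokes solution but is independent of $\Delta t$ and $\mu$ (and the same $C$ serves for all $n$).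
   Context: $\Omega\subset\mathbb{R}^d$, $d=2,3$, is an open bounded Lipschitz domain. $\|\cdot\|$ and $(\cdot,\cdot)$ are the $L^2(\Omega)$ norm and inner product. $X=H^1_0(\Omega)^d$, $Q=L^2_0(\Omega)$ (mean-zero $L^2$ functions), and $Y=\{u\in L^2(\Omega)^d:\nabla\cdot u=0,\ u\cdot n|_{\partial\Omega}=0\}$. $P_Y$ is the $L^2$-orthogonal projector of $L^2(\Omega)^d$ onto $Y$, and $\tilde u^{n}=P_Yu^{n}$. Navier-Stokes equations: with viscosity $\nu>0$ and forcing $f\in L^\infty(0,\infty;H^{-1}(\Omega))$, $(w,q)$ satisfies $w_t+w\cdot\nabla w+\nabla q-\nu\Delta w=f$, $\nabla\cdot w=0$, $w|_{\partial\Omega}=0$, $w(0)=w^0$, where $w^0\in X$ is divergence-free. Here $\Delta t>0$ is the time step, $t^n=n\Delta t$, $w^n=w(t^n)$, $f^n=f(t^n)$. Measurement interpolant: $I_H$ is a (linear) interpolation operator on a regular conforming coarse mesh of maximum spacing $H$, into vector-valued piecewise polynomials of some fixed degree, satisfying for all $\phi\in X$: $\|I_H(\phi)-\phi\|\le C_IH\|\nabla\phi\|$ and $\|I_H(\phi)\|\le C_I\|\phi\|$. CDA-Projection algorithm (semi-discrete): let $u^0=w^0$ (so $\tilde u^0=w^0$), and let $\mu\ge0$ be a nudging parameter. For $n=0,1,2,\dots$: Step 1: find $u^{n+1}\in X$ such that for all $v\in X$ $$\tfrac1{\Delta t}(u^{n+1}-\tilde u^n,v)+(\tilde u^n\cdot\nabla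 u^{n+1},v)+\nu(\nabla u^{n+1},\nabla v)+\mu(I_H(u^{n+1}-w^{n+1}),v)=(f^{n+1},v).$$ Step 2: find $\tilde u^{n+1}\in Y$ and $p^{n+1}\in Q$ such that $\tfrac1{\Delta t}(\tilde u^{n+1}-u^{n+1},v)-(p^{n+1},\nabla\cdot v)=0$ for all $v\in Y$ and $(\nabla\cdot\tilde u^{n+1},r)=0$ for all $r\in Q$; that is, $\tilde u^{n+1}=P_Yu^{n+1}$.
   Formalization: Since the algorithm samples f(t^n) while f and q are only L^∞ in time, the Navier-Stokes equations are assumed to hold at every t>0 and ‖q(t)‖²_{H^1} ≤ C_q at every t>0, not just almost every t. *)

(* Defs.v *)
From HB Require Import structures.
From mathcomp Require Import all_boot all_order all_algebra.
From mathcomp Require Import all_classical all_reals all_analysis.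
From mathcomp Require Import ess_sup_inf.
Set Implicit Arguments.
Unset Strict Implicit.
Unset Printing Implicit Defensive.
Import Order.TTheory GRing.Theory Num.Theory.
Import numFieldNormedType.Exports.
Local Open Scope classical_set_scope.
Local Open Scope ring_scope.

(* Borel sets and Lebesgue measure on R^n, with points as row vectors.       *)

Definition row_display : measure_display.
Proof. exact: default_measure_display. Qed.

Section row_measurable.
Context {R : realType} {n : nat}.

Definition row_coord (i : 'I_n) (x : 'rV[R]_n) : measurableTypeR R := x ord0 i.

Let row_set0 : g_sigma_preimage row_coord set0.
Proof. exact: sigma_algebra0. Qed.

Let row_setC A : g_sigma_preimage row_coord A -> g_sigma_preimage row_coord (~` A).
Proof. exact: sigma_algebraC. Qed.

Let row_bigcup (F : (set 'rV[R]_n)^nat) :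
  (forall i, g_sigma_preimage row_coord (F i)) ->
  g_sigma_preimage row_coord (\bigcup_i (F i)).
Proof. exact: sigma_algebra_bigcup. Qed.

HB.instance Definition _ := @isMeasurable.Build row_display
  'rV[R]_n (g_sigma_preimage row_coord) row_set0 row_setC row_bigcup.

End row_measurable.

Section row_lebesgue.
Context {R : realType}.

Definition row_cons (n : nat) (p : 'rV[R]_n * measurableTypeR R) : 'rV[R]_n.+1 :=
  \row_(i < n.+1) if unlift ord0 i is Some j then p.1 ord0 j else p.2.

Lemma measurable_row_coord n (i : 'I_n) :
  measurable_fun [set: 'rV[R]_n] (row_coord i).
Proof.
move=> _ Y mY; rewrite setTI; apply: sub_sigma_algebra => /=.
rewrite -bigcup_seq/=; exists i => /=; first by rewrite mem_index_enum.
by exists Y => //; rewrite setTI.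
Qed.

Lemma measurable_row_cons n : measurable_fun [set: _] (@row_cons n).
Proof.
move=> _ Y; rewrite setTI.
suff : measurable `<=` image_set_system setT (@row_cons n) measurable.
  by move=> /[apply]; rewrite /image_set_system /= setTI.
apply: smallest_sub; first exact/sigma_algebra_image/sigma_algebra_measurable.
rewrite -bigcup_seq; apply: bigcup_sub => i _ _ [B mB <-].
rewrite /image_set_system /= !setTI -comp_preimage.
rewrite -[X in measurable X]setTI.
have [j ij|i0] := unliftP ord0 i.
- have -> : row_coord i \o @row_cons n = row_coord j \o fst.
    by apply/funext => p; rewrite /row_coord/= mxE ij liftK.
  by apply: (measurableT_comp (measurable_row_coord j)).
- have -> : row_coord i \o @row_cons n = snd.
    by apply/funext => p; rewrite /row_coord/= mxE i0 unlift_none.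
  exact: measurable_snd.
Qed.

HB.instance Definition _ n :=
  isMeasurableFun.Build _ _ _ _ (@row_cons n) (@measurable_row_cons n).

Section next_dimension.
Local Open Scope ereal_scope.
Context {n : nat} (m : {measure set 'rV[R]_n -> \bar R}).

Definition leb_next : set 'rV[R]_n.+1 -> \bar R :=
  pushforward (m \x lebesgue_measure) (@row_cons n).

Let leb_next0 : leb_next set0 = 0.
Proof. by rewrite /leb_next /pushforward preimage_set0 measure0. Qed.

Let leb_next_ge0 A : 0 <= leb_next A.
Proof. exact: measure_ge0. Qed.

Let leb_next_sigma_additive : semi_sigma_additive leb_next.
Proof.
move=> F mF tF mUF; rewrite /leb_next /pushforward preimage_bigcup.
have mpre A : measurable A -> measurable (@row_cons n @^-1` A).
  by move=> mA; rewrite -[X in measurable X]setTI; exact: measurable_row_cons.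
apply: measure_semi_sigma_additive.
- by move=> k; exact: mpre.
- apply/trivIsetP => /= i j _ _ ij; rewrite -preimage_setI.
  by move/trivIsetP : tF => /(_ _ _ _ _ ij) ->//; rewrite preimage_set0.
- by rewrite -preimage_bigcup; exact: mpre.
Qed.

HB.instance Definition _ :=
  isMeasure.Build _ _ _ leb_next leb_next0 leb_next_ge0 leb_next_sigma_additive.

End next_dimension.

Fixpoint leb (n : nat) : {measure set 'rV[R]_n -> \bar R} :=
  match n return {measure set 'rV[R]_n -> \bar R} with
  | 0 => dirac (0 : 'rV[R]_0)
  | n'.+1 => leb_next (leb n')
  end.

End row_lebesgue.

Notation sfield R d := ('rV[R]_d -> R).
Notation vfield R d := ('I_d -> 'rV[R]_d -> R).

Section domains.
Context {R : realType} {d : nat}.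
Implicit Types (x y z e : 'rV[R]_d) (Om T F : set 'rV[R]_d).

Definition dotp x y : R := \sum_(i < d) x ord0 i * y ord0 i.

(* The library norm on row vectors is the max norm. *)
Definition enorm x : R := Num.sqrt (dotp x x).

(* [x] is split as (component along [e], projection on the hyperplane e^perp);
   near each boundary point, Om is the part strictly above a Lipschitz graph. *)
Definition lipschitz_boundary Om :=
  forall x0, (closure Om `\` interior Om) x0 ->
  exists e (gamma : 'rV[R]_d -> R) (L r : R),
    [/\ enorm e = 1, 0 < r,
        forall y z, `|gamma y - gamma z| <= L * enorm (y - z) &
        forall x, enorm (x - x0) < r ->
          (Om x <-> gamma (x - dotp x e *: e) < dotp x e)].

Definition lipschitz_domain Om :=
  [/\ Om !=set0, open Om, connected Om, bounded_set Om & lipschitz_boundary Om].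

Definition diam T : R :=
  sup [set r | exists x y, [/\ T x, T y & r = enorm (x - y)]].

Definition polytope T :=
  exists (m : nat) (P : 'I_m -> 'rV[R]_d),
    T = [set x | exists a : 'I_m -> R,
           [/\ forall i, 0 <= a i, \sum_i a i = 1 & x = \sum_i a i *: P i]].

Definition face F T :=
  F `<=` T /\
  forall x y (s : R), T x -> T y -> 0 < s < 1 ->
    F (s *: x + (1 - s) *: y) -> F x /\ F y.

(* Cells need not be contained in Om, so that domains with curved boundary are
   meshable; [rho] is the shape-regularity constant. *)
Definition regular_conforming_mesh Om (rho H : R) (M : set (set 'rV[R]_d)) :=
  [/\ finite_set M,
      forall T, M T -> [/\ polytope T, (T `&` Om) !=set0, 0 < diam T &
        exists c, forall x, enorm (x - c) <= rho * diam T -> T x],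
      forall T T', M T -> M T' -> face (T `&` T') T,
      Om `<=` \bigcup_(T in M) T &
      (forall T, M T -> diam T <= H) /\ (exists2 T, M T & diam T = H)].

Definition piecewise_poly Om (M : set (set 'rV[R]_d)) (k : nat)
    (g : vfield R d) :=
  forall T (i : 'I_d), M T ->
  exists c : {ffun 'I_d -> 'I_k.+1} -> R,
  forall x, Om x -> interior T x ->
    g i x = \sum_(a : {ffun 'I_d -> 'I_k.+1} | (\sum_j (a j : nat) <= k)%N)
              c a * \prod_j x ord0 j ^+ a j.

End domains.

Section sobolev.
Context {R : realType} {d : nat}.
Variable Om : set 'rV[R]_d.
Local Notation E := 'rV[R]_d.
Implicit Types (phi psi : sfield R d) (u v b g : vfield R d) (p r : sfield R d).

Definition partial (i : 'I_d) phi : sfield R d :=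
  fun x => 'D_(delta_mx ord0 i) phi x.

Definition unit_mi (i : 'I_d) : 'I_d -> nat := fun j => (j == i) : nat.

Definition partial_mi (a : 'I_d -> nat) phi : sfield R d :=
  foldr (fun i h => iter (a i) (partial i) h) phi (enum 'I_d).

Definition smooth phi :=
  forall (s : seq 'I_d) x, differentiable (foldr partial phi s) x.

Definition test_fun phi :=
  let supp := closure [set x | phi x != 0] in
  [/\ smooth phi, compact supp & supp `<=` Om].

Definition ip p r : R := \int[leb d]_(x in Om) (p x * r x).
Definition sqL2 p : \bar R := (\int[leb d]_(x in Om) ((p x) ^+ 2)%:E)%E.
Definition L2 p := measurable_fun Om p /\ (sqL2 p < +oo)%E.

(* Weak derivatives; functions are representatives of almost-everywhere
   classes, and [wderiv] selects some representative. *)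
Definition is_wderiv (a : 'I_d -> nat) p r :=
  L2 r /\ forall phi, test_fun phi ->
    ip p (partial_mi a phi) = (-1) ^+ (\sum_i a i) * ip r phi.

Definition wderiv (a : 'I_d -> nat) p : sfield R d :=
  xget (fun=> 0) [set r | is_wderiv a p r].

Definition dx (i : 'I_d) p : sfield R d := wderiv (unit_mi i) p.

Definition Hspace (m : nat) p :=
  L2 p /\ forall a : 'I_d -> nat, (\sum_i a i <= m)%N -> exists r, is_wderiv a p r.

Definition sqH (m : nat) p : \bar R :=
  if `[< Hspace m p >] then
    (\sum_(a : {ffun 'I_d -> 'I_m.+1} | (\sum_j (a j : nat) <= m)%N)
       sqL2 (wderiv (fun i => a i) p))%E
  else +oo%E.

Definition H10 p :=
  Hspace 1 p /\ exists phi : nat -> sfield R d,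
    [/\ forall k, test_fun (phi k),
        (fun k => sqL2 (phi k - p)) @ \oo --> 0%E &
        forall i, (fun k => sqL2 (partial i (phi k) - dx i p)) @ \oo --> 0%E].

Definition Qspace p := L2 p /\ \int[leb d]_(x in Om) p x = 0.

Definition normH (m : nat) p : \bar R := sqrte (sqH m p).

Definition vL2 u := forall i, L2 (u i).
Definition Xspace u := forall i, H10 (u i).

Definition vip u v : R := \int[leb d]_(x in Om) (\sum_i u i x * v i x).
Definition vnormL2 u : \bar R := sqrte (\sum_i sqL2 (u i))%E.
Definition vnormH (m : nat) u : \bar R := sqrte (\sum_i sqH m (u i))%E.

Definition gradip u v : R := \sum_i \sum_j ip (dx j (u i)) (dx j (v i)).
Definition gradnorm u : \bar R := sqrte (\sum_i \sum_j sqL2 (dx j (u i)))%E.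
Definition gradnorm_Linf u : \bar R :=
  ess_sup (leb d)
    ((fun x => (Num.sqrt (\sum_i \sum_j dx j (u i) x ^+ 2))%:E) \_ Om).

Definition is_wdiv u p :=
  L2 p /\ forall phi, test_fun phi ->
    vip u (fun i => partial i phi) = - ip p phi.
Definition wdiv u : sfield R d := xget (fun=> 0) [set p | is_wdiv u p].
Definition divfree u := is_wdiv u (fun=> 0).

(* u.n = 0 in H^{-1/2} of the boundary: the normal trace of a field in H(div)
   is the functional psi |-> (u, grad psi) + (div u, psi) on H^1. *)
Definition normal_trace0 u :=
  forall psi, Hspace 1 psi -> vip u (fun i => dx i psi) + ip (wdiv u) psi = 0.

Definition Yspace u := [/\ vL2 u, divfree u & normal_trace0 u].

Definition convect b u : vfield R d := fun i x => \sum_j b j x * dx j (u i) x.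

Definition linear_onX (F : vfield R d -> R) :=
  forall (a : R) u v, Xspace u -> Xspace v ->
    F (fun i x => a * u i x + v i x) = a * F u + F v.

Definition normHm1 (F : vfield R d -> R) : \bar R :=
  if `[< linear_onX F >] then
    ereal_sup [set (`|F v|)%:E | v in [set v | Xspace v /\ (gradnorm v <= 1)%E]]
  else +oo%E.

Definition Hm1 (F : vfield R d -> R) :=
  linear_onX F /\ (normHm1 F < +oo)%E.

End sobolev.

Section bochner.
Context {R : realType} {V : zmodType}.
(* An extended norm: [N v = +oo] when [v] is outside the normed space. *)
Variable N : V -> \bar R.
Local Notation mu := (@lebesgue_measure R).

Definition bochner_measurable (z : R -> V) :=
  exists s : nat -> R -> V,
    (forall k, finite_set (range (s k)) /\
       forall v, measurable (s k @^-1` [set v] : set (measurableTypeR R))) /\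
    {ae mu, forall t, 0 < t -> (fun k => N (s k t - z t)) @ \oo --> 0%E}.

Definition Linf_norm (z : R -> V) : \bar R :=
  ess_sup mu ((N \o z) \_ `]0, +oo[).

Definition Linf (z : R -> V) := bochner_measurable z /\ (Linf_norm z < +oo)%E.

End bochner.

Section navier_stokes.
Context {R : realType} {d : nat}.
Variable Om : set 'rV[R]_d.

(* z is the primitive of z' in L^2, tested against elements of L^2. *)
Definition time_deriv (z z' : R -> vfield R d) :=
  forall s t psi, 0 <= s -> s <= t -> vL2 Om psi ->
    lebesgue_measure.-integrable `[s, t] (fun tau => (vip Om (z' tau) psi)%:E) /\
    vip Om (z t) psi - vip Om (z s) psi =
    \int[lebesgue_measure]_(tau in `[s, t]) vip Om (z' tau) psi.

Definition navier_stokes (nu : R) (f : R -> vfield R d -> R) (w0 : vfield R d)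
    (w wt : R -> vfield R d) (q : R -> sfield R d) :=
  [/\ w 0 = w0,
      time_deriv w wt,
      forall t, 0 <= t -> [/\ Xspace Om (w t), divfree Om (w t) & vL2 Om (wt t)],
      forall t, 0 < t -> Hm1 Om (f t) /\ Qspace Om (q t) &
      forall t v, 0 < t -> Xspace Om v ->
        vip Om (wt t) v + vip Om (convect Om (w t) (w t)) v
        - ip Om (q t) (wdiv Om v) + nu * gradip Om (w t) v = f t v].

Definition Cw (w wt wtt : R -> vfield R d) : \bar R :=
  (Linf_norm (normHm1 Om) (fun t => vip Om (wtt t)) ^+ 2
   + Linf_norm (vnormL2 Om) wt ^+ 2 * Linf_norm (vnormH Om 3) w ^+ 2
   + Linf_norm (gradnorm_Linf Om) w)%E.

Definition Cq (q : R -> sfield R d) : \bar R :=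
  (Linf_norm (normH Om 1) q ^+ 2)%E.

Definition interpolation (H CI rho : R) (k : nat) (M : set (set 'rV[R]_d))
    (IH : vfield R d -> vfield R d) :=
  [/\ regular_conforming_mesh Om rho H M,
      forall phi, Xspace Om phi ->
        vL2 Om (IH phi) /\ piecewise_poly Om M k (IH phi),
      forall (a : R) phi psi, Xspace Om phi -> Xspace Om psi ->
        {ae leb d, forall x, Om x -> forall i,
          IH (fun i x => a * phi i x + psi i x) i x
          = a * IH phi i x + IH psi i x},
      forall phi, Xspace Om phi ->
        (vnormL2 Om (IH phi - phi)%R <= (CI * H)%:E * gradnorm Om phi)%E &
      forall phi, Xspace Om phi ->
        (vnormL2 Om (IH phi) <= CI%:E * vnormL2 Om phi)%E].

(* The trilinear form is not defined on all of Y x X x X: a solution of the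
   first step is one for which it makes sense against every test function. *)
Definition cda_step1 (dt mu nu : R) (IH : vfield R d -> vfield R d)
    (fn : vfield R d -> R) (wn ut u : vfield R d) :=
  Xspace Om u /\
  forall v, Xspace Om v ->
    (leb d).-integrable Om
      (fun x => (\sum_i convect Om ut u i x * v i x)%:E) /\
    dt^-1 * vip Om (u - ut) v + vip Om (convect Om ut u) v
    + nu * gradip Om u v + mu * vip Om (IH (u - wn)) v = fn v.

Definition cda_step2 (dt : R) (u ut : vfield R d) (p : sfield R d) :=
  [/\ Yspace Om ut, Qspace Om p,
      forall v, Yspace Om v ->
        dt^-1 * vip Om (ut - u) v - ip Om p (wdiv Om v) = 0 &
      forall r, Qspace Om r -> ip Om (wdiv Om ut) r = 0].

Definition cda_projection (dt mu nu : R) (IH : vfield R d -> vfield R d)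
    (f : R -> vfield R d -> R) (w0 : vfield R d) (w : R -> vfield R d)
    (u ut : nat -> vfield R d) (p : nat -> sfield R d) :=
  [/\ u 0%N = w0, ut 0%N = w0 &
      forall n, let t := n.+1%:R * dt in
        cda_step1 dt mu nu IH (f t) (w t) (ut n) (u n.+1) /\
        cda_step2 dt (u n.+1) (ut n.+1) (p n.+1)].

End navier_stokes.

(* Main.v *)
(* Testing the error equation with e = u^(n+1) - w^(n+1), the convection term
   (ut^n . grad e, e) vanishes because ut^n is divergence free and e is in
   H^1_0, the nudging term gives 3/4 mu |e|^2 up to nu/2 |grad e|^2, and all
   consistency errors (pressure, time difference, convection) are bounded in L^2
   and absorbed in mu |e|^2 at the price of a constant over mu. Hence, with
   c = (d |grad w|_oo)^2,
     (1/(2dt) + mu/4) |e^(n+1)|^2 <= (1/(2dt) + 4c/mu) |et^n|^2 + K/mu,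
   and the projection gives |et^n| <= |e^n|, because w^n is a fixed point of it.
   If 32 c <= mu^2 this recursion yields |e^n|^2 <= 8K/mu^2 <= 8K dt^2 for all n.
   Otherwise mu, hence 1/dt, is bounded, and it suffices that |e^n| is bounded,
   which follows by testing the first step with u^(n+1) itself.
   The essential bounds in time on w, w_t and grad w hold at every time because
   w and w_t are weakly continuous in L^2. *)

Require Import Defs.
From HB Require Import structures.
From mathcomp Require Import all_boot all_order all_algebra.
From mathcomp Require Import all_classical all_reals all_analysis.
From mathcomp Require Import measurable_realfun ess_sup_inf ring lra.
Set Implicit Arguments.
Unset Strict Implicit.
Unset Printing Implicit Defensive.
Import Order.TTheory GRing.Theory Num.Theory.
Import numFieldNormedType.Exports.
Local Open Scope classical_set_scope.
Local Open Scope ring_scope.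

(** * Smooth functions and bumps *)

(** Weak derivatives and divergences are picked by [xget], so even additivity of [dx] holds only
    almost everywhere, through uniqueness of weak derivatives. That is the fundamental lemma of the
    calculus of variations; it costs bump functions, approximation of indicators in L^1, and
    measurability of open sets for the sigma-algebra of row vectors. The same approximation detects
    a sup bound by testing against L^1, and this form survives the weak limit in time that carries
    the bound on grad w to every t. The consistency errors are bounded, not small: (w^(n+1) -
    w^n)/dt and w_t(t^(n+1)) are estimated separately. No order of consistency is needed, because
    the squared error inherits the factor 1/mu^2 <= dt^2. The pressure term does not vanish, as e is
    not divergence free; with q in H^1 it becomes (grad q, e). The threshold 32 c <= mu^2 says that
    the growth 4c/mu is at most mu/8, half of the damping mu/4. Below it the error recursion may
    amplify. Testing with u^(n+1) is then stable because (ut^n . grad u, u) = 0 leaves no growth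
    factor on |ut^n|^2. *)

Section smooth_functions.
Context {R : realType} {d : nat}.
Local Notation E := 'rV[R]_d.
Implicit Types (f g h : E -> R) (x : E) (i j : 'I_d).

Lemma partialD i f g : (forall x, differentiable f x) ->
  (forall x, differentiable g x) ->
  partial i (f + g) = partial i f + partial i g.
Proof.
by move=> df dg; apply/funext => x; apply: deriveD; exact: diff_derivable.
Qed.

Lemma partialM i f g : (forall x, differentiable f x) ->
  (forall x, differentiable g x) ->
  partial i (f * g) = f * partial i g + g * partial i f.
Proof.
by move=> df dg; apply/funext => x; apply: deriveM; exact: diff_derivable.
Qed.

(** The derivative is spelled as a product of functions so that the closure of [smoothn] under
    products applies to it directly. *)
Lemma partialV i f : (forall x, f x != 0) -> (forall x, differentiable f x) ->
  partial i (fun x => (f x)^-1) =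
  (fun x => -1) * (partial i f * ((fun x => (f x)^-1) * (fun x => (f x)^-1))).
Proof.
move=> f0 df; apply/funext => x; rewrite /partial deriveV //; last exact: diff_derivable.
by rewrite /GRing.scale/= !fctE -invfM expr2; ring.
Qed.

Lemma partial_cst i (c : R) : partial i (fun=> c) = (fun=> 0).
Proof. by apply/funext => x; exact: derive_cst. Qed.

(** [smooth] ranges over lists of directions. Counting the order instead allows induction: a
    derivative of a product or an inverse is built from functions smooth to one order less. *)
Fixpoint smoothn (n : nat) f : Prop :=
  (forall x, differentiable f x) /\
  if n is m.+1 then forall i, smoothn m (partial i f) else True.

Lemma smoothn_diff n f : smoothn n f -> forall x, differentiable f x.
Proof. by case: n => [|n] []. Qed.

(** The innermost derivative is the last entry of the list, hence the induction that grows lists at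
    their end. *)
Lemma smoothP f : smooth f <-> forall n, smoothn n f.
Proof.
split=> [|fn s].
  move=> + n; elim: n f => [|n IH] f sf /=; first by split=> // x; exact: (sf [::]).
  split=> [x|i]; first exact: (sf [::]).
  by apply: IH => s x; rewrite -foldr_rcons; exact: sf.
elim/last_ind: s f fn => [|s i IH] f fn x; first exact: (smoothn_diff (fn 0%N)).
rewrite foldr_rcons; apply: IH => n; exact: (fn n.+1).2.
Qed.

Lemma smoothn_le n f : smoothn n.+1 f -> smoothn n f.
Proof.
elim: n f => [|n IH] f; first by move=> [df _]; split.
by move=> [df sf]; split=> // i; apply: IH; exact: sf.
Qed.

Lemma smoothn_cst n (c : R) : smoothn n (fun=> c).
Proof.
elim: n c => [|n IH] c; first by split=> // x; exact: differentiable_cst.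
split=> [x|i]; first exact: differentiable_cst.
by rewrite partial_cst; exact: IH.
Qed.

Lemma smoothnD n f g : smoothn n f -> smoothn n g -> smoothn n (f + g).
Proof.
elim: n f g => [|n IH] f g [df sf] [dg sg].
  by split=> // x; exact: differentiableD.
split=> [x|i]; first exact: differentiableD.
rewrite partialD //; apply: IH; [exact: sf|exact: sg].
Qed.

Lemma smoothnM n f g : smoothn n f -> smoothn n g -> smoothn n (f * g).
Proof.
elim: n f g => [|n IH] f g; first by move=> [df _] [dg _]; split=> // x; exact: differentiableM.
move=> sf sg; have [df pf] := sf; have [dg pg] := sg.
split=> [x|i]; first exact: differentiableM.
rewrite partialM //; apply: smoothnD; apply: IH;
  by [exact: smoothn_le|exact: pg|exact: pf].
Qed.

Lemma smoothnV n f : (forall x, f x != 0) -> smoothn n f ->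
  smoothn n (fun x => (f x)^-1).
Proof.
move=> f0; elim: n => [|n IH].
  by move=> [df _]; split=> // x; exact: differentiableV.
move=> sf; have [df pf] := sf; split=> [x|i]; first exact: differentiableV.
rewrite partialV //; have ? := IH (smoothn_le sf).
apply: smoothnM; first exact: smoothn_cst.
by apply: smoothnM; [exact: pf|exact: smoothnM].
Qed.

Lemma smooth_cst (c : R) : smooth (fun _ : E => c).
Proof. by apply/smoothP => n; exact: smoothn_cst. Qed.

Lemma smoothD f g : smooth f -> smooth g -> smooth (f + g).
Proof. by move=> /smoothP sf /smoothP sg; apply/smoothP => n; exact: smoothnD. Qed.

Lemma smoothM f g : smooth f -> smooth g -> smooth (f * g).
Proof. by move=> /smoothP sf /smoothP sg; apply/smoothP => n; exact: smoothnM. Qed.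

Lemma smoothV f : (forall x, f x != 0) -> smooth f -> smooth (fun x => (f x)^-1).
Proof. by move=> f0 /smoothP sf; apply/smoothP => n; exact: smoothnV. Qed.

Lemma smooth_partial i f : smooth f -> smooth (partial i f).
Proof. by move=> /smoothP sf; apply/smoothP => n; exact: (sf n.+1).2. Qed.

Lemma smooth_diff f : smooth f -> forall x, differentiable f x.
Proof. by move=> sf; exact: (sf [::]). Qed.

Lemma smooth_prod (I : Type) (r : seq I) (F : I -> E -> R) :
  (forall a, smooth (F a)) -> smooth (fun x => \prod_(a <- r) F a x).
Proof.
move=> sF; elim: r => [|a r IH].
  rewrite (_ : (fun _ => _) = fun=> 1); first exact: smooth_cst.
  by apply/funext => x; rewrite big_nil.
rewrite (_ : (fun _ => _) = F a * (fun x => \prod_(b <- r) F b x)); first exact: smoothM.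
by apply/funext => x; rewrite big_cons.
Qed.

End smooth_functions.

Section bump.
Context {R : realType}.

(* The family [x ^- n * exp (- 1 / x)] is closed under derivation up to linear
   combinations, which makes each member smooth, also at 0. *)
Definition flat (n : nat) (x : R) : R :=
  if 0 < x then x ^- n * expR (- x^-1) else 0.

(** The bound exp y >= y^(n+2)/(n+2)! at y = 1/x leaves two spare powers of x; a quadratic bound is
    what kills the difference quotient at 0. *)
Lemma flat_le n (x : R) : `|flat n x| <= (n.+2)`!%:R * x ^+ 2.
Proof.
rewrite /flat; case: ifPn => x0; last by rewrite normr0 mulr_ge0 // sqr_ge0.
have y0 : 0 < x^-1 by rewrite invr_gt0.
rewrite ger0_norm; last by rewrite mulr_ge0 ?expR_ge0// invr_ge0 exprn_ge0// ltW.
rewrite expRN -exprVn.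
have F0 : 0 < (n.+2)`!%:R :> R by rewrite ltr0n fact_gt0.
have := expR_ge1Dxn n.+1 (ltW y0).
set y := x^-1 in y0 * => H.
have He : y ^+ n.+2 / (n.+2)`!%:R <= expR y by apply: le_trans H; rewrite lerDr.
rewrite ler_pdivrMr ?expR_gt0//.
rewrite ler_pdivrMr// in He.
have -> : y ^+ n = x ^+ 2 * y ^+ n.+2.
  by rewrite -(addn2 n) exprD mulrCA /y [x^-1 ^+ 2]exprVn mulfV ?mulr1// expf_neq0// gt_eqF.
by rewrite [leRHS]mulrAC [leRHS]mulrC ler_pM2l ?exprn_gt0// mulrC.
Qed.

Lemma is_derive_flat n (x : R) :
  is_derive x 1 (flat n) (flat n.+2 x - n%:R * flat n.+1 x).
Proof.
have [x0|x0|->] := ltgtP x 0.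
- apply: (@near_eq_is_derive _ _ _ (fun=> 0)).
    near=> y; rewrite /flat ltNge ltW //; near: y; exact: lt_nbhsl.
  by rewrite /flat ltNge ltW //= mulr0 subr0; exact: is_derive_cst.
- apply: (@near_eq_is_derive R R^o R^o (fun y : R => y^-1 ^+ n * expR (- y^-1))).
    near=> y; rewrite /flat ifT ?exprVn//; near: y; exact: lt_nbhsr.
  rewrite /flat x0.
  have dV : is_derive x (1:R) (fun y : R => y^-1) (- x ^- 2).
    have := @derivableV R R^o id x 1 (lt0r_neq0 x0) (@derivable_id _ _ _ _).
    move=> /derivableP; rewrite deriveV ?lt0r_neq0// derive_id.
    by rewrite /GRing.scale/= mulr1.
  have dVn : is_derive x (1:R) (fun y : R => y^-1 ^+ n) (- (n%:R * x ^- n.+1)).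
    case: n => [|n]; first by rewrite mul0r oppr0; exact: is_derive_cst.
    have := @is_deriveX _ _ (fun y : R => y^-1) n.+1 x 1 _ dV.
    rewrite exprfctE => /is_derive_eq; apply.
    rewrite /GRing.scale/= -!exprVn !exprS expr0; ring.
  have dE : is_derive x (1:R) (fun y : R => expR (- y^-1)) (expR (- x^-1) * x ^- 2).
    have dN := @is_deriveN _ _ _ _ x 1 _ dV; rewrite opprK in dN.
    have := @is_derive1_comp _ expR (- (fun y : R => y^-1)) x _ _ (is_derive_expR _) dN.
    by move=> /is_derive_eq; apply; rewrite mulrC.
  have := @is_deriveM _ _ _ _ x 1 _ _ dVn dE.
  move=> /is_derive_eq; apply.
  rewrite /GRing.scale/= -!exprVn !exprS; ring.
(* At 0 the claimed derivative is 0, and by [flat_le] the difference quotient is at most (n+2)!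
   |h|. *)
- rewrite {2 3}/flat ltxx mulr0 subr0.
  apply: DeriveDef; last first.
  all: have cv : (fun h : R => h^-1 *: (flat n (h *: 1 + 0) - flat n 0)) @ 0^' --> (0:R).
  1,3: apply/cvgr0Pnorm_le => e e0; near=> h.
  1,2: have h0 : h != 0 by near: h; exact: nbhs_dnbhs_neq.
  1,2: rewrite /= addr0 [h *: _]mulr1 {2}/flat ltxx subr0 normrM normfV.
  1,2: rewrite ler_pdivrMl ?normr_gt0//; apply: le_trans (flat_le _ _) _.
  1,2: rewrite -real_normK ?num_real// expr2 mulrA mulrC ler_pM2l ?normr_gt0//.
  1,2: rewrite -ler_pdivlMl ?ltr0n ?fact_gt0//.
  1,2: near: h; apply: dnbhs0_le; rewrite mulr_gt0// invr_gt0 ltr0n fact_gt0 //.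
  + exact/cvg_lim.
  + by apply/cvg_ex; exists 0.
Unshelve. all: by end_near. Qed.

Lemma diff_flat n (x : R) : differentiable (flat n) x.
Proof. by apply/derivable1_diffP; have [] := is_derive_flat n x. Qed.

Lemma flat_gt0 n (x : R) : (0 < flat n x) = (0 < x).
Proof.
rewrite /flat; case: ifPn; rewrite ?ltxx// => x0.
by rewrite mulr_gt0 ?expR_gt0// invr_gt0 exprn_gt0.
Qed.

Lemma flat_ge0 n (x : R) : 0 <= flat n x.
Proof.
rewrite /flat; case: ifPn => // x0.
by rewrite mulr_ge0 ?expR_ge0// invr_ge0 exprn_ge0// ltW.
Qed.

Context {d : nat}.
Local Notation E := 'rV[R]_d.

Lemma diff_affine_coord (i : 'I_d) (s c : R) (x : E) :
  differentiable (fun y : E => s * y ord0 i + c) x.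
Proof.
apply: differentiableD; last exact: differentiable_cst.
apply: (@differentiableZ _ _ _ (fun y : E => y ord0 i) s x).
exact: differentiable_coord.
Qed.

Lemma derive_affine_coord (i j : 'I_d) (s c : R) (x : E) :
  is_derive x (delta_mx ord0 j : E) (fun y : E => s * y ord0 i + c) (s * (i == j)%:R).
Proof.
apply: DeriveDef; first exact/diff_derivable/diff_affine_coord.
rewrite /derive.
apply: cvg_lim => //; apply: cvg_near_cst; near=> h.
have h0 : h != 0 by near: h; exact: nbhs_dnbhs_neq.
rewrite /= !mxE eqxx/= /GRing.scale/=.
have -> : s * (h * (i == j)%:R + x ord0 i) + c - (s * x ord0 i + c) = 
  h * (s * (i == j)%:R) by ring.
by rewrite mulrA mulVf ?mul1r.
Unshelve. all: by end_near. Qed.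

(** The index [n] stays general in the induction because a derivative raises it to [n.+2] and
    [n.+1]. The affine argument serves both ends of an interval, with [s] equal to 1 or -1. *)
Lemma smooth_flat n (i : 'I_d) (s c : R) :
  smooth (fun x : E => flat n (s * x ord0 i + c)).
Proof.
have df m (x : E) : differentiable (fun x : E => flat m (s * x ord0 i + c)) x.
  by apply: (differentiable_comp (diff_affine_coord _ _ _ _)); exact: diff_flat.
apply/smoothP => k; elim: k n => [|k IH] n; first by split.
split=> // j.
rewrite (_ : partial j _ = (fun=> s * (i == j)%:R) *
  ((fun x : E => flat n.+2 (s * x ord0 i + c)) +
    (fun=> - n%:R) * (fun x : E => flat n.+1 (s * x ord0 i + c)))); last first.
  apply/funext => x; rewrite /partial deriveE //.
  rewrite (@diff_comp _ _ _ _ (fun y : E => s * y ord0 i + c) (flat n)) //=; last first.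
    exact: diff_flat.
    exact: diff_affine_coord.
  rewrite -(deriveE _ (diff_affine_coord i s c x)).
  have [_ ->] := derive_affine_coord i j s c x.
  have [_ D] := is_derive_flat n (s * x ord0 i + c).
  rewrite deriv1E; last by have [] := is_derive_flat n (s * x ord0 i + c).
  rewrite derive1E D !fctE /GRing.scale/=; ring.
apply: smoothnM; first exact: smoothn_cst.
apply: smoothnD => //; apply: smoothnM => //; exact: smoothn_cst.
Qed.

End bump.

(** * Cubes, measurability of open sets, and finite measure of bounded sets *)

Section cubes.
Context {R : realType} {d : nat}.
Local Notation E := 'rV[R]_d.
Implicit Types (a x y : E) (U : set E).

Definition cube a (r : R) : set E := [set x | forall i, `|a ord0 i - x ord0 i| < r].

Definition ccube a (r : R) : set E := [set x | forall i, `|a ord0 i - x ord0 i| <= r].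

Lemma ccubeE a r : ccube a r = [set x | forall i, `[a ord0 i - r, a ord0 i + r]%classic (x ord0 i)].
Proof.
by apply/seteqP; split=> x /= H i; move: (H i); rewrite in_itv/= ler_distlC.
Qed.

Lemma ccube_compact a r : compact (ccube a r).
Proof. by rewrite ccubeE; apply: (@rV_compact R d (fun i => `[a ord0 i - r, a ord0 i + r]%classic)) => i; exact: segment_compact. Qed.

Lemma ccube_closed a r : closed (ccube a r).
Proof.
by apply: compact_closed; [exact: norm_hausdorff|exact: ccube_compact].
Qed.

Lemma cube_ccube a r : cube a r `<=` ccube a r.
Proof. by move=> x xa i; exact: ltW. Qed.

Lemma cube_measurable a r : measurable (cube a r).
Proof.
rewrite (_ : cube a r = \bigcap_(i in [set: 'I_d])
    row_coord i @^-1` `](a ord0 i - r), (a ord0 i + r)[%classic).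
  apply: fin_bigcap_measurable => [|i _]; first exact: finite_finset.
  rewrite -[X in measurable X]setTI; apply: measurable_row_coord => //.
apply/seteqP; split=> x /= H i; last by move: (H i I); rewrite /row_coord/= in_itv/= ltr_distlC.
by move=> _; move: (H i); rewrite /row_coord/= in_itv/= ltr_distlC.
Qed.

Lemma ball_rowE x (e : R) y : ball x e y <-> 0 < e /\ forall i, `|x ord0 i - y ord0 i| < e.
Proof.
split=> [[e0 H]|[e0 H]]; split=> //; first by move=> i; exact: (H ord0 i).
by move=> i j; rewrite (ord1 i); exact: H.
Qed.

(** Rational centres and radii 1/(n+1) form a countable family, enumerated by [unpickle]; codes of
    inadmissible pairs give the empty set. The closed cube is kept inside [U] so that bumps on the
    open cube have compact support there. *)
Lemma open_cubes U : open U -> exists F : nat -> set E,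
  U = \bigcup_n F n /\
  forall n, F n = set0 \/ exists a r, [/\ 0 < r, F n = cube a r & ccube a r `<=` U].
Proof.
move=> oU.
pose c (p : 'rV[rat]_d) : E := map_mx ratr p.
pose rad (n : nat) : R := n.+1%:R^-1.
have rad0 n : 0 < rad n by rewrite invr_gt0 ltr0n.
pose F n : set E := if @unpickle ('rV[rat]_d * nat)%type n is Some p then
  if `[< ccube (c p.1) (rad p.2) `<=` U >] then cube (c p.1) (rad p.2) else set0
  else set0.
exists F; split; last first.
  move=> n; rewrite /F; case: unpickle => [p|]; last by left.
  by case: asboolP => H; [right; exists (c p.1), (rad p.2)|left].
apply/seteqP; split=> x; last first.
  move=> [n _]; rewrite /F; case: unpickle => [p|//].
  by case: asboolP => // H /cube_ccube /H.
move=> Ux; have /nbhs_ballP[e /= e0 xeU] : nbhs x U by exact: open_nbhs_nbhs.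
(* Half of [e], since a point of the cube is within [rad n] of the centre, and so is [x]. *)
have [n ne] : exists n, rad n < e / 2.
  by have [n _ /(_ n (leqnn _))] := near_infty_natSinv_lt (PosNum (divr_gt0 e0 (ltr0Sn R 1))); exists n.
have qP i : exists q : rat, `|ratr q - x ord0 i| < rad n.
  have : x ord0 i - rad n < x ord0 i + rad n by have := rad0 n; lra.
  by move=> /rat_in_itvoo[q]; rewrite in_itv/= -ltr_distl; exists q.
have [q qx] := choice qP.
pose p := \row_i q i.
exists (pickle (p, n)) => //; rewrite /F pickleK /= asboolT.
  by move=> i; rewrite !mxE.
move=> y yp; apply: xeU; apply/ball_rowE; split=> // i.
have := qx i; have := yp i; rewrite !mxE => H1 H2.
have := ler_distD (ratr (q i)) (x ord0 i) (y ord0 i).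
rewrite (distrC (x _ _) (ratr _)); lra.
Qed.

(** The sigma-algebra is generated by coordinates, which yields boxes; a general open set needs the
    countable decomposition. *)
Lemma open_measurable_row U : open U -> measurable U.
Proof.
move=> /open_cubes[F [-> FP]]; apply: bigcupT_measurable => n.
have [->|[a [r [_ -> _]]]] := FP n; [exact: measurable0|exact: cube_measurable].
Qed.

Lemma continuous_measurable_row (D : set E) (f : E -> R) : continuous f ->
  measurable_fun D f.
Proof.
move=> cf; apply: (measurable_funS measurableT) => //.
apply: (measurability _ (RGenOpens.measurableE R)) => _ [_ [a [b ->]] <-].
rewrite setTI; apply: open_measurable_row; have oA : open `]a, b[%classic by exact: interval_open.
by apply: open_comp => // x _; exact: cf.
Qed.

End cubes.

Section leb_finite.
Context {R : realType}.

(** [leb] adds one coordinate at a time, and the preimage of a closed cube under [row_cons] is a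
    lower cube times an interval. *)
Lemma leb_ccube_finite n (M : R) : (leb n (ccube (0 : 'rV[R]_n) M) < +oo)%E.
Proof.
elim: n => [|n IH].
  apply: le_lt_trans (ltry 1); rewrite /= diracE; by case: (_ \in _).
rewrite /= /leb_next /pushforward.
have -> : @row_cons R n @^-1` ccube 0 M = ccube 0 M `*` `[- M, M]%classic.
  apply/seteqP; split=> -[x t] /=.
    move=> H; split.
      move=> i; have := H (lift ord0 i); by rewrite !mxE liftK.
    by have := H ord0; rewrite !mxE unlift_none sub0r normrN in_itv/= -ler_norml.
  move=> [H1 H2] i; rewrite !mxE; case: unliftP => [j _|_].
    by have := H1 j; rewrite !mxE.
  by rewrite sub0r normrN ler_norml; move: H2; rewrite in_itv.
have mc : measurable (ccube (0 : 'rV[R]_n) M).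
  rewrite -[ccube _ _]setCK; apply: measurableC; apply: open_measurable_row.
  by rewrite openC; exact: ccube_closed.
rewrite product_measure1E //=.
rewrite lebesgue_measure_itv/=; case: ifP => _; last by rewrite mule0.
by rewrite lte_mul_pinfty// ?ge0_fin_numE// ltry.
Qed.

Lemma leb_bounded_finite d (A : set 'rV[R]_d) : measurable A -> bounded_set A ->
  (leb d A < +oo)%E.
Proof.
move=> mA [M [_ /(_ (M + 1))]]; rewrite ltrDl ltr01 => /(_ isT) AM.
apply: le_lt_trans (leb_ccube_finite d (M + 1)).
apply: le_measure; rewrite ?inE//.
  rewrite -[ccube _ _]setCK; apply: measurableC; apply: open_measurable_row.
  by rewrite openC; exact: ccube_closed.
move=> x /AM xM i; apply: le_trans xM; rewrite mxE sub0r normrN.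
by rewrite [leRHS]mx_normrE; apply: le_trans (le_bigmax _ _ (ord0, i)).
Qed.

End leb_finite.

(** * Test functions *)

Section test_functions.
Context {R : realType} {d : nat}.
Local Notation E := 'rV[R]_d.
Variable Om : set E.
Implicit Types (f g phi psi : E -> R) (a x y : E).

Lemma test_fun_sub f g : smooth f -> [set x | f x != 0] `<=` [set x | g x != 0] ->
  test_fun Om g -> test_fun Om f.
Proof.
move=> sf fg [sg cg gOm]; have fg' := closure_subset fg; split=> //.
  by apply: subclosed_compact fg' => //; exact: closed_closure.
exact: subset_trans gOm.
Qed.

Lemma test_fun_smooth f : test_fun Om f -> smooth f.
Proof. by case. Qed.

Lemma test_fun0 : test_fun Om (fun=> 0).
Proof.
split; first exact: smooth_cst.
all: rewrite (_ : [set _ | _] = set0) ?closure0; last by apply/seteqP; split=> x //=; rewrite eqxx.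
  exact: compact0.
exact: sub0set.
Qed.

Lemma test_funMl f g : smooth f -> test_fun Om g -> test_fun Om (f * g).
Proof.
move=> sf tg; apply: test_fun_sub (tg); first by apply: smoothM => //; case: tg.
by move=> x /=; rewrite !fctE mulf_eq0 negb_or => /andP[].
Qed.

Lemma test_funD f g : test_fun Om f -> test_fun Om g -> test_fun Om (f + g).
Proof.
move=> [sf cf fO] [sg cg gO].
have fg : closure [set x | (f + g) x != 0] `<=`
    closure [set x | f x != 0] `|` closure [set x | g x != 0].
  rewrite -closureU; apply: closure_subset => x /=.
  have [fx|] := eqVneq (f x) 0; last by left.
  have [gx|] := eqVneq (g x) 0; last by right.
  by rewrite !fctE fx gx addr0 eqxx.
split; first exact: smoothD.
  apply: subclosed_compact fg; first exact: closed_closure.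
  have := @bigsetU_compact E _ (fun b : bool => if b then closure [set x | f x != 0] else closure [set x | g x != 0]) [:: true; false] xpredT.
  rewrite !big_cons big_nil setU0; apply.
  by case.
by move=> x /fg [/fO|/gO].
Qed.

Lemma test_funZ (c : R) f : test_fun Om f -> test_fun Om (fun x => c * f x).
Proof. by move=> tf; apply: test_funMl tf; exact: smooth_cst. Qed.

Lemma test_funB f g : test_fun Om f -> test_fun Om g -> test_fun Om (f - g).
Proof.
move=> tf tg; rewrite (_ : f - g = f + (fun x => -1 * g x)).
  by apply: test_funD => //; exact: test_funZ.
by apply/funext => x; rewrite !fctE mulN1r.
Qed.

Lemma partial_supp i f : [set x | partial i f x != 0] `<=` closure [set x | f x != 0].
Proof.
move=> x /=; apply: contraNP => xf; apply/eqP.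
have : nbhs x (~` closure [set x | f x != 0]).
  by apply: open_nbhs_nbhs; split=> //; rewrite openC; exact: closed_closure.
move=> fx0; rewrite /partial -(@near_eq_derive _ _ _ (fun=> 0)) ?derive_cst//.
apply: filterS fx0 => y yf; apply/esym/eqP; apply: contra_notT yf => ?.
exact: subset_closure.
Qed.

Lemma test_fun_partial i f : test_fun Om f -> test_fun Om (partial i f).
Proof.
move=> [sf cf fO].
have sub : closure [set x | partial i f x != 0] `<=` closure [set x | f x != 0].
  rewrite [X in _ `<=` X](closure_id _).1; last exact: closed_closure.
  exact/closure_subset/partial_supp.
split; first exact: smooth_partial.
  by apply: subclosed_compact sub => //; exact: closed_closure.
exact: subset_trans fO.
Qed.

Lemma test_fun_continuous f : test_fun Om f -> continuous f.
Proof. by move=> [sf _ _] x; apply: differentiable_continuous; exact: smooth_diff. Qed.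

Lemma test_fun_measurable (D : set E) f : test_fun Om f -> measurable_fun D f.
Proof. by move=> tf; apply: continuous_measurable_row; exact: test_fun_continuous. Qed.

Lemma test_fun_bounded f : test_fun Om f -> exists M, forall x, `|f x| <= M.
Proof.
move=> tf; have [_ cf _] := tf.
have : compact (f @` closure [set x | f x != 0]).
  apply: continuous_compact => //; apply: continuous_subspaceT.
  exact: test_fun_continuous.
move=> /compact_bounded[M [_ /(_ (Num.max (M + 1) 0))]].
rewrite lt_max ltrDl ltr01 => /(_ isT) H; exists (Num.max (M + 1) 0) => x.
have [->|fx] := eqVneq (f x) 0; first by rewrite normr0 le_max lexx orbT.
by apply: H; exists x => //; exact: subset_closure.
Qed.

(** A product over the coordinates of two one-sided flat functions, one vanishing below and one
    above the interval: it is positive exactly where all factors are. *)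
Lemma cube_bump a r : ccube a r `<=` Om -> exists psi,
  [/\ test_fun Om psi, forall x, 0 <= psi x & forall x, 0 < psi x <-> cube a r x].
Proof.
move=> aOm.
pose psi (x : E) := \prod_i (flat 0 (1 * x ord0 i + (r - a ord0 i)) *
   flat 0 (- 1 * x ord0 i + (r + a ord0 i))).
have psi0 x : 0 <= psi x.
  by apply: prodr_ge0 => i _; rewrite mulr_ge0 ?flat_ge0.
have psi1 x : 0 < psi x <-> cube a r x.
  split.
    rewrite lt0r => /andP[/prodf_neq0 H _] i.
    have := H i isT; rewrite mulf_eq0 negb_or => /andP[].
    rewrite !neq_lt !ltNge !flat_ge0/= -!ltNge !flat_gt0 ltr_distlC mul1r mulN1r.
    by move=> ? ?; apply/andP; split; lra.
  move=> H; apply: prodr_gt0 => i _; have := H i.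
  rewrite ltr_distlC => /andP[? ?].
  by rewrite mulr_gt0// flat_gt0; lra.
have sub : [set x | psi x != 0] `<=` ccube a r.
  by move=> x /= p0; apply: cube_ccube; apply/psi1; rewrite lt0r p0 psi0.
have sub' : closure [set x | psi x != 0] `<=` ccube a r.
  by rewrite (closure_id (ccube a r)).1; [exact: closure_subset|exact: ccube_closed].
exists psi; split=> //; split.
- apply: smooth_prod => i.
  by apply: smoothM; exact: smooth_flat.
- by apply: subclosed_compact sub'; [exact: closed_closure|exact: ccube_compact].
- exact: subset_trans aOm.
Qed.

End test_functions.

(** * Square-integrable functions *)

Section L2_calculus.
Context {R : realType} {d : nat}.
Variable Om : set 'rV[R]_d.
Hypothesis mOm : measurable Om.
Local Notation E := 'rV[R]_d.
Local Notation mu := (leb d).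
Implicit Types (f g h p r : E -> R).

Definition Int h := mu.-integrable Om (EFin \o h).

Lemma Int_meas h : Int h -> measurable_fun Om h.
Proof. by move=> /measurable_int /measurable_EFinP. Qed.

Lemma Int_le h g : measurable_fun Om h -> Int g ->
  (forall x, Om x -> `|h x| <= g x) -> Int h.
Proof.
move=> mh ig hg; apply: (le_integrable mOm) ig; first exact/measurable_EFinP.
move=> x Ox; rewrite /= lee_fin; apply: le_trans (hg x Ox) _; exact: ler_norm.
Qed.

Lemma IntD h g : Int h -> Int g -> Int (fun x => h x + g x).
Proof. move=> ih ig; exact: (integrableD mOm ih ig). Qed.

Lemma IntZ (c : R) h : Int h -> Int (fun x => c * h x).
Proof. move=> ih; exact: (integrableZl mOm c ih). Qed.

Lemma IntN h : Int h -> Int (fun x => - h x).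
Proof.
move=> ih; rewrite (_ : (fun x => - h x) = (fun x => -1 * h x)); first exact: IntZ.
by apply/funext => x; rewrite mulN1r.
Qed.

Lemma IntB h g : Int h -> Int g -> Int (fun x => h x - g x).
Proof. by move=> ih ig; apply: IntD => //; exact: IntN. Qed.

Lemma Int_abs h : Int h -> Int (fun x => `|h x|).
Proof. exact: integrable_norm. Qed.

Lemma Int0 : Int (fun=> 0).
Proof. exact: integrable0. Qed.

Lemma Int_sum (I : Type) (s : seq I) (h : I -> E -> R) :
  (forall i, Int (h i)) -> Int (fun x => \sum_(i <- s) h i x).
Proof.
move=> ih; elim: s => [|i s IH].
  by under eq_fun do rewrite big_nil; exact: Int0.
by under eq_fun do rewrite big_cons; exact: IntD.
Qed.

Lemma I_sum (I : Type) (s : seq I) (h : I -> E -> R) :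
  (forall i, Int (h i)) ->
  \int[mu]_(x in Om) (\sum_(i <- s) h i x) = \sum_(i <- s) \int[mu]_(x in Om) h i x.
Proof.
move=> ih; elim: s => [|i s IH].
  rewrite big_nil; under eq_fun do rewrite big_nil.
  by rewrite Rintegral_cst// mul0r.
rewrite big_cons -IH; under eq_fun do rewrite big_cons.
by rewrite RintegralD//; [exact: ih|exact: Int_sum].
Qed.

Lemma I_ae h g : measurable_fun Om h -> measurable_fun Om g ->
  (\forall x \ae mu, Om x -> h x = g x) ->
  \int[mu]_(x in Om) h x = \int[mu]_(x in Om) g x.
Proof.
move=> mh mg hg; congr fine; apply: ae_eq_integral => //; [exact/measurable_EFinP..|].
by apply: filterS hg => x H Ox /=; rewrite H.
Qed.

Lemma Int_ae h g : measurable_fun Om g ->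
  (\forall x \ae mu, Om x -> h x = g x) -> Int h -> Int g.
Proof.
move=> mg hg ih; have mh := Int_meas ih.
move/integrableP: ih => [_ ih]; apply/integrableP; split; first exact/measurable_EFinP.
rewrite -(ae_eq_integral (fun x => `|(EFin \o g) x|)%E (fun x => `|(EFin \o h) x|)%E)//.
- by apply: measurableT_comp => //; exact/measurable_EFinP.
- by apply: measurableT_comp => //; exact/measurable_EFinP.
- by apply: filterS hg => x H Ox /=; rewrite H.
Qed.

Lemma I_le_ae h g : Int h -> Int g ->
  (\forall x \ae mu, Om x -> h x <= g x) ->
  \int[mu]_(x in Om) h x <= \int[mu]_(x in Om) g x.
Proof.
move=> ih ig hg; rewrite -subr_ge0 -RintegralB//.
have mh := Int_meas ih; have mg := Int_meas ig.
have mB : measurable_fun Om (fun x => g x - h x) by exact: measurable_funB.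
rewrite (@I_ae _ (fun x => Num.max (g x - h x) 0))//.
- by apply: Rintegral_ge0 => x _; rewrite le_max lexx orbT.
- exact: measurable_maxr.
- apply: filterS hg => x H /H; rewrite -subr_ge0 => H'.
  by rewrite (elimT max_idPl H').
Qed.

Lemma I_abs_le_ae h g : Int h -> Int g ->
  (\forall x \ae mu, Om x -> `|h x| <= g x) ->
  `|\int[mu]_(x in Om) h x| <= \int[mu]_(x in Om) g x.
Proof.
move=> ih ig hg; apply: (le_trans (le_normr_Rintegral mOm ih)).
by apply: I_le_ae => //; exact: Int_abs.
Qed.

Lemma I_abs_le h g : Int h -> Int g -> (forall x, Om x -> `|h x| <= g x) ->
  `|\int[mu]_(x in Om) h x| <= \int[mu]_(x in Om) g x.
Proof. by move=> ih ig hg; apply: I_abs_le_ae => //; apply: aeW => x; exact: hg. Qed.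

Lemma I_ge0_eq0 h : Int h -> (forall x, 0 <= h x) ->
  \int[mu]_(x in Om) h x <= 0 -> \forall x \ae mu, Om x -> h x = 0.
Proof.
move=> ih h0 hle.
have H0 : (\int[mu]_(x in Om) `|(h x)%:E| = 0)%E.
  under eq_integral do rewrite /= ger0_norm//.
  have : \int[mu]_(x in Om) h x = 0.
    by apply/eqP; rewrite eq_le hle Rintegral_ge0.
  rewrite /Rintegral => H; rewrite -[LHS]fineK ?H//.
  exact: integrable_fin_num.
have := (ae_eq_integral_abs mu mOm (measurable_int _ ih)).1 H0.
by apply: filterS => x H Ox; have := H Ox => -[].
Qed.

Lemma L2P p : L2 Om p <-> measurable_fun Om p /\ Int (fun x => p x ^+ 2).
Proof.
have E2 : (\int[mu]_(x in Om) `|(p x ^+ 2)%:E| = sqL2 Om p)%E.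
  by apply: eq_integral => x _; rewrite gee0_abs// lee_fin sqr_ge0.
split=> -[mp].
  move=> H; split=> //; apply/integrableP; split; last by rewrite [ltLHS]E2.
  by apply/measurable_EFinP; exact: measurable_funX.
by move=> /integrableP[_]; rewrite [X in (X < _)%E]E2 => H; split.
Qed.

Lemma L2_meas p : L2 Om p -> measurable_fun Om p.
Proof. by case. Qed.

Lemma L2M p r : L2 Om p -> L2 Om r -> Int (fun x => p x * r x).
Proof.
move=> /L2P[mp ip2] /L2P[mr ir2].
apply: (@Int_le _ (fun x => p x ^+ 2 + r x ^+ 2)).
- exact: measurable_funM.
- exact: IntD.
- move=> x _; rewrite normrM -(real_normK (num_real (p x))) -(real_normK (num_real (r x))).
  have := sqr_ge0 (`|p x| - `|r x|); have := mulr_ge0 (normr_ge0 (p x)) (normr_ge0 (r x)).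
  nra.
Qed.

Lemma L2_le p r : measurable_fun Om p -> L2 Om r ->
  (forall x, Om x -> `|p x| <= `|r x|) -> L2 Om p.
Proof.
move=> mp /L2P[mr ir] pr; apply/L2P; split=> //.
apply: Int_le ir _; first exact: measurable_funX.
move=> x Ox; rewrite normrX -(real_normK (num_real (r x))).
by rewrite lerXn2r ?nnegrE// pr.
Qed.

Lemma L2Z (c : R) p : L2 Om p -> L2 Om (fun x => c * p x).
Proof.
move=> /L2P[mp ip2]; apply/L2P; split; first exact: measurable_funM.
by under eq_fun do rewrite exprMn; exact: IntZ.
Qed.

Lemma L2D p r : L2 Om p -> L2 Om r -> L2 Om (fun x => p x + r x).
Proof.
move=> Lp Lr; have i2 := L2M Lp Lr.
move: Lp Lr => /L2P[mp ip2] /L2P[mr ir2]; apply/L2P; split.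
  exact: measurable_funD.
rewrite (_ : (fun x => _) = (fun x => p x ^+ 2 + 2 * (p x * r x) + r x ^+ 2)).
  by apply: IntD => //; apply: IntD => //; exact: IntZ.
by apply/funext => x; ring.
Qed.

Lemma L2N p : L2 Om p -> L2 Om (fun x => - p x).
Proof.
move=> Lp; rewrite (_ : (fun x => _) = (fun x => -1 * p x)); first exact: L2Z.
by apply/funext => x; rewrite mulN1r.
Qed.

Lemma L2B p r : L2 Om p -> L2 Om r -> L2 Om (fun x => p x - r x).
Proof. by move=> Lp Lr; apply: L2D => //; exact: L2N. Qed.

Lemma L2_0 : L2 Om (fun=> 0).
Proof.
by apply/L2P; split; [exact: measurable_cst|under eq_fun do rewrite expr0n; exact: Int0].
Qed.

Lemma L2_sum (I : Type) (s : seq I) (h : I -> E -> R) :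
  (forall i, L2 Om (h i)) -> L2 Om (fun x => \sum_(i <- s) h i x).
Proof.
move=> ih; elim: s => [|i s IH].
  by under eq_fun do rewrite big_nil; exact: L2_0.
by under eq_fun do rewrite big_cons; exact: L2D.
Qed.

Lemma L2_ae p r : measurable_fun Om r ->
  (\forall x \ae mu, Om x -> p x = r x) -> L2 Om p -> L2 Om r.
Proof.
move=> mr pr /L2P[mp ip2]; apply/L2P; split=> //.
apply: Int_ae ip2; first exact: measurable_funX.
by apply: filterS pr => x H /H ->.
Qed.

(** Truncating [g] at [K] and [- K] changes it on a null set only and makes the bound hold
    everywhere. *)
Lemma L2M_bounded_ae p g (K : R) : L2 Om p -> measurable_fun Om g ->
  (\forall x \ae mu, Om x -> `|g x| <= K) -> L2 Om (fun x => g x * p x).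
Proof.
move=> Lp mg gK; have [mp _] := Lp.
pose g' x := Num.max (Num.min (g x) K) (- K).
have K0 x : `|g x| <= K -> g' x = g x.
  rewrite ler_norml /g' => /andP[? ?].
  by rewrite (elimT min_idPl)// (elimT max_idPl).
have mg' : measurable_fun Om g'.
  by apply: measurable_maxr => //; exact: measurable_minr.
apply: (@L2_ae (fun x => g' x * p x)).
- exact: measurable_funM.
- by apply: filterS gK => x H /H /K0 ->.
apply: (@L2_le _ (fun x => K * p x)); [exact: measurable_funM|exact: L2Z|].
move=> x _; rewrite !normrM ler_wpM2r// /g'.
have [K0'|K0'] := leP 0 K.
  rewrite (ger0_norm K0') ler_norml le_max lexx orbT /= ge_max ge_min lexx orbT /=.
  by rewrite ge0_cp.
(* For negative [K] the truncation is the constant [- K], whose absolute value is still that of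
   [K]. *)
rewrite (elimT max_idPr) ?normrN// ge_min; apply/orP; right; lra.
Qed.

Lemma ipC p r : ip Om p r = ip Om r p.
Proof. by rewrite /ip; under eq_Rintegral do rewrite mulrC. Qed.

Lemma ipBl p p' r : L2 Om p -> L2 Om p' -> L2 Om r ->
  ip Om (fun x => p x - p' x) r = ip Om p r - ip Om p' r.
Proof.
move=> Lp Lp' Lr; rewrite /ip -RintegralB//; [|exact: L2M..].
by apply: eq_Rintegral => x _; rewrite mulrBl.
Qed.

Lemma ipZl (c : R) p r : L2 Om p -> L2 Om r ->
  ip Om (fun x => c * p x) r = c * ip Om p r.
Proof.
move=> Lp Lr; rewrite /ip -RintegralZl//; last exact: L2M.
by apply: eq_Rintegral => x _; rewrite mulrA.
Qed.

Lemma ipBr p p' r : L2 Om p -> L2 Om p' -> L2 Om r ->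
  ip Om r (fun x => p x - p' x) = ip Om r p - ip Om r p'.
Proof. by move=> *; rewrite ipC ipBl// !(ipC r). Qed.

Lemma ip_sumr (I : Type) (s : seq I) (h : I -> E -> R) p :
  (forall i, L2 Om (h i)) -> L2 Om p ->
  ip Om p (fun x => \sum_(i <- s) h i x) = \sum_(i <- s) ip Om p (h i).
Proof.
move=> Lh Lp; rewrite /ip -I_sum; last by move=> i; exact: L2M.
by apply: eq_Rintegral => x _; rewrite mulr_sumr.
Qed.

Lemma ip_ge0 p : 0 <= ip Om p p.
Proof. by apply: Rintegral_ge0 => x _; rewrite -expr2 sqr_ge0. Qed.

Lemma sqL2E p : L2 Om p -> sqL2 Om p = (ip Om p p)%:E.
Proof.
move=> /L2P[mp ip2]; rewrite /ip /Rintegral fineK; last first.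
  apply: integrable_fin_num => //.
by apply: eq_integral => x _; rewrite expr2.
Qed.

Lemma ip_ae p p' r : measurable_fun Om p -> measurable_fun Om p' -> measurable_fun Om r ->
  (\forall x \ae mu, Om x -> p x = p' x) -> ip Om p r = ip Om p' r.
Proof.
move=> mp mp' mr pp'; apply: I_ae; [exact: measurable_funM..|].
by apply: filterS pp' => x H /H ->.
Qed.

Lemma sqL2_ae p p' : measurable_fun Om p -> measurable_fun Om p' ->
  (\forall x \ae mu, Om x -> p x = p' x) -> sqL2 Om p = sqL2 Om p'.
Proof.
move=> mp mp' pp'; apply: ae_eq_integral => //.
- by apply/measurable_EFinP; exact: measurable_funX.
- by apply/measurable_EFinP; exact: measurable_funX.
- by apply: filterS pp' => x H /H ->.
Qed.

(** It replaces the Cauchy-Schwarz inequality throughout: only quadratic quantities appear, and the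
    weight [a] decides how much of each term is absorbed. *)
Lemma ip_young (a : R) p r : 0 < a -> L2 Om p -> L2 Om r ->
  2 * `|ip Om p r| <= a * ip Om p p + a^-1 * ip Om r r.
Proof.
move=> a0 Lp Lr.
have := @I_abs_le (fun x => p x * r x) (fun x => 2^-1 * (a * (p x * p x) + a^-1 * (r x * r x))).
have i1 := IntZ a (L2M Lp Lp); have i2 := IntZ a^-1 (L2M Lr Lr).
move=> /(_ (L2M Lp Lr) (IntZ _ (IntD i1 i2))).
rewrite RintegralZl//; last exact: IntD.
rewrite RintegralD// !RintegralZl//; [|exact: L2M..].
rewrite -/(ip Om p p) -/(ip Om r r) -/(ip Om p r) => H.
have {}H : `|ip Om p r| <= 2^-1 * (a * ip Om p p + a^-1 * ip Om r r).
  apply: H => x _; set b := a^-1; have ab : a * b = 1 by rewrite /b mulfV// gt_eqF.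
  have b0 : 0 < b by rewrite invr_gt0.
  rewrite ler_norml; apply/andP; split.
    suff : 0 <= b * (a * p x + r x) ^+ 2.
      have -> : b * (a * p x + r x) ^+ 2 = (a * b) * (a * (p x * p x)) + 2 * (a * b) * (p x * r x) + b * (r x * r x) by ring.
      rewrite ab; lra.
    by rewrite mulr_ge0 ?sqr_ge0// ltW.
  suff : 0 <= b * (a * p x - r x) ^+ 2.
    have -> : b * (a * p x - r x) ^+ 2 = (a * b) * (a * (p x * p x)) - 2 * (a * b) * (p x * r x) + b * (r x * r x) by ring.
    rewrite ab; lra.
  by rewrite mulr_ge0 ?sqr_ge0// ltW.
lra.
Qed.

Hypothesis fOm : (leb d Om < +oo)%E.

Lemma Int_bounded h (K : R) : measurable_fun Om h -> (forall x, Om x -> `|h x| <= K) -> Int h.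
Proof.
move=> mh hK; apply: (@Int_le _ (fun=> K)) => //.
apply: (measurable_bounded_integrable mOm fOm) => //.
by exists `|K|; split=> [|M KM x _]; [exact: num_real|exact: ltW].
Qed.

Lemma L2_bounded h (K : R) : measurable_fun Om h -> (forall x, Om x -> `|h x| <= K) -> L2 Om h.
Proof.
move=> mh hK; apply/L2P; split=> //; apply: (@Int_bounded _ (K ^+ 2)); first exact: measurable_funX.
move=> x Ox; rewrite normrX lerXn2r ?nnegrE ?hK//.
by apply: le_trans (hK x Ox).
Qed.

Lemma L2_Int h : L2 Om h -> Int h.
Proof.
move=> Lh; have L1 : L2 Om (fun=> 1).
  by apply: (@L2_bounded _ 1) => // x _; rewrite normr1.
have := L2M Lh L1; rewrite (_ : (fun x => h x * _) = h)//.
by apply/funext => x; rewrite mulr1.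
Qed.

Lemma test_fun_L2 phi : test_fun Om phi -> L2 Om phi.
Proof.
move=> tphi; have [M HM] := test_fun_bounded tphi.
by apply: (@L2_bounded _ M) => //; exact: test_fun_measurable tphi.
Qed.

End L2_calculus.

(** * Approximation by test functions *)

Section approximation.
Context {R : realType} {d : nat}.
Variable Om : set 'rV[R]_d.
Hypothesis oOm : open Om.
Hypothesis fOm : (leb d Om < +oo)%E.
Local Notation E := 'rV[R]_d.
Local Notation mu := (leb d).
Implicit Types (f g h phi psi : E -> R) (A B C : set E).

Let mOm : measurable Om.
Proof. exact: open_measurable_row. Qed.

Lemma I_dominated (f_ : nat -> E -> R) f g : (forall n, measurable_fun Om (f_ n)) ->
  (forall x, Om x -> f_ n x @[n --> \oo] --> f x) -> Int Om g ->
  (forall n x, Om x -> `|f_ n x| <= g x) ->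
  \int[mu]_(x in Om) f_ n x @[n --> \oo] --> \int[mu]_(x in Om) f x.
Proof.
move=> mf ff ig fg.
have if_ n : Int Om (f_ n) by exact: Int_le ig (fg n).
have mf' : measurable_fun Om f.
  by apply: (measurable_fun_cvg mf).
have if' : Int Om f.
  apply: Int_le ig _ => // x Ox.
  have cv : `|f_ n x| @[n --> \oo] --> `|f x| by apply: cvg_norm; exact: ff.
  by apply: (cvgr_to_le cv); apply: nearW => n; exact: fg.
have := @dominated_cvg _ _ _ mu Om mOm (fun n => EFin \o f_ n) (EFin \o f) (EFin \o g).
move=> /(_ (fun n => (measurable_EFinP _ _).2 (mf n))) H.
apply: fine_cvg; rewrite fineK; last exact: integrable_fin_num.
by apply: H => // x Ox; apply: cvg_EFin; [exact: nearW|exact: ff].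
Qed.

(* The sets whose indicator is an L^1 limit of test functions with values in
   [0, 1] contain the open cubes well inside Om and are closed under differences
   and countable unions, so they exhaust the measurable subsets of Om. *)
Definition appr A := measurable A /\ forall eps : R, 0 < eps -> exists phi,
  [/\ test_fun Om phi, forall x, 0 <= phi x <= 1 &
      \int[mu]_(x in Om) `|phi x - \1_A x| <= eps].

Let indic01 A (x : E) : 0 <= (\1_A x : R) <= 1.
Proof. by rewrite indicE; case: (_ \in _); rewrite /= ?lexx ?ler01. Qed.

Let mindic A : measurable A -> measurable_fun Om (\1_A : E -> R).
Proof. by move=> mA; exact: measurable_indic. Qed.

Let Int_diff phi A : measurable_fun Om phi -> (forall x, 0 <= phi x <= 1) ->
  measurable A -> Int Om (fun x => `|phi x - \1_A x|).
Proof.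
move=> mphi p01 mA; apply: (@Int_bounded _ _ _ mOm fOm _ 1).
  by apply: measurableT_comp => //; apply: measurable_funB => //; exact: mindic.
move=> x _; rewrite normr_id ler_norml.
by move: (p01 x) (indic01 A x) => /andP[? ?] /andP[? ?]; apply/andP; split; lra.
Qed.

(** The indicators of a difference and of a union are polynomials c1 s + c2 t + c3 st in the two
    indicators. One that maps the unit square to [0, 1] and is 1-Lipschitz in each variable there
    carries approximations of [A] and [B] to one of [C]. *)
Let appr_op (c1 c2 c3 : R) A B C :
  (forall s t : R, 0 <= s <= 1 -> 0 <= t <= 1 -> 0 <= c1 * s + c2 * t + c3 * (s * t) <= 1) ->
  (forall s t s' t' : R, 0 <= s <= 1 -> 0 <= t <= 1 -> 0 <= s' <= 1 -> 0 <= t' <= 1 ->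
    `|(c1 * s + c2 * t + c3 * (s * t)) - (c1 * s' + c2 * t' + c3 * (s' * t'))| <=
    `|s - s'| + `|t - t'|) ->
  (forall x, \1_C x = c1 * \1_A x + c2 * \1_B x + c3 * (\1_A x * \1_B x)) ->
  measurable C -> appr A -> appr B -> appr C.
Proof.
move=> G01 Glip GC mC [mA apA] [mB apB]; split=> // eps e0.
have e2 : 0 < eps / 2 by rewrite divr_gt0.
have [phi [tphi p01 Iphi]] := apA _ e2; have [psi [tpsi q01 Ipsi]] := apB _ e2.
pose chi : E -> R := (fun x => c1 * phi x) + (fun x => c2 * psi x) + (fun x => c3 * (phi * psi) x).
have tchi : test_fun Om chi.
  apply: test_funD; first by apply: test_funD; exact: test_funZ.
  by apply/test_funZ/test_funMl => //; case: tphi.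
have chi01 x : 0 <= chi x <= 1 by apply: G01.
exists chi; split=> //.
have mphi : measurable_fun Om phi := test_fun_measurable tphi.
have mpsi : measurable_fun Om psi := test_fun_measurable tpsi.
rewrite [leRHS]splitr; apply: le_trans (lerD Iphi Ipsi).
rewrite -RintegralD//; [|exact: Int_diff..].
apply: le_Rintegral => //.
- by apply: Int_diff => //; exact: test_fun_measurable tchi.
- by apply: IntD => //; exact: Int_diff.
- by move=> x _; rewrite GC; apply: Glip.
Qed.

Let norm01 (a b : R) : 0 <= a <= 1 -> `|a * b| <= `|b|.
Proof. by move=> /andP[a0 a1]; rewrite normrM ler_piMl// ger0_norm. Qed.

Let indicIE A B x : (\1_(A `&` B) x : R) = \1_A x * \1_B x.
Proof. by rewrite !indicE in_setI; case: (_ \in A); case: (_ \in B); rewrite /= ?mulr0 ?mul1r ?mul0r. Qed.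

Lemma apprD A B : appr A -> appr B -> appr (A `\` B).
Proof.
move=> apA apB; have [mA _] := apA; have [mB _] := apB.
apply: (@appr_op 1 0 (-1) A B) => //; last exact: measurableD.
- by move=> s t /andP[? ?] /andP[? ?]; apply/andP; split; nra.
- move=> s t s' t' s01 t01 s'01 t'01.
  have -> : 1 * s + 0 * t + -1 * (s * t) - (1 * s' + 0 * t' + -1 * (s' * t')) =
    (1 - t) * (s - s') - s' * (t - t') by ring.
  apply: le_trans (ler_normB _ _) _; apply: lerD; apply: norm01 => //.
  by move/andP: t01 => [? ?]; apply/andP; split; lra.
- move=> x; rewrite setDE indicIE.
  by rewrite !indicE in_setC; case: (_ \in B) => /=; ring.
Qed.

Lemma apprU A B : appr A -> appr B -> appr (A `|` B).
Proof.
move=> apA apB; have [mA _] := apA; have [mB _] := apB.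
apply: (@appr_op 1 1 (-1) A B) => //; last exact: measurableU.
- by move=> s t /andP[? ?] /andP[? ?]; apply/andP; split; nra.
- move=> s t s' t' s01 t01 s'01 t'01.
  have -> : 1 * s + 1 * t + -1 * (s * t) - (1 * s' + 1 * t' + -1 * (s' * t')) =
    (1 - t) * (s - s') + (1 - s') * (t - t') by ring.
  apply: le_trans (ler_normD _ _) _; apply: lerD; apply: norm01 => //.
    by move/andP: t01 => [? ?]; apply/andP; split; lra.
  by move/andP: s'01 => [? ?]; apply/andP; split; lra.
- move=> x.
  by rewrite !indicE in_setU; case: (_ \in B) => /=; case: (_ \in A) => /=; ring.
Qed.

Lemma appr0 : appr set0.
Proof.
split=> // eps e0; exists (fun=> 0); split; first exact: test_fun0.
  by move=> x; rewrite lexx ler01.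
rewrite (@eq_Rintegral _ _ _ _ _ (fun=> 0)) ?Rintegral_cst ?mul0r// ?ltW//.
by move=> x _; rewrite indic0 subrr normr0.
Qed.

Lemma appr_cvg A (A_ : nat -> set E) : measurable A -> (forall n, appr (A_ n)) ->
  (forall x, Om x -> \forall n \near \oo, A_ n x <-> A x) -> appr A.
Proof.
move=> mA apA AA; split=> // eps e0.
have e2 : 0 < eps / 2 by rewrite divr_gt0.
have : \int[mu]_(x in Om) `|\1_(A_ n) x - \1_A x| @[n --> \oo] --> \int[mu]_(x in Om) (0 : R).
  apply: (@I_dominated _ _ (fun=> 1)).
  - by move=> n; apply: (Int_meas (@Int_diff _ _ (mindic _) _ _)) => //; case: (apA n).
  - move=> x Ox; apply: cvg_near_cst; apply: filterS (AA x Ox) => n H.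
    by rewrite !indicE (_ : (x \in A_ n) = (x \in A)) ?subrr ?normr0//; apply/idP/idP; rewrite !inE => /H.
  - by apply: (@Int_bounded _ _ _ mOm fOm _ 1) => // x _; rewrite normr1.
  - move=> n x _; rewrite normr_id ler_norml.
    by move: (indic01 A x) (indic01 (A_ n) x) => /andP[? ?] /andP[? ?]; apply/andP; split; lra.
rewrite Rintegral_cst// mul0r => /cvgrPdist_le /(_ _ e2) [n _ /(_ n (leqnn n))].
rewrite sub0r normrN => H; have [mAn /(_ _ e2) [phi [tphi p01 Iphi]]] := apA n.
exists phi; split=> //.
have mphi : measurable_fun Om phi := test_fun_measurable tphi.
rewrite [leRHS]splitr; apply: le_trans (lerD Iphi (le_trans (ler_norm _) H)).
have i1 : Int Om (fun x => `|\1_(A_ n) x - \1_A x|) by apply: Int_diff => //; exact: mindic.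
rewrite -RintegralD//; last exact: Int_diff.
apply: le_Rintegral => //; [exact: Int_diff|by apply: IntD => //; exact: Int_diff|].
by move=> x _; exact: ler_distD.
Qed.

Lemma appr_bigcup (F : nat -> set E) : (forall n, appr (F n)) -> appr (\bigcup_n F n).
Proof.
move=> apF.
apply: (@appr_cvg _ (fun n => \big[setU/set0]_(i < n) F i)).
- by apply: bigcupT_measurable => n; case: (apF n).
- move=> n; elim: n => [|n IH]; first by rewrite big_ord0; exact: appr0.
  by rewrite big_ord_recr/=; exact: apprU.
- move=> x _; have [[k _ Fk]|nF] := pselect ((\bigcup_n F n) x).
    exists k.+1 => // n /= kn; split=> _; first by exists k.
    by rewrite -bigcup_mkord; exists k.
  apply: nearW => n; split=> //; rewrite -bigcup_mkord => -[k _ Fk].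
  by exfalso; apply: nF; exists k.
Qed.

Lemma appr_cube a r : ccube a r `<=` Om -> appr (cube a r).
Proof.
move=> /cube_bump[psi [tpsi p0 pE]]; split=> [|eps e0]; first exact: cube_measurable.
(* n psi / (1 + n psi) increases to the indicator of the cube. *)
pose D n x : R := 1 + n%:R * psi x.
have D0 n x : 0 < D n x by rewrite ltr_pwDl// mulr_ge0.
pose phi n : E -> R := (fun x => n%:R * (D n x)^-1) * psi.
have tphi n : test_fun Om (phi n).
  apply: test_funMl => //; apply: (@smoothM _ _ (fun=> n%:R)); first exact: smooth_cst.
  apply: smoothV; first by move=> x; rewrite gt_eqF.
  apply: (@smoothD _ _ (fun=> 1)); first exact: smooth_cst.
  by apply: (@smoothM _ _ (fun=> n%:R)); [exact: smooth_cst|case: tpsi].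
have phi1 n x : 1 - phi n x = (D n x)^-1.
  rewrite /phi !fctE; have := D0 n x; rewrite /D => H.
  by field; rewrite gt_eqF.
have p01 n x : 0 <= phi n x <= 1.
  apply/andP; split; first by rewrite /phi !fctE mulr_ge0// mulr_ge0// invr_ge0 ltW.
  by rewrite -subr_ge0 phi1 invr_ge0 ltW.
have : \int[mu]_(x in Om) `|phi n x - \1_(cube a r) x| @[n --> \oo] --> \int[mu]_(x in Om) (0 : R).
  apply: (@I_dominated _ _ (fun=> 1)).
  - move=> n; apply: (Int_meas (@Int_diff _ _ _ _ _)) => //.
      exact: test_fun_measurable (tphi n).
    exact: cube_measurable.
  - move=> x Ox; rewrite indicE; have [cx|nx] := pselect (cube a r x).
      rewrite mem_set//; move/pE : cx => px; apply/cvgr0Pnorm_le => e e0'; near=> n.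
      rewrite normr_id distrC phi1 ger0_norm; last by rewrite invr_ge0 ltW.
      rewrite invf_ple ?posrE//.
      rewrite /D; apply: (@le_trans _ _ (n%:R * psi x)); last by rewrite lerDr.
      by rewrite -ler_pdivrMr//; near: n; exact: nbhs_infty_ger.
    rewrite memNset//; have psi0 : psi x = 0.
      by apply/eqP; rewrite eq_le p0 andbT leNgt; apply/negP => /pE.
    by rewrite /phi; under eq_fun do rewrite !fctE psi0 mulr0 subr0 normr0; exact: cvg_cst.
  - by apply: (@Int_bounded _ _ _ mOm fOm _ 1) => // x _; rewrite normr1.
  - move=> n x _; rewrite normr_id ler_norml.
    by move: (indic01 (cube a r) x) (p01 n x) => /andP[? ?] /andP[? ?]; apply/andP; split; lra.
rewrite Rintegral_cst// mul0r => /cvgrPdist_le /(_ _ e0) [n _ /(_ n (leqnn n))].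
rewrite sub0r normrN => H; exists (phi n); split=> //.
exact: le_trans (ler_norm _) H.
Unshelve. all: by end_near. Qed.

Lemma appr_open A : open A -> A `<=` Om -> appr A.
Proof.
move=> /open_cubes[F [-> HF]] FOm; apply: appr_bigcup => n.
have [->|[a [r [_ -> H]]]] := HF n; first exact: appr0.
by apply: appr_cube; exact: subset_trans FOm.
Qed.

(** Stated along a map because the measurable sets are generated in two layers: preimages under
    coordinates, of Borel sets generated by open intervals. Complements are taken inside [Om],
    itself approximable as an open set. *)
Lemma sigma_algebra_appr T (f : E -> T) :
  sigma_algebra setT [set B | appr (Om `&` f @^-1` B)].
Proof.
split=> /=.
- by rewrite preimage_set0 setI0; exact: appr0.
- move=> A apA; rewrite (_ : _ `&` _ = Om `\` (Om `&` f @^-1` A)).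
    by apply: apprD => //; exact: appr_open.
  by apply/seteqP; split=> x /= [Ox H]; split=> //; [move=> [_]; case: H|split=> // Ax; apply: H].
- by move=> F apF; rewrite preimage_bigcup setI_bigcupr; exact: appr_bigcup.
Qed.

Lemma appr_measurable A : measurable A -> appr (Om `&` A).
Proof.
suff : measurable `<=` [set B | appr (Om `&` id @^-1` B)] by exact.
apply: smallest_sub; first exact: sigma_algebra_appr.
rewrite -bigcup_seq; apply: bigcup_sub => i _ _ [B mB <-] /=.
rewrite setTI; move: B mB.
suff : measurable `<=` [set B | appr (Om `&` (@row_coord R d i) @^-1` B)] by exact.
rewrite RGenOpens.measurableE.
apply: smallest_sub; first exact: sigma_algebra_appr.
move=> _ [a [b ->]] /=; apply: appr_open; last exact: subIsetl.
apply: openI => //; apply: open_comp; last exact: interval_open.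
by move=> x _; exact: coord_continuous.
Qed.

(** Formally one tests with the indicator of {g > K}, which gives a nonpositive integral of the
    positive part of g - K. A test function close to that indicator stands in for it. *)
Lemma le_of_test g (K : R) : L2 Om g ->
  (forall phi, test_fun Om phi -> (forall x, 0 <= phi x) ->
    ip Om g phi <= K * \int[mu]_(x in Om) phi x) ->
  \forall x \ae mu, Om x -> g x <= K.
Proof.
move=> Lg H; pose A := [set x | K < g x].
have mA : measurable (Om `&` A).
  by have := L2_meas Lg; move=> /(_ mOm) /(_ `]K, +oo[%classic (measurable_itv _));
    rewrite preimage_itvoy.
have LK c : L2 Om (fun=> c : R) by apply: (@L2_bounded _ _ _ mOm fOm _ `|c|).
have LgK : L2 Om (fun x => g x - K) by exact: (@L2B _ _ _ mOm _ (fun=> K)).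
have LA : L2 Om (\1_(Om `&` A) : E -> R).
  apply: (@L2_bounded _ _ _ mOm fOm _ 1); first exact: mindic.
  by move=> x _; have /andP[? ?] := indic01 (Om `&` A) x; rewrite ger0_norm.
have le0 : ip Om (fun x => g x - K) (\1_(Om `&` A)) <= 0.
  apply/ler_addgt0Pl => e e0.
  pose M := ip Om (fun x => g x - K) (fun x => g x - K).
  have M0 : 0 <= M by exact: ip_ge0.
  (* The indicator is approximated to a^2 in L^1; as the difference is at most 1 in absolute value,
     its square also has integral at most a^2. Young's inequality with weight [a] then costs at most
     a M + a = e. *)
  pose a := e / (M + 1).
  have a0 : 0 < a by rewrite divr_gt0// ltr_wpDl.
  have aM : a * (M + 1) = e by rewrite /a divfK// gt_eqF// ltr_wpDl.
  have [_ /(_ (a ^+ 2))] := appr_measurable mA.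
  rewrite setIA setIid => /(_ (exprn_gt0 _ a0)) [phi [tphi p01 Iphi]].
  have Lphi := test_fun_L2 mOm fOm tphi.
  have Ld : L2 Om (fun x => \1_(Om `&` A) x - phi x) by exact: L2B.
  have := ip_young mOm a0 LgK Ld.
  rewrite -/M ipBr//.
  have Hphi : ip Om (fun x => g x - K) phi <= 0.
    rewrite (@ipBl _ _ _ mOm _ (fun=> K))// subr_le0.
    rewrite {2}/ip RintegralZl//; last exact: L2_Int.
    by apply: H => // x; case/andP: (p01 x).
  have Hd : ip Om (fun x => \1_(Om `&` A) x - phi x) (fun x => \1_(Om `&` A) x - phi x) <= a ^+ 2.
    apply: le_trans Iphi; apply: le_Rintegral => //; first exact: L2M.
      by apply: Int_diff => //; exact: L2_meas Lphi.
    move=> x _; rewrite -expr2 -(real_normK (num_real _)) distrC expr2.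
    rewrite ler_piMl// ler_norml.
    by move: (indic01 (Om `&` A) x) (p01 x) => /andP[? ?] /andP[? ?]; apply/andP; split; lra.
  have Ha : a^-1 * ip Om (fun x => \1_(Om `&` A) x - phi x) (fun x => \1_(Om `&` A) x - phi x) <= a.
    by rewrite ler_pdivrMl// -expr2.
  have := ler_norm (ip Om (fun x => g x - K) (\1_(Om `&` A)) - ip Om (fun x => g x - K) phi).
  nra.
have H0 : \forall x \ae mu, Om x -> (g x - K) * \1_(Om `&` A) x = 0.
  apply: (I_ge0_eq0 mOm) => //; first exact: L2M.
  move=> x; rewrite indicE; have [Ax|nAx] := pselect ((Om `&` A) x).
    by rewrite mem_set// mulr1 subr_ge0 ltW//; case: Ax.
  by rewrite memNset// mulr0.
apply: filterS H0 => x Hx Ox; rewrite leNgt; apply/negP => gK.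
have := Hx Ox; rewrite indicE mem_set ?mulr1; last by split.
by move=> /eqP; rewrite subr_eq0 => /eqP gE; move: gK; rewrite gE ltxx.
Qed.

(** A sup bound by duality with L^1. Each tested inequality passes to weak limits, which
    [weak_dx_bound] exploits. *)
Lemma norm_le_of_test g (K : R) : L2 Om g ->
  (forall phi, test_fun Om phi -> `|ip Om g phi| <= K * \int[mu]_(x in Om) `|phi x|) ->
  \forall x \ae mu, Om x -> `|g x| <= K.
Proof.
move=> Lg H.
have Habs phi : (forall x, 0 <= phi x) ->
    \int[mu]_(x in Om) `|phi x| = \int[mu]_(x in Om) phi x.
  by move=> p0; apply: eq_Rintegral => x _; rewrite ger0_norm.
have H1 : \forall x \ae mu, Om x -> g x <= K.
  apply: le_of_test => // phi tphi p0; rewrite -Habs//.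
  exact: le_trans (ler_norm _) (H _ tphi).
have H2 : \forall x \ae mu, Om x -> - g x <= K.
  apply: le_of_test => [|phi tphi p0]; first exact: L2N.
  have Lphi := test_fun_L2 mOm fOm tphi.
  rewrite -Habs// (_ : ip Om _ _ = - ip Om g phi).
    by apply: le_trans (H _ tphi); rewrite -normrN ler_norm.
  rewrite -mulN1r -(ipZl mOm)//; congr ip.
  by apply/funext => x; rewrite mulN1r.
apply: filterS2 H1 H2 => x A B Ox; rewrite ler_norml.
by have := A Ox; have := B Ox => ? ?; apply/andP; split; lra.
Qed.

(** The fundamental lemma of the calculus of variations, as the case K = 0 of the duality bound. *)
Lemma test_ae0 g : L2 Om g -> (forall phi, test_fun Om phi -> ip Om g phi = 0) ->
  \forall x \ae mu, Om x -> g x = 0.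
Proof.
move=> Lg H; have : \forall x \ae mu, Om x -> `|g x| <= 0.
  by apply: norm_le_of_test => // phi tphi; rewrite H// normr0 mul0r.
by apply: filterS => x /[apply]; rewrite normr_le0 => /eqP.
Qed.

Lemma test_ae_eq g h : L2 Om g -> L2 Om h ->
  (forall phi, test_fun Om phi -> ip Om g phi = ip Om h phi) ->
  \forall x \ae mu, Om x -> g x = h x.
Proof.
move=> Lg Lh H; have : \forall x \ae mu, Om x -> g x - h x = 0.
  apply: test_ae0; first exact: L2B.
  by move=> phi tphi; rewrite ipBl// ?H ?subrr//; exact: test_fun_L2.
by apply: filterS => x /[apply] /eqP; rewrite subr_eq0 => /eqP.
Qed.

End approximation.

(** * Weak derivatives *)

Section weak_derivatives.
Context {R : realType} {d : nat}.
Variable Om : set 'rV[R]_d.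
Hypothesis oOm : open Om.
Hypothesis fOm : (leb d Om < +oo)%E.
Local Notation E := 'rV[R]_d.
Local Notation mu := (leb d).
Local Notation ip := (ip Om).
Local Notation "p =ae r" := (\forall x \ae leb d, Om x -> p x = r x) (at level 70).
Implicit Types (f g h p r phi psi : E -> R).

Let mOm : measurable Om.
Proof. exact: open_measurable_row. Qed.

Lemma test_fun_partial_mi a phi : test_fun Om phi -> test_fun Om (partial_mi a phi).
Proof.
move=> tphi; rewrite /partial_mi; elim: (enum _) => //= i s IH.
by elim: (a i) => //= n; exact: test_fun_partial.
Qed.

Lemma partial_mi_unit i phi : partial_mi (unit_mi i) phi = partial i phi.
Proof.
have H s : uniq s -> foldr (fun j h => iter (unit_mi i j) (partial j) h) phi s =
    if i \in s then partial i phi else phi.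
  elim: s => //= j s IH /andP[js us]; rewrite IH// inE /unit_mi eq_sym.
  by have [ij|_] //= := eqVneq i j; rewrite ij (negbTE js).
by rewrite /partial_mi H ?enum_uniq// mem_enum.
Qed.

Lemma sum_unit_mi (i : 'I_d) : (\sum_j unit_mi i j = 1)%N.
Proof.
rewrite (bigD1 i)//= /unit_mi eqxx big1// => j /negbTE ->.
by [].
Qed.

Lemma is_wderiv_uniq a p r r' : is_wderiv Om a p r -> is_wderiv Om a p r' -> r =ae r'.
Proof.
move=> [Lr Hr] [Lr' Hr']; apply: (test_ae_eq oOm fOm) => // phi tphi.
(* A second factor (-1)^|a| cancels the sign on both sides. *)
have := Hr _ tphi; rewrite (Hr' _ tphi) => /(congr1 (fun t => (-1) ^+ (\sum_i a i) * t)).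
by rewrite !mulrA -!exprD addnn -muln2 mulnC !exprM sqrrN !expr1n !mul1r.
Qed.

Lemma wderivP a p : (exists r, is_wderiv Om a p r) -> is_wderiv Om a p (wderiv Om a p).
Proof. by move=> H; exact: (xgetPex _ H). Qed.

Lemma is_wderiv0 p : L2 Om p -> is_wderiv Om (fun=> 0%N) p p.
Proof.
move=> Lp; split=> // phi _; rewrite big1// expr0 mul1r.
by rewrite /partial_mi; elim: (enum _).
Qed.

Lemma Hspace_L2 m p : Hspace Om m p -> L2 Om p.
Proof. by case. Qed.

Lemma Hspace1_dx i p : Hspace Om 1 p -> is_wderiv Om (unit_mi i) p (dx Om i p).
Proof. by move=> [_ H]; apply/wderivP/H; rewrite sum_unit_mi. Qed.

Lemma dx_L2 i p : Hspace Om 1 p -> L2 Om (dx Om i p).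
Proof. by move=> /Hspace1_dx -/(_ i) []. Qed.

Lemma dx_test i p phi : Hspace Om 1 p -> test_fun Om phi ->
  ip p (partial i phi) = - ip (dx Om i p) phi.
Proof.
move=> /Hspace1_dx -/(_ i) [_ H] tphi.
by rewrite -partial_mi_unit H// sum_unit_mi expr1 mulN1r.
Qed.

Lemma is_wderivB a p p' r r' : L2 Om p -> L2 Om p' ->
  is_wderiv Om a p r -> is_wderiv Om a p' r' ->
  is_wderiv Om a (fun x => p x - p' x) (fun x => r x - r' x).
Proof.
move=> Lp Lp' [Lr Hr] [Lr' Hr']; split=> [|phi tphi]; first exact: L2B.
have Lphi := test_fun_L2 mOm fOm tphi.
have Lphi' := test_fun_L2 mOm fOm (test_fun_partial_mi a tphi).
by rewrite !ipBl// Hr// Hr'// mulrBr.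
Qed.

Lemma HspaceB m p r : Hspace Om m p -> Hspace Om m r ->
  Hspace Om m (fun x => p x - r x).
Proof.
move=> [Lp Hp] [Lr Hr]; split=> [|a am]; first exact: L2B.
have [p' Hp'] := Hp a am; have [r' Hr'] := Hr a am.
by exists (fun x => p' x - r' x); exact: is_wderivB.
Qed.

Lemma dxB i p r : Hspace Om 1 p -> Hspace Om 1 r ->
  dx Om i (fun x => p x - r x) =ae (fun x => dx Om i p x - dx Om i r x).
Proof.
move=> Hp Hr; apply: is_wderiv_uniq (Hspace1_dx i (HspaceB Hp Hr)) _.
by apply: is_wderivB; [exact: Hspace_L2 Hp|exact: Hspace_L2 Hr|exact: Hspace1_dx..].
Qed.

Lemma is_wderiv_cst0 a : is_wderiv Om a (fun=> 0) (fun=> 0).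
Proof.
split; first exact: L2_0.
have ip0 g : ip (fun=> 0) g = 0.
  by rewrite /Defs.ip; under eq_Rintegral do rewrite mul0r; rewrite Rintegral_cst// mul0r.
by move=> phi tphi; rewrite !ip0 mulr0.
Qed.

Lemma Hspace0 m : Hspace Om m (fun=> 0).
Proof. by split=> [|a _]; [exact: L2_0|exists (fun=> 0); exact: is_wderiv_cst0]. Qed.

Lemma dx0 i : dx Om i (fun=> 0) =ae (fun=> 0).
Proof. by apply: is_wderiv_uniq (Hspace1_dx i (Hspace0 1)) (is_wderiv_cst0 _). Qed.

End weak_derivatives.

(** * Limits of pairings and the space H^1_0 *)

Section limits.
Context {R : realType} {d : nat}.
Variable Om : set 'rV[R]_d.
Hypothesis oOm : open Om.
Hypothesis fOm : (leb d Om < +oo)%E.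
Local Notation E := 'rV[R]_d.
Local Notation mu := (leb d).
Local Notation ip := (ip Om).
Implicit Types (f g h p r phi psi : E -> R).

Let mOm : measurable Om.
Proof. exact: open_measurable_row. Qed.

Lemma ip_cvg0 (M : R) (f g : nat -> E -> R) :
  (forall k, L2 Om (f k)) -> (forall k, L2 Om (g k)) ->
  (forall k, ip (g k) (g k) <= M) ->
  ip (f k) (f k) @[k --> \oo] --> (0 : R) ->
  ip (g k) (f k) @[k --> \oo] --> (0 : R).
Proof.
move=> Lf Lg gM f0; apply/cvgr0Pnorm_le => e e0.
have M0 : 0 <= M by apply: le_trans (gM 0%N); exact: ip_ge0.
pose a := e / (M + 1).
have a0 : 0 < a by rewrite divr_gt0// ltr_wpDl.
have aM : a * (M + 1) = e by rewrite /a divfK// gt_eqF// ltr_wpDl.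
have ae : 0 < a * e by rewrite mulr_gt0.
move/cvgr0Pnorm_le : f0 => /(_ _ ae) f0; near=> k.
have := ip_young mOm a0 (Lg k) (Lf k).
have : a^-1 * ip (f k) (f k) <= e.
  rewrite ler_pdivrMl//; apply: le_trans (ler_norm _) _; near: k; exact: f0.
have := gM k; nra.
Unshelve. all: by end_near. Qed.

(** Here [h] is merely integrable. Its truncation at level n is bounded, hence pairs with the
    L^2-null sequence, and the remainder is small in L^1 against the uniform bound on [f]. *)
Lemma I_mul_cvg0 (C : R) h (f : nat -> E -> R) : Int Om h ->
  (forall k, measurable_fun Om (f k)) -> (forall k x, Om x -> `|f k x| <= C) ->
  ip (f k) (f k) @[k --> \oo] --> (0 : R) ->
  ip h (f k) @[k --> \oo] --> (0 : R).
Proof.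
move=> ih mf fC f0; have mh := Int_meas ih.
have Lf k : L2 Om (f k) by exact: L2_bounded (mf k) (fC k).
pose hN n x := Num.max (Num.min (h x) n%:R) (- n%:R).
have mhN n : measurable_fun Om (hN n).
  by apply: measurable_maxr => //; exact: measurable_minr.
have hNn n x : `|hN n x| <= n%:R.
  rewrite ler_norml /hN le_max lexx orbT /= ge_max ge_min lexx orbT /=.
  by apply: le_trans (ler0n _ n); rewrite oppr_le0.
have hNd n x : `|h x - hN n x| <= `|h x|.
  have n0 : 0 <= n%:R :> R by [].
  rewrite /hN; case: (leP (h x) n%:R) => hn.
    case: (leP (h x) (- n%:R)) => hn'; last by rewrite subrr normr0.
    have h0 : h x <= 0 by apply: le_trans hn' _; rewrite oppr_le0.
    rewrite (ler0_norm h0) ler0_norm; lra.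
  have h0 : 0 <= h x by lra.
  by case: (leP n%:R (- n%:R : R)) => nn; rewrite (ger0_norm h0) ger0_norm; lra.
have LhN n : L2 Om (hN n) by apply: (L2_bounded mOm fOm (mhN n)) => x _; exact: hNn.
have Int_d n : Int Om (fun x => `|h x - hN n x|).
  by apply: Int_abs; apply: IntB => //; exact: L2_Int.
have hcvg : \int[mu]_(x in Om) `|h x - hN n x| @[n --> \oo] --> \int[mu]_(x in Om) (0 : R).
  apply: (I_dominated oOm (g := fun x => `|h x|)).
  - by move=> n; exact: Int_meas (Int_d n).
  - move=> x Ox; apply: cvg_near_cst; near=> n.
    have : `|h x| <= n%:R by near: n; exact: nbhs_infty_ger.
    rewrite ler_norml => /andP[? ?].
    by rewrite /hN (elimT min_idPl)// (elimT max_idPl)// subrr normr0.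
  - exact: Int_abs.
  - by move=> n x _; rewrite normr_id.
rewrite Rintegral_cst// mul0r in hcvg.
apply/cvgr0Pnorm_le => e e0.
have C1 : 0 < `|C| + 1 by rewrite ltr_wpDl.
have e1 : 0 < e / (2 * (`|C| + 1)) by rewrite divr_gt0// mulr_gt0.
have e2 : 0 < e / 2 by rewrite divr_gt0.
move/cvgr0Pnorm_le : hcvg => /(_ _ e1) [n _ /(_ n (leqnn n))] /= Hn.
have := @ip_cvg0 (ip (hN n) (hN n)) f (fun=> hN n) Lf (fun=> LhN n) (fun=> lexx _) f0.
move=> /cvgr0Pnorm_le /(_ _ e2) Hk; near=> k.
have i1 : Int Om (fun x => (h x - hN n x) * f k x).
  apply: (@Int_le _ _ _ mOm _ (fun x => (`|C| + 1) * `|h x - hN n x|)).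
  - by apply: measurable_funM => //; exact: measurable_funB.
  - exact: IntZ.
  - move=> x Ox; rewrite normrM mulrC ler_wpM2r//.
    by apply: le_trans (fC k x Ox) _; rewrite (le_trans (ler_norm _))// lerDl.
have -> : ip h (f k) = ip (hN n) (f k) + \int[mu]_(x in Om) ((h x - hN n x) * f k x).
  rewrite /Defs.ip -RintegralD//; last exact: L2M.
  by apply: eq_Rintegral => x _; ring.
rewrite [leRHS]splitr; apply: le_trans (ler_normD _ _) _; apply: lerD.
  by near: k; exact: Hk.
apply: (@le_trans _ _ (\int[mu]_(x in Om) ((`|C| + 1) * `|h x - hN n x|))).
  apply: I_abs_le => //; first exact: IntZ.
  move=> x Ox; rewrite normrM mulrC ler_wpM2r//.
  by apply: le_trans (fC k x Ox) _; rewrite (le_trans (ler_norm _))// lerDl.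
rewrite RintegralZl//; last exact: Int_d.
have C2 : 0 < 2 * (`|C| + 1) by rewrite mulr_gt0.
have := le_trans (ler_norm _) Hn; rewrite ler_pdivlMr//.
lra.
Unshelve. all: by end_near. Qed.

Lemma H10_approx p : H10 Om p -> exists phi : nat -> E -> R,
  [/\ forall k, test_fun Om (phi k),
      ip (fun x => phi k x - p x) (fun x => phi k x - p x) @[k --> \oo] --> (0 : R) &
      forall i, ip (fun x => partial i (phi k) x - dx Om i p x)
        (fun x => partial i (phi k) x - dx Om i p x) @[k --> \oo] --> (0 : R)].
Proof.
move=> [Hp [phi [tphi c0 c1]]]; exists phi; split=> //.
  have L k : L2 Om (fun x => phi k x - p x).
    by apply: L2B => //; [exact: test_fun_L2|exact: Hspace_L2 Hp].
  apply: cvg_trans (fine_cvg c0); apply: near_eq_cvg; apply: nearW => k.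
  exact: (congr1 fine (sqL2E mOm (L k))).
move=> i; have L k : L2 Om (fun x => partial i (phi k) x - dx Om i p x).
  apply: L2B => //; [exact/test_fun_L2/test_fun_partial|exact: dx_L2].
apply: cvg_trans (fine_cvg (c1 i)); apply: near_eq_cvg; apply: nearW => k.
exact: (congr1 fine (sqL2E mOm (L k))).
Qed.

Lemma H10_of_approx p (phi : nat -> E -> R) : Hspace Om 1 p ->
  (forall k, test_fun Om (phi k)) ->
  ip (fun x => phi k x - p x) (fun x => phi k x - p x) @[k --> \oo] --> (0 : R) ->
  (forall i, ip (fun x => partial i (phi k) x - dx Om i p x)
        (fun x => partial i (phi k) x - dx Om i p x) @[k --> \oo] --> (0 : R)) ->
  H10 Om p.
Proof.
move=> Hp tphi c0 c1; split=> //; exists phi; split=> // [|i].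
  have L k : L2 Om (fun x => phi k x - p x).
    by apply: L2B => //; [exact: test_fun_L2|exact: Hspace_L2 Hp].
  rewrite (_ : (fun k => _) = (fun k => (ip (fun x => phi k x - p x) (fun x => phi k x - p x))%:E)).
    by apply: cvg_EFin => //; exact: nearW.
  by apply/funext => k; exact: (sqL2E mOm (L k)).
have L k : L2 Om (fun x => partial i (phi k) x - dx Om i p x).
  apply: L2B => //; [exact/test_fun_L2/test_fun_partial|exact: dx_L2].
rewrite (_ : (fun k => _) = (fun k => (ip (fun x => partial i (phi k) x - dx Om i p x)
    (fun x => partial i (phi k) x - dx Om i p x))%:E)).
  by apply: cvg_EFin; [exact: nearW|exact: c1].
by apply/funext => k; exact: (sqL2E mOm (L k)).
Qed.

Lemma H10_Hspace p : H10 Om p -> Hspace Om 1 p.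
Proof. by case. Qed.

Lemma ip_sqB_le p r : L2 Om p -> L2 Om r ->
  ip (fun x => p x - r x) (fun x => p x - r x) <= 2 * ip p p + 2 * ip r r.
Proof.
move=> Lp Lr; have L := L2B mOm Lp Lr.
rewrite (ipBl mOm Lp Lr L) (ipBr mOm Lp Lr Lp) (ipBr mOm Lp Lr Lr).
have := ip_young mOm ltr01 Lp Lr; rewrite (ipC _ r p) invr1 !mul1r.
have := ler_norm (- ip p r); rewrite normrN; lra.
Qed.

Lemma H10B p r : H10 Om p -> H10 Om r -> H10 Om (fun x => p x - r x).
Proof.
move=> Hp Hr; have [phi [tphi a0 a1]] := H10_approx Hp; have [psi [tpsi b0 b1]] := H10_approx Hr.
have [Hp1 Hr1] := (H10_Hspace Hp, H10_Hspace Hr).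
have sq (f g : nat -> E -> R) : (forall k, L2 Om (f k)) -> (forall k, L2 Om (g k)) ->
    ip (f k) (f k) @[k --> \oo] --> (0 : R) -> ip (g k) (g k) @[k --> \oo] --> (0 : R) ->
    ip (fun x => f k x - g k x) (fun x => f k x - g k x) @[k --> \oo] --> (0 : R).
  move=> Lf Lg f0 g0.
  apply: (@squeeze_cvgr _ _ _ _ (fun=> 0) (fun k => 2 * ip (f k) (f k) + 2 * ip (g k) (g k))).
  - by apply: nearW => k; rewrite ip_ge0 ip_sqB_le.
  - exact: cvg_cst.
  - have -> : (0 : R) = 2 * 0 + 2 * 0 by rewrite mulr0 addr0.
    by apply: cvgD; apply: cvgMr.
apply: (@H10_of_approx _ (fun k => phi k - psi k)).
- exact: HspaceB.
- by move=> k; exact: test_funB.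
- rewrite (_ : (fun k => _) = (fun k => ip (fun x => (phi k x - p x) - (psi k x - r x)) (fun x => (phi k x - p x) - (psi k x - r x)))).
    apply: sq => // k; apply: L2B => //; by [exact: test_fun_L2|exact: Hspace_L2 Hp1|exact: Hspace_L2 Hr1].
  by apply/funext => k; congr ip; apply/funext => x; rewrite !fctE; ring.
- move=> i.
  have Lp i' k : L2 Om (fun x => partial i' (phi k) x - dx Om i' p x).
    by apply: L2B => //; [exact/test_fun_L2/test_fun_partial|exact: dx_L2].
  have Lr i' k : L2 Om (fun x => partial i' (psi k) x - dx Om i' r x).
    by apply: L2B => //; [exact/test_fun_L2/test_fun_partial|exact: dx_L2].
  have c := sq _ _ (Lp i) (Lr i) (a1 i) (b1 i).
  apply: cvg_trans c; apply: near_eq_cvg; apply: nearW => k.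
  have tB := test_fun_partial i (test_funB (tphi k) (tpsi k)).
  have mL : measurable_fun Om (fun x => partial i (phi k - psi k) x - dx Om i (fun x => p x - r x) x).
    apply: L2_meas; apply: L2B => //; [exact: test_fun_L2|apply: dx_L2; exact: HspaceB].
  have mR := L2_meas (L2B mOm (Lp i k) (Lr i k)).
  apply: I_ae; [exact: mOm|exact: measurable_funM|exact: measurable_funM|].
  (* Classical derivatives subtract pointwise, the chosen weak ones only almost everywhere. *)
  apply: filterS (dxB oOm fOm i Hp1 Hr1) => x /[apply] H.
  have -> : partial i (phi k - psi k) x = partial i (phi k) x - partial i (psi k) x.
    by apply: deriveB; apply: diff_derivable; apply: smooth_diff; exact: test_fun_smooth.
  by rewrite H; ring.
Qed.

Lemma H10_0 : H10 Om (fun=> 0).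
Proof.
have cst0 : ip (fun=> 0) (fun=> 0) = 0.
  by rewrite /Defs.ip; under eq_Rintegral do rewrite mul0r; rewrite Rintegral_cst// mul0r.
apply: (@H10_of_approx _ (fun=> (fun=> 0))).
- exact: Hspace0.
- by move=> _; exact: test_fun0.
- under eq_fun do under [X in ip X _]eq_fun do rewrite subrr.
  rewrite (_ : (fun=> _) = (fun=> 0)); first exact: cvg_cst.
  by apply/funext => k; rewrite -[RHS]cst0; congr ip; apply/funext => x; rewrite subrr.
- move=> i; rewrite (_ : (fun=> _) = (fun=> 0)); first exact: cvg_cst.
  apply/funext => k; rewrite -[RHS]cst0.
  have mL : measurable_fun Om (fun x => partial i (fun=> 0 : R) x - dx Om i (fun=> 0) x).
    apply: L2_meas; apply: L2B => //; last by apply: dx_L2; exact: Hspace0.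
    by rewrite partial_cst; exact: L2_0.
  apply: I_ae => //; first exact: measurable_funM.
  by apply: filterS (dx0 oOm fOm i) => x /[apply] ->; rewrite partial_cst subrr.
Qed.

Lemma ip_cvg (f : nat -> E -> R) p g : (forall k, L2 Om (f k)) -> L2 Om p -> L2 Om g ->
  ip (fun x => f k x - p x) (fun x => f k x - p x) @[k --> \oo] --> (0 : R) ->
  ip (f k) g @[k --> \oo] --> ip p g.
Proof.
move=> Lf Lp Lg c.
have L k : L2 Om (fun x => f k x - p x) by exact: L2B.
have := @ip_cvg0 (ip g g) _ (fun=> g) L (fun=> Lg) (fun=> lexx _) c.
move=> H; apply/subr_cvg0; apply: cvg_trans H; apply: near_eq_cvg; apply: nearW => k.
by rewrite ipBr// !(ipC _ g).
Qed.

(** The weak derivative of [q] is tested with the functions approximating [p], and both sides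
    converge; [p] in H^1_0 is why no boundary term appears. *)
Lemma dx_ibp i p q : H10 Om p -> Hspace Om 1 q -> ip p (dx Om i q) = - ip (dx Om i p) q.
Proof.
move=> Hp Hq; have [phi [tphi c0 c1]] := H10_approx Hp.
have Hp1 := H10_Hspace Hp.
have Lphi k := test_fun_L2 mOm fOm (tphi k).
have Lphi' k := test_fun_L2 mOm fOm (test_fun_partial i (tphi k)).
have d1 := ip_cvg Lphi (Hspace_L2 Hp1) (dx_L2 i Hq) c0.
have d2 := ip_cvg Lphi' (dx_L2 i Hp1) (Hspace_L2 Hq) (c1 i).
have E : (fun k => ip (phi k) (dx Om i q)) = (fun k => - ip (partial i (phi k)) q).
  by apply/funext => k; rewrite (ipC _ (partial _ _)) (dx_test i Hq (tphi k)) opprK ipC.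
rewrite E in d1.
have d3 : - ip (partial i (phi k)) q @[k --> \oo] --> - ip (dx Om i p) q by exact: cvgN.
exact: (cvg_unique _ d1 d3).
Qed.

End limits.

(** * Vector fields, weak divergence and the projection step *)

Section vector_fields.
Context {R : realType} {d : nat}.
Variable Om : set 'rV[R]_d.
Hypothesis oOm : open Om.
Hypothesis fOm : (leb d Om < +oo)%E.
Local Notation E := 'rV[R]_d.
Local Notation mu := (leb d).
Local Notation ip := (ip Om).
Local Notation vip := (vip Om).
Local Notation "p =ae r" := (\forall x \ae leb d, Om x -> p x = r x) (at level 70).
Implicit Types (p q r phi : E -> R) (u v w b : vfield R d).

Let mOm : measurable Om.
Proof. exact: open_measurable_row. Qed.

Lemma vipE u v : vL2 Om u -> vL2 Om v -> vip u v = \sum_i ip (u i) (v i).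
Proof. by move=> Lu Lv; rewrite /Defs.vip I_sum// => i; exact: L2M. Qed.

Lemma vL2B u v : vL2 Om u -> vL2 Om v -> vL2 Om (u - v).
Proof. by move=> Lu Lv i; exact: L2B. Qed.

Lemma vipC u v : vip u v = vip v u.
Proof. by apply: eq_Rintegral => x _; apply: eq_bigr => i _; rewrite mulrC. Qed.

Lemma vip_ge0 u : 0 <= vip u u.
Proof.
by apply: Rintegral_ge0 => x _; apply: sumr_ge0 => i _; rewrite -expr2 sqr_ge0.
Qed.

Lemma vipBl u v w : vL2 Om u -> vL2 Om v -> vL2 Om w ->
  vip (u - v) w = vip u w - vip v w.
Proof.
move=> Lu Lv Lw; rewrite !vipE//; last exact: vL2B.
by rewrite -sumrB; apply: eq_bigr => i _; exact: ipBl.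
Qed.

Lemma vipBr u v w : vL2 Om u -> vL2 Om v -> vL2 Om w ->
  vip w (u - v) = vip w u - vip w v.
Proof. by move=> *; rewrite vipC vipBl// !(vipC w). Qed.

Lemma vip_young (a : R) u v : 0 < a -> vL2 Om u -> vL2 Om v ->
  2 * `|vip u v| <= a * vip u u + a^-1 * vip v v.
Proof.
move=> a0 Lu Lv; rewrite !vipE// !mulr_sumr -big_split/=.
apply: (@le_trans _ _ (\sum_i 2 * `|ip (u i) (v i)|)).
  by rewrite -mulr_sumr ler_pM2l// ler_norm_sum.
by apply: ler_sum => i _; exact: ip_young.
Qed.

Lemma vip_sqB_le u v : vL2 Om u -> vL2 Om v ->
  vip (u - v) (u - v) <= 2 * vip u u + 2 * vip v v.
Proof.
move=> Lu Lv; have L := vL2B Lu Lv.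
rewrite (vipBl Lu Lv L) (vipBr Lu Lv Lu) (vipBr Lu Lv Lv).
have := vip_young ltr01 Lu Lv; rewrite (vipC v u) invr1 !mul1r.
have := ler_norm (- vip u v); rewrite normrN; lra.
Qed.

Lemma sum_sqL2E (I : finType) (F : I -> E -> R) : (forall i, L2 Om (F i)) ->
  (\sum_i sqL2 Om (F i) = (\sum_i ip (F i) (F i))%:E)%E.
Proof.
by move=> LF; rewrite -sumEFin; apply: eq_bigr => i _; exact: sqL2E.
Qed.

Lemma sqrteE (s : R) : sqrte s%:E = (Num.sqrt s)%:E.
Proof. by []. Qed.

Lemma vnormL2E u : vL2 Om u -> vnormL2 Om u = (Num.sqrt (vip u u))%:E.
Proof. by move=> Lu; rewrite /vnormL2 sum_sqL2E// -vipE. Qed.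

Lemma gradnormE u : (forall i, Hspace Om 1 (u i)) ->
  gradnorm Om u = (Num.sqrt (gradip Om u u))%:E.
Proof.
move=> Hu; rewrite /gradnorm /gradip -sqrteE -sumEFin; congr sqrte.
by apply: eq_bigr => i _; rewrite -sum_sqL2E// => j; exact: dx_L2.
Qed.

Lemma sqrt_le_sq (s K : R) : 0 <= s -> Num.sqrt s <= K -> s <= K ^+ 2.
Proof.
move=> s0 sK; rewrite -(sqr_sqrtr s0) lerXn2r// nnegrE ?sqrtr_ge0//.
exact: le_trans sK.
Qed.

Lemma Xspace_vL2 u : Xspace Om u -> vL2 Om u.
Proof. by move=> Xu i; exact: Hspace_L2 (H10_Hspace (Xu i)). Qed.

Lemma Xspace_dx u i j : Xspace Om u -> L2 Om (dx Om j (u i)).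
Proof. by move=> Xu; exact: dx_L2 (H10_Hspace (Xu i)). Qed.

Lemma XspaceB u v : Xspace Om u -> Xspace Om v -> Xspace Om (u - v).
Proof. by move=> Xu Xv i; exact: H10B. Qed.

Lemma Xspace_single i p : H10 Om p ->
  Xspace Om (fun j x => if j == i then p x else 0).
Proof. move=> Hp j; case: (j == i); [exact: Hp|exact: (H10_0 oOm fOm)]. Qed.

Lemma is_wdiv_uniq u p r : is_wdiv Om u p -> is_wdiv Om u r -> p =ae r.
Proof.
move=> [Lp Hp] [Lr Hr]; apply: (test_ae_eq oOm fOm) => // phi tphi.
by apply: oppr_inj; rewrite -Hp// Hr.
Qed.

Lemma is_wdiv_X u : Xspace Om u -> is_wdiv Om u (fun x => \sum_i dx Om i (u i) x).
Proof.
move=> Xu; split; first by apply: L2_sum => // i; exact: Xspace_dx.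
move=> phi tphi; have Lphi := test_fun_L2 mOm fOm tphi.
rewrite vipE; [|exact: Xspace_vL2|by move=> i; exact/test_fun_L2/test_fun_partial].
rewrite (ipC _ _ phi) ip_sumr//; last by move=> i; exact: Xspace_dx.
rewrite -sumrN; apply: eq_bigr => i _.
by rewrite (dx_test i (H10_Hspace (Xu i)) tphi) ipC.
Qed.

Lemma wdivP u : (exists p, is_wdiv Om u p) -> is_wdiv Om u (wdiv Om u).
Proof. by move=> H; exact: (xgetPex _ H). Qed.

Lemma wdiv_X u : Xspace Om u -> wdiv Om u =ae (fun x => \sum_i dx Om i (u i) x).
Proof.
move=> Xu; have H := is_wdiv_X Xu.
by apply: (is_wdiv_uniq _ H); apply: wdivP; eexists; exact: H.
Qed.

Lemma wdiv_divfree u : divfree Om u -> L2 Om (wdiv Om u) /\ wdiv Om u =ae (fun=> 0).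
Proof.
move=> Du; have H : is_wdiv Om u (wdiv Om u) by apply: wdivP; exists (fun=> 0).
by split; [case: H|exact: is_wdiv_uniq H Du].
Qed.

Lemma ip_ae0r p r : L2 Om p -> L2 Om r -> r =ae (fun=> 0) -> ip p r = 0.
Proof.
move=> Lp Lr r0; rewrite ipC (ip_ae mOm _ _ _ r0)//; try exact: L2_meas.
by rewrite /Defs.ip; under eq_Rintegral do rewrite mul0r; rewrite Rintegral_cst// mul0r.
Qed.

(** This turns the pressure term into an L^2 pairing with grad q, which the nudging term can absorb;
    it also supplies the zero normal trace in [Yspace_X]. *)
Lemma ip_wdiv_X q v : Hspace Om 1 q -> Xspace Om v ->
  ip q (wdiv Om v) = - vip (fun i => dx Om i q) v.
Proof.
move=> Hq Xv; have Lq := Hspace_L2 Hq.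
have [Lw _] : is_wdiv Om v (wdiv Om v) by apply: wdivP; eexists; exact: is_wdiv_X.
have Ls : L2 Om (fun x => \sum_i dx Om i (v i) x) by apply: L2_sum => // i; exact: Xspace_dx.
rewrite ipC (ip_ae mOm _ _ _ (wdiv_X Xv))//; try exact: L2_meas.
rewrite ipC ip_sumr//; last by move=> i; exact: Xspace_dx.
rewrite vipE; [|by move=> i; exact: dx_L2|exact: Xspace_vL2].
rewrite -sumrN; apply: eq_bigr => i _.
by rewrite (ipC _ (dx _ _ _)) (dx_ibp oOm fOm i (Xv i) Hq) opprK ipC.
Qed.

(** It places the exact solution in Y, so that projecting cannot move u^n away from w^n. The normal
    trace vanishes by [ip_wdiv_X], with [psi] in the role of the pressure. *)
Lemma Yspace_X u : Xspace Om u -> divfree Om u -> Yspace Om u.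
Proof.
move=> Xu Du; split=> //; first exact: Xspace_vL2.
move=> psi Hpsi; have [Lw w0] := wdiv_divfree Du.
have := ip_wdiv_X Hpsi Xu; rewrite ip_ae0r//; last exact: Hspace_L2 Hpsi.
move=> /esym/eqP; rewrite oppr_eq0 => /eqP; rewrite vipC => ->.
by rewrite add0r ipC ip_ae0r//; exact: Hspace_L2 Hpsi.
Qed.

(** Test fields in Y have weak divergence zero almost everywhere, so the pressure drops out and [ut]
    is the orthogonal projection of [u]. *)
Lemma step2_orth dt u ut p : 0 < dt -> cda_step2 Om dt u ut p ->
  forall v, Yspace Om v -> vip (ut - u) v = 0.
Proof.
move=> dt0 [_ [Lp _] H _] v Yv; have := H v Yv; have [_ Dv _] := Yv.
have [Lw w0] := wdiv_divfree Dv.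
rewrite (ip_ae0r Lp Lw w0) subr0 => /eqP; rewrite mulf_eq0 invr_eq0 gt_eqF//=.
by move=> /eqP.
Qed.

(** Pythagoras: [ut - w] is a difference of elements of Y, hence orthogonal to [ut - u]. *)
Lemma step2_le dt u ut p w : 0 < dt -> vL2 Om u -> cda_step2 Om dt u ut p ->
  Yspace Om w -> vip (ut - w) (ut - w) <= vip (u - w) (u - w).
Proof.
move=> dt0 Lu s2 Yw; have [[Lut _ _] _ _ _] := s2; have [Lw _ _] := Yw.
have Yut : Yspace Om ut by case: s2.
have o1 := step2_orth dt0 s2 Yut; have o2 := step2_orth dt0 s2 Yw.
have Ld : vL2 Om (ut - u) by exact: vL2B.
have Le : vL2 Om (ut - w) by exact: vL2B.
have o3 : vip (ut - u) (ut - w) = 0 by rewrite vipBr// o1 o2 subrr.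
have -> : u - w = (ut - w) - (ut - u) by rewrite opprB [RHS]addrC addrA subrK.
have LB := vL2B Le Ld.
rewrite (vipBl Le Ld LB) (vipBr Le Ld Le) (vipBr Le Ld Ld) (vipC (ut - w) (ut - u)) o3.
by have := vip_ge0 (ut - u); lra.
Qed.

End vector_fields.

(* As b is only in L^2, b . grad p is not a priori integrable against p; the
   identity is proved for a bounded function of p, then passed to the limit. *)
Section skew_symmetry.
Context {R : realType} {d : nat}.
Variable Om : set 'rV[R]_d.
Hypothesis oOm : open Om.
Hypothesis fOm : (leb d Om < +oo)%E.
Local Notation E := 'rV[R]_d.
Local Notation mu := (leb d).
Local Notation ip := (ip Om).
Implicit Types (p q r phi : E -> R) (b : vfield R d).

Let mOm : measurable Om.
Proof. exact: open_measurable_row. Qed.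

Variable eps : R.
Hypothesis eps0 : 0 < eps.

Let a (s : R) : R := (1 + eps * s ^+ 2)^-1.
(* The derivative of [s ^+ 2 / (2 * (1 + eps * s ^+ 2))]. *)
Definition damped (s : R) : R := s * a s ^+ 2.
Let K : R := 1 + eps^-1.

Let den_ge1 s : 1 <= 1 + eps * s ^+ 2.
Proof. by rewrite lerDl mulr_ge0 ?sqr_ge0// ltW. Qed.

Let den_gt0 s : 0 < 1 + eps * s ^+ 2.
Proof. exact: lt_le_trans (den_ge1 s). Qed.

Let a_gt0 s : 0 < a s.
Proof. by rewrite invr_gt0. Qed.

Let a_le1 s : a s <= 1.
Proof. by rewrite invf_le1. Qed.

(** With t the absolute value of s, K (1 + eps t^2) >= 1 + t^2 >= 2t. *)
Let sa_le s : `|s| * a s <= K.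
Proof.
rewrite ler_pdivrMr// -(real_normK (num_real s)); set t := `|s|.
have t0 : 0 <= t by exact: normr_ge0.
have -> : K * (1 + eps * t ^+ 2) = 1 + t ^+ 2 + eps^-1 + eps * t ^+ 2 * 1 + (eps^-1 * eps - 1) * t ^+ 2.
  by rewrite /K; ring.
rewrite mulVf ?gt_eqF// subrr mul0r addr0 mulr1.
have : 0 < eps^-1 by rewrite invr_gt0.
have : 0 <= eps * t ^+ 2 by rewrite mulr_ge0 ?sqr_ge0// ltW.
have := sqr_ge0 (t - 1); nra.
Qed.

Lemma damped_le s : `|damped s| <= `|s|.
Proof.
rewrite /damped normrM ler_piMr// ger0_norm ?sqr_ge0//.
by rewrite exprn_ile1// ?a_le1// ltW.
Qed.

Lemma damped_bounded : exists C, forall s, `|damped s| <= C.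
Proof.
exists K => s; rewrite /damped normrM (ger0_norm (sqr_ge0 _)) expr2 mulrA.
apply: le_trans (sa_le s); rewrite ler_piMr ?a_le1//.
by rewrite mulr_ge0// ltW.
Qed.

(** It transfers L^2 convergence from phi_k to [damped] of phi_k. In a s - a t = eps (t - s)(t + s)
    a s a t, each factor s or t meets an [a] that keeps it bounded: s a s by [K], and t^2 a t by
    1/eps. *)
Lemma damped_lipschitz : exists L, forall s t, `|damped s - damped t| <= L * `|s - t|.
Proof.
exists (1 + 2 * (eps * (2 * K ^+ 2 + eps^-1))) => s t.
have aE : a s - a t = eps * (t - s) * (t + s) * (a s * a t).
  rewrite /a; field; apply/andP; split; exact: lt0r_neq0.
have -> : damped s - damped t = (s - t) * a s ^+ 2 - (s - t) * ((a s + a t) * (eps * (t * (t + s) * (a s * a t)))).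
  rewrite /damped.
  have -> : s * a s ^+ 2 - t * a t ^+ 2 = (s - t) * a s ^+ 2 + t * (a s - a t) * (a s + a t) by ring.
  by rewrite aE; ring.
rewrite -mulrBr normrM mulrC ler_wpM2r//.
have as2 : `|a s ^+ 2| <= 1.
  by rewrite ger0_norm ?sqr_ge0// exprn_ile1// ?a_le1// ltW.
apply: le_trans (ler_normB _ _) _; apply: lerD => //.
rewrite normrM; apply: ler_pM => //.
  rewrite ger0_norm; last by rewrite addr_ge0// ltW.
  by have := a_le1 s; have := a_le1 t; lra.
rewrite normrM (gtr0_norm eps0) ler_pM2l//.
have -> : t * (t + s) * (a s * a t) = (t * a t) * t * a s + (t * a t) * (s * a s) by ring.
have tK : `|t * a t| <= K by rewrite normrM (gtr0_norm (a_gt0 t)).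
have sK : `|s * a s| <= K by rewrite normrM (gtr0_norm (a_gt0 s)).
apply: le_trans (ler_normD _ _) _.
have h1 : `|t * a t * (s * a s)| <= K ^+ 2.
  by rewrite normrM expr2; exact: ler_pM.
have h2 : `|t * a t * t * a s| <= eps^-1.
  have -> : t * a t * t * a s = (t ^+ 2 * a t) * a s by ring.
  rewrite normrM (gtr0_norm (a_gt0 s)) ger0_norm; last by rewrite mulr_ge0 ?sqr_ge0// ltW.
  apply: (@le_trans _ _ (t ^+ 2 * a t)).
    by rewrite ler_piMr ?a_le1// mulr_ge0 ?sqr_ge0// ltW.
  rewrite ler_pdivrMr// mulrDr mulr1 mulrA mulVf ?gt_eqF// mul1r lerDr invr_ge0 ltW//.
have := sqr_ge0 K; lra.
Qed.

(** The primitive G = phi^2 / (2 (1 + eps phi^2)) keeps a factor phi, hence compact support; so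
    [damped phi] times grad phi is an admissible gradient against a divergence-free field. *)
Lemma damped_test phi : test_fun Om phi -> exists2 G, test_fun Om G &
  forall i x, partial i G x = damped (phi x) * partial i phi x.
Proof.
move=> tphi; have sphi := test_fun_smooth tphi.
pose D : E -> R := (fun=> 1) + (fun=> eps) * (phi * phi).
have Dx x : D x = 1 + eps * phi x ^+ 2 by rewrite /D !fctE expr2.
have D0 x : D x != 0 by rewrite Dx gt_eqF.
have sD : smooth D by do ?[apply: smoothD|apply: smoothM] => //; exact: smooth_cst.
have sV := smoothV D0 sD.
pose V : E -> R := fun x => (D x)^-1.
exists ((fun=> 2^-1) * V * phi * phi).
  apply: test_funMl => //; apply: smoothM => //; apply: smoothM => //; exact: smooth_cst.
move=> i x.
have df := smooth_diff sphi; have dV := smooth_diff sV; have dD := smooth_diff sD.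
have dc (c : R) : forall y : E, differentiable (fun=> c) y by move=> y; exact: differentiable_cst.
have dcV y : differentiable ((fun=> 2^-1) * V) y by exact: differentiableM.
have dcVp y : differentiable ((fun=> 2^-1) * V * phi) y by exact: differentiableM.
have dpp y : differentiable (phi * phi) y by exact: differentiableM.
have dep y : differentiable ((fun=> eps) * (phi * phi)) y by exact: differentiableM.
have PD : partial i D = (fun=> eps) * (phi * partial i phi + phi * partial i phi).
  rewrite /D (partialD i (dc 1) dep) (partialM i (dc eps) dpp) (partialM i df df) !partial_cst.
  by apply/funext => y; rewrite !fctE; ring.
have PV : partial i V = (fun=> -1) * (partial i D * (V * V)) := partialV i D0 dD.
rewrite (partialM i dcVp df) (partialM i dcV df) (partialM i (dc _) dV) PV PD !partial_cst.
rewrite !fctE /V Dx /damped /a.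
by field; rewrite gt_eqF.
Qed.

Lemma skew_damped b p : vL2 Om b -> divfree Om b -> H10 Om p ->
  \int[mu]_(x in Om) (\sum_j b j x * (damped (p x) * dx Om j p x)) = 0.
Proof.
move=> Lb [_ Db] Hp; have Hp1 := H10_Hspace Hp; have Lp := Hspace_L2 Hp1.
have [phi [tphi c0 c1]] := H10_approx oOm fOm Hp.
have [C HC] := damped_bounded; have [L HL] := damped_lipschitz.
have cdamped : continuous damped.
  move=> s; apply/cvgrPdist_le => e e0.
  have L1 : 0 < `|L| + 1 by rewrite ltr_wpDl.
  near=> t; apply: le_trans (HL _ _) _.
  apply: (@le_trans _ _ ((`|L| + 1) * `|s - t|)).
    by rewrite ler_wpM2r// (le_trans (ler_norm _))// lerDl.
  rewrite -ler_pdivlMl//; near: t.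
  by apply: cvgr_dist_le => //; rewrite mulr_gt0// invr_gt0.
have mdamped r : measurable_fun Om r -> measurable_fun Om (damped \o r).
  by move=> mr; apply: measurableT_comp => //; exact: continuous_measurable_fun.
have mdp := mdamped _ (L2_meas Lp).
have mdphi k := mdamped _ (test_fun_measurable (tphi k)).
have Ldj j := dx_L2 j Hp1.
have Ltj j k := test_fun_L2 mOm fOm (test_fun_partial j (tphi k)).
have bdd (r g : E -> R) : L2 Om g -> measurable_fun Om r -> L2 Om (fun x => damped (r x) * g x).
  move=> Lg mr; apply: (L2M_bounded_ae mOm Lg (mdamped _ mr) (K := C)).
  by apply: aeW => x _; exact: HC.
have Lphi k := test_fun_L2 mOm fOm (tphi k).
(* The difference splits into damped(phi_k) b_j (d_j phi_k - d_j p), an L^2-bounded factor times a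
   null one, and b_j d_j p (damped(phi_k) - damped(p)), where the coefficient is only integrable but
   the other factor is bounded and null in L^2. *)
have cv j : ip (b j) (fun x => damped (phi k x) * partial j (phi k) x) @[k --> \oo] -->
    ip (b j) (fun x => damped (p x) * dx Om j p x).
  pose f k x := partial j (phi k) x - dx Om j p x.
  have Lf k : L2 Om (f k) by exact: L2B.
  pose g k x := damped (phi k x) * b j x.
  have Lg k : L2 Om (g k) by apply: bdd => //; exact: L2_meas.
  have gM k : ip (g k) (g k) <= C ^+ 2 * ip (b j) (b j).
    rewrite -RintegralZl//; last exact: L2M.
    apply: le_Rintegral => //; [exact: L2M|by apply: IntZ => //; exact: L2M|].
    move=> x _; rewrite /g mulrACA -!expr2 ler_wpM2r ?sqr_ge0//.
    by rewrite -(real_normK (num_real _)) lerXn2r// nnegrE// (le_trans _ (HC 0))//.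
  have t1 := ip_cvg0 oOm Lf Lg gM (c1 j).
  pose h x := b j x * dx Om j p x.
  have ih : Int Om h by exact: L2M.
  pose D k x := damped (phi k x) - damped (p x).
  have mD k : measurable_fun Om (D k) by apply: measurable_funB; [exact: mdphi|exact: mdp].
  have DC k x : Om x -> `|D k x| <= C + C.
    by move=> _; apply: le_trans (ler_normB _ _) _; exact: lerD.
  have LD k : L2 Om (D k) by exact: L2_bounded (mD k) (DC k).
  have Lpp k : L2 Om (fun x => phi k x - p x) by exact: L2B.
  have D0 : ip (D k) (D k) @[k --> \oo] --> (0 : R).
    apply: (@squeeze_cvgr _ _ _ _ (fun=> 0) (fun k => L ^+ 2 * ip (fun x => phi k x - p x) (fun x => phi k x - p x))).
    - apply: nearW => k; rewrite ip_ge0/= -RintegralZl//; last exact: L2M.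
      apply: le_Rintegral => //; [exact: L2M|by apply: IntZ => //; exact: L2M|].
      move=> x _; rewrite -!expr2 -exprMn -(real_normK (num_real (D k x))).
      rewrite -(real_normK (num_real (L * _))) lerXn2r ?nnegrE//.
      apply: le_trans (HL _ _) _; rewrite normrM ler_wpM2r//; exact: ler_norm.
    - exact: cvg_cst.
    - by rewrite -(mulr0 (L ^+ 2)); exact: cvgMr.
  have t2 := I_mul_cvg0 oOm fOm ih mD DC D0.
  have := cvgD t1 t2; rewrite addr0 => t3.
  apply/subr_cvg0.
  rewrite (_ : (fun k => _) = (fun k => ip (g k) (f k) + ip h (D k))); first exact: t3.
  apply/funext => k.
  have L1 : L2 Om (fun x => damped (phi k x) * partial j (phi k) x) by apply: bdd => //; exact: L2_meas.
  have L2' : L2 Om (fun x => damped (p x) * dx Om j p x) by apply: bdd => //; exact: L2_meas.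
  have iD : Int Om (fun x => h x * D k x).
    apply: (@Int_le _ _ _ mOm _ (fun x => (C + C) * `|h x|)).
    - by apply: measurable_funM => //; exact: Int_meas ih.
    - by apply: IntZ => //; exact: Int_abs.
    - by move=> x Ox; rewrite normrM mulrC ler_wpM2r// DC.
  have ig := L2M mOm (Lg k) (Lf k).
  rewrite -(ipBr mOm L1 L2' (Lb j)) /Defs.ip -(RintegralD mOm ig iD).
  by apply: eq_Rintegral => x _; rewrite /g /f /h /D; ring.
have z k : \sum_j ip (b j) (fun x => damped (phi k x) * partial j (phi k) x) = 0.
  have [G tG HG] := damped_test (tphi k).
  have := Db G tG; rewrite vipE; [|by []|by []|move=> i; exact/test_fun_L2/test_fun_partial].
  move=> H; transitivity (- ip (fun=> 0) G).
    rewrite -H; apply: eq_bigr => j _; congr ip; apply/funext => x; exact/esym/HG.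
  rewrite /Defs.ip; under eq_Rintegral do rewrite mul0r.
  by rewrite Rintegral_cst// mul0r oppr0.
have c2 : \sum_j ip (b j) (fun x => damped (phi k x) * partial j (phi k) x) @[k --> \oo] -->
    \sum_j ip (b j) (fun x => damped (p x) * dx Om j p x).
  elim: (index_enum _) => [|j s IH].
    by rewrite big_nil; under eq_fun do rewrite big_nil; exact: cvg_cst.
  by rewrite big_cons; under eq_fun do rewrite big_cons; apply: cvgD IH; exact: cv.
rewrite (_ : (fun k => _) = (fun=> 0)) in c2; last by apply/funext => k; exact: z.
rewrite I_sum//; last by move=> j; apply: L2M => //; apply: bdd => //; exact: L2_meas.
exact: (cvg_unique _ c2 (cvg_cst _)).
Unshelve. all: by end_near. Qed.

End skew_symmetry.

Section skew_symmetry_limit.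
Context {R : realType} {d : nat}.
Variable Om : set 'rV[R]_d.
Hypothesis oOm : open Om.
Hypothesis fOm : (leb d Om < +oo)%E.
Local Notation E := 'rV[R]_d.
Local Notation mu := (leb d).

Let mOm : measurable Om.
Proof. exact: open_measurable_row. Qed.

(** The damping parameter 1/(n+1) tends to 0. Since [damped s] never exceeds s in absolute value,
    the integrand without damping, integrable by hypothesis, dominates. *)
Lemma skew_symmetric (b : vfield R d) (p : E -> R) :
  vL2 Om b -> divfree Om b -> H10 Om p ->
  Int Om (fun x => (\sum_j b j x * dx Om j p x) * p x) ->
  \int[mu]_(x in Om) ((\sum_j b j x * dx Om j p x) * p x) = 0.
Proof.
move=> Lb Db Hp ibp; have Hp1 := H10_Hspace Hp.
pose e n : R := n.+1%:R^-1.
have e0 n : 0 < e n by rewrite invr_gt0.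
pose f n x := \sum_j b j x * (damped (e n) (p x) * dx Om j p x).
have fE n x : f n x = (\sum_j b j x * dx Om j p x) * damped (e n) (p x).
  by rewrite /f mulr_suml; apply: eq_bigr => j _; ring.
have mp := L2_meas (Hspace_L2 Hp1).
have mV s : measurable_fun Om (fun x => (1 + e s * p x ^+ 2)^-1).
  apply: (measurableT_comp (f := fun t : R => (1 + e s * t ^+ 2)^-1)) => //.
  apply: continuous_measurable_fun => t.
  apply: cvgV.
    by rewrite gt_eqF// ltr_pwDl// mulr_ge0 ?sqr_ge0// ltW.
  by apply: cvgD; [exact: cvg_cst|apply: cvgMr; exact: exprn_continuous].
have mf n : measurable_fun Om (f n).
  apply: (@eq_measurable_fun _ _ _ _ _ (fun x => (\sum_j b j x * dx Om j p x) * (p x * (1 + e n * p x ^+ 2)^-1 ^+ 2))).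
    by move=> x _; rewrite fE.
  apply: measurable_funM; last by apply: measurable_funM => //; exact: measurable_funX.
  apply: measurable_sum => j; apply: measurable_funM; first exact: L2_meas.
  exact: (L2_meas (dx_L2 j Hp1)).
have cv : \int[mu]_(x in Om) f n x @[n --> \oo] -->
    \int[mu]_(x in Om) ((\sum_j b j x * dx Om j p x) * p x).
  apply: (I_dominated oOm (g := fun x => `|(\sum_j b j x * dx Om j p x) * p x|)) => //.
  - move=> x Ox; under eq_fun do rewrite fE.
    have cD : 1 + e n * p x ^+ 2 @[n --> \oo] --> (1 : R).
      rewrite -[X in _ --> X](addr0 (1 : R)); apply: cvgD; first exact: cvg_cst.
      rewrite -[X in _ --> X](mul0r (p x ^+ 2)).
      by apply: cvgM; [exact: cvg_harmonic|exact: cvg_cst].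
    have cV : (1 + e n * p x ^+ 2)^-1 @[n --> \oo] --> (1 : R).
      rewrite -[X in _ --> X]invr1; apply: cvgV => //; exact: oner_neq0.
    apply: cvgM; first exact: cvg_cst.
    rewrite -[X in _ --> X](mulr1 (p x)); apply: cvgM; first exact: cvg_cst.
    by rewrite -[X in _ --> X](mulr1 (1 : R)); exact: cvgM.
  - exact: Int_abs.
  - move=> n x _; by rewrite fE normrM [leRHS]normrM ler_wpM2l// damped_le.
rewrite (_ : (fun n => _) = (fun=> 0)) in cv.
  exact/esym/(cvg_unique _ (cvg_cst _) cv).
by apply/funext => n; exact: (skew_damped oOm fOm (e0 n)).
Qed.

End skew_symmetry_limit.

(** * Real bounds extracted from the Sobolev norms *)

Section norms.
Context {R : realType} {d : nat}.
Variable Om : set 'rV[R]_d.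
Hypothesis oOm : open Om.
Hypothesis fOm : (leb d Om < +oo)%E.
Local Notation E := 'rV[R]_d.
Local Notation mu := (leb d).
Implicit Types (p q r phi : E -> R) (u v w b : vfield R d).

Let mOm : measurable Om.
Proof. exact: open_measurable_row. Qed.

Lemma sqL2_ge0 p : (0 <= sqL2 Om p)%E.
Proof. by apply: integral_ge0 => x _; rewrite lee_fin sqr_ge0. Qed.

Lemma sqH_ge0 m p : (0 <= sqH Om m p)%E.
Proof.
rewrite /sqH; case: asboolP => // _.
by apply: sume_ge0 => a _; exact: sqL2_ge0.
Qed.

Lemma sqH_lty m p : (sqH Om m p < +oo)%E -> Hspace Om m p.
Proof. by rewrite /sqH; case: asboolP. Qed.

Lemma sqL2_wderiv_le m p (a : 'I_d -> nat) : Hspace Om m p -> (\sum_i a i <= m)%N ->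
  (sqL2 Om (wderiv Om a p) <= sqH Om m p)%E.
Proof.
move=> Hp am; rewrite /sqH asboolT//.
(* Each entry of a multi-index is at most its order, so [a] is one of the finitely many indices of
   the sum. *)
have ai i : (a i < m.+1)%N by rewrite ltnS (leq_trans _ am)// (bigD1 i)//= leq_addr.
pose b : {ffun 'I_d -> 'I_m.+1} := [ffun i => Ordinal (ai i)].
have -> : a = (fun i => nat_of_ord (b i)) by apply/funext => i; rewrite ffunE.
rewrite (bigD1 b)/=; last by under eq_bigr do rewrite ffunE.
by rewrite leeDl// sume_ge0// => ? _; exact: sqL2_ge0.
Qed.

(** The zero multi-index contributes [p] itself, though only almost everywhere, since that term too
    is a chosen representative. *)
Lemma sqL2_le_sqH m p : (sqL2 Om p <= sqH Om m p)%E.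
Proof.
rewrite {1}/sqH; have [Hp|nHp] := pselect (Hspace Om m p); last first.
  by rewrite /sqH asboolF// leey.
have Lp := Hspace_L2 Hp.
have [Lw _] : is_wderiv Om (fun=> 0%N) p (wderiv Om (fun=> 0%N) p).
  by apply: wderivP; exists p; exact: is_wderiv0.
apply: le_trans (sqL2_wderiv_le (a := fun=> 0%N) Hp _); last by rewrite big1.
rewrite (@sqL2_ae _ _ _ mOm p (wderiv Om (fun=> 0%N) p))//; try exact: L2_meas.
apply: (is_wderiv_uniq oOm fOm (is_wderiv0 Lp)).
by apply: wderivP; exists p; exact: is_wderiv0.
Qed.

Lemma sqrte_le (s : \bar R) (K : R) : (0 <= s)%E -> (sqrte s <= K%:E)%E ->
  (s <= (K ^+ 2)%:E)%E.
Proof.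
case: s => [s|//|//]; rewrite !lee_fin.
by move=> s0; exact: sqrt_le_sq.
Qed.

Lemma vnormH_bound m u (K : R) : (vnormH Om m u <= K%:E)%E ->
  (forall i, Hspace Om m (u i)) /\ vip Om u u <= K ^+ 2.
Proof.
have s0 : (0 <= \sum_i sqH Om m (u i))%E by apply: sume_ge0 => i _; exact: sqH_ge0.
move=> /(sqrte_le s0) H.
have Hu i : Hspace Om m (u i).
  apply: sqH_lty; apply: le_lt_trans (ltry (K ^+ 2)); apply: le_trans H.
  by rewrite (bigD1 i)//= leeDl// sume_ge0// => ? _; exact: sqH_ge0.
split=> //; have Lu : vL2 Om u by move=> i; exact: Hspace_L2 (Hu i).
rewrite -lee_fin vipE// -sum_sqL2E//; apply: le_trans H.
by apply: lee_sum => i _; exact: sqL2_le_sqH.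
Qed.

Lemma Hspace_le m n p : (m <= n)%N -> Hspace Om n p -> Hspace Om m p.
Proof. by move=> mn [Lp H]; split=> // a am; apply: H; exact: leq_trans mn. Qed.

Lemma normH1_dx q (K : R) : (normH Om 1 q ^+ 2 <= K%:E)%E ->
  Hspace Om 1 q /\ vip Om (fun i => dx Om i q) (fun i => dx Om i q) <= d%:R * K.
Proof.
rewrite /normH sqr_sqrte ?sqH_ge0// => H.
have Hq : Hspace Om 1 q by apply: sqH_lty; exact: le_lt_trans (ltry K).
split=> //; have Ld i := dx_L2 i Hq.
rewrite vipE//; apply: (@le_trans _ _ (\sum_(i < d) K)); last first.
  by rewrite sumr_const card_ord mulr_natl.
apply: ler_sum => i _; rewrite -lee_fin -sqL2E//; apply: le_trans H.
by apply: sqL2_wderiv_le => //; rewrite sum_unit_mi.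
Qed.

Lemma gradnorm_Linf_bound u (L : R) : (gradnorm_Linf Om u <= L%:E)%E ->
  forall i j, \forall x \ae mu, Om x -> `|dx Om j (u i) x| <= L.
Proof.
move=> uL i j; rewrite /gradnorm_Linf in uL.
have := ess_sup_ge (leb d) ((fun x => (Num.sqrt (\sum_i \sum_j dx Om j (u i) x ^+ 2))%:E) \_ Om).
apply: filterS => x /le_trans /(_ uL); rewrite /patch => H Ox.
move: H; rewrite mem_set// lee_fin; apply: le_trans.
rewrite -sqrtr_sqr ler_sqrt; last by apply: sumr_ge0 => ? _; apply: sumr_ge0 => ? _; exact: sqr_ge0.
rewrite (bigD1 i)//= (bigD1 j)//= -addrA lerDl addr_ge0//.
  by apply: sumr_ge0 => ? _; exact: sqr_ge0.
by apply: sumr_ge0 => ? _; apply: sumr_ge0 => ? _; exact: sqr_ge0.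
Qed.

Lemma sum_single (i : 'I_d) (F : 'I_d -> R) (y : R) :
  \sum_k F k * (if k == i then y else 0) = F i * y.
Proof.
rewrite (bigD1 i)//= eqxx big1 ?addr0// => k /negbTE ->.
by rewrite mulr0.
Qed.

Lemma vip_single u i p : vip Om u (fun k x => if k == i then p x else 0) = ip Om (u i) p.
Proof. by apply: eq_Rintegral => x _; rewrite sum_single. Qed.

Lemma vL2_single i p : L2 Om p -> vL2 Om (fun k x => if k == i then p x else 0).
Proof. by move=> Lp k; case: (k == i); [exact: Lp|exact: L2_0]. Qed.

End norms.

Lemma norm_le_of_dist (R : realType) (x y K e : R) :
  `|- x - - y| <= e -> `|y| <= K -> `|x| <= e + K.
Proof.
move=> H1 H2; have := ler_normD (- x - - y) (- y).
by rewrite subrK !normrN; lra.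
Qed.

(** * Weak continuity in time *)

Section time.
Context {R : realType}.
Local Notation lam := (@lebesgue_measure R).

Lemma lebesgue_ae_imp2 (P Q S : R -> Prop) : (forall t, P t -> Q t -> S t) ->
  (\forall t \ae lam, P t) -> (\forall t \ae lam, Q t) -> \forall t \ae lam, S t.
Proof.
move=> PQS aeP aeQ; apply: negligibleS (negligibleU aeP aeQ) => t /= nS.
by apply: contrapT => /not_orP[/contrapT Pt /contrapT Qt]; apply: nS; exact: PQS.
Qed.

Lemma lebesgue_ae_imp (P S : R -> Prop) : (forall t, P t -> S t) ->
  (\forall t \ae lam, P t) -> \forall t \ae lam, S t.
Proof. by move=> PS aeP; apply: negligibleS aeP => t /= nS /PS. Qed.

Lemma Linf_ae (V : zmodType) (N : V -> \bar R) (z : R -> V) :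
  (Linf_norm N z < +oo)%E -> exists K : R, 0 <= K /\
  \forall t \ae lam, 0 < t -> (N (z t) <= K%:E)%E.
Proof.
rewrite /Linf_norm => H.
exists (Num.max 0 (fine (ess_sup lam ((N \o z) \_ `]0, +oo[)))).
split; first by rewrite le_max lexx.
have := ess_sup_ge lam ((N \o z) \_ `]0, +oo[).
apply: filterS => t /[swap] t0.
rewrite /patch mem_set /=; last by rewrite in_itv/= t0.
move=> /le_trans; apply; move: H; case: ess_sup => [s|//|] _; last exact: leNye.
by rewrite lee_fin le_max lexx orbT.
Qed.

Lemma ae_exists (P : R -> Prop) (a b : R) : a < b ->
  (\forall t \ae lam, P t) -> exists2 t, a < t < b & P t.
Proof.
move=> ab [A [mA A0 PA]]; apply: contrapT => nP.
have : lam `]a, b[%classic = 0%E.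
  apply: (subset_measure0 _ mA _ A0); first exact: measurable_itv.
  move=> t /=; rewrite in_itv/= => tab; apply: PA => Pt; apply: nP.
  by exists t.
rewrite lebesgue_measure_itv/= lte_fin ab -EFinD => -[] /eqP.
by rewrite subr_eq0 gt_eqF.
Qed.

Context {d : nat}.
Variable Om : set 'rV[R]_d.
Hypothesis oOm : open Om.
Hypothesis fOm : (leb d Om < +oo)%E.

Let mOm : measurable Om.
Proof. exact: open_measurable_row. Qed.

Variables (z z' : R -> vfield R d) (K' : R).
Hypothesis zz' : time_deriv Om z z'.
Hypothesis z'K : \forall t \ae lam, 0 < t -> vL2 Om (z' t) /\ vip Om (z' t) (z' t) <= K'.

(** Young's inequality under the time integral. The weight stays free: 1 suffices for weak
    continuity, whereas 4/m lets the nudging term absorb the time difference. *)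
Lemma time_lipschitz (s t a : R) psi : 0 <= s -> s <= t -> 0 < a -> vL2 Om psi ->
  2 * `|vip Om (z t) psi - vip Om (z s) psi| <=
  (t - s) * (a * K' + a^-1 * vip Om psi psi).
Proof.
move=> s0 st a0 Lpsi; have [itau ->] := zz' s0 st Lpsi.
set c := a * K' + a^-1 * vip Om psi psi.
have bnd : \forall tau \ae lam, `[s, t]%classic tau -> (`|(vip Om (z' tau) psi)%:E| <= (Num.max 0 (c / 2))%:E)%E.
  (* The bound on [z'] concerns positive times only, and the interval may start at 0. *)
  have n0 : \forall tau \ae lam, tau <> 0 :> R.
    exists [set 0]; split=> //; first exact: lebesgue_measure_set1.
    by move=> tau /= /contrapT ->.
  apply: (lebesgue_ae_imp2 _ n0 z'K) => tau tau0 H; rewrite /= in_itv/= => /andP[stau _].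
  have {}tau0 : 0 < tau by rewrite lt0r (le_trans s0 stau) andbT; apply/eqP.
  have [Lz Kz] := H tau0; rewrite lee_fin le_max; apply/orP; right.
  have := vip_young oOm a0 Lz Lpsi.
  have : a * vip Om (z' tau) (z' tau) <= a * K' by rewrite ler_pM2l.
  rewrite /c; lra.
(* [K'] is nonnegative because the almost-everywhere bound is attained at some time. *)
have c0 : 0 <= c.
  have [tau /andP[tau0 _] /(_ tau0) [Lz Kz]] := ae_exists (@ltr01 R) z'K.
  have k0 := le_trans (vip_ge0 _ _) Kz.
  by apply: addr_ge0; apply: mulr_ge0 => //; [exact: ltW|rewrite invr_ge0 ltW|exact: vip_ge0].
have [mi _] := integrableP _ _ _ itau.
have H : (`|\int[lam]_(tau in `[s, t]) vip Om (z' tau) psi|%:E <= (c / 2 * (t - s))%:E)%E.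
  rewrite EFin_normr_Rintegral//; apply: le_trans (le_abse_integral _ _ _) _ => //.
  apply: (@le_trans _ _ (\int[lam]_(tau in `[s, t]) (c / 2)%:E)%E).
    apply: ae_ge0_le_integral => //.
    - exact: measurableT_comp.
    - by move=> x _; rewrite lee_fin divr_ge0.
    - by apply: (lebesgue_ae_imp _ bnd) => tau /[apply]; rewrite max_r// divr_ge0.
  rewrite integral_cst//= lebesgue_measure_itv/= lte_fin.
  case: ltP => [st'|ts]; first by rewrite -EFinD -EFinM.
  by rewrite mule0 lee_fin mulr_ge0 ?divr_ge0// subr_ge0.
move: H; rewrite lee_fin; lra.
Qed.

Lemma time_weak_cvg (t e : R) psi : 0 < t -> 0 < e -> vL2 Om psi ->
  exists2 r, t < r & forall s, t < s < r -> `|vip Om (z t) psi - vip Om (z s) psi| <= e.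
Proof.
move=> t0 e0 Lpsi; set c := 1 * K' + 1^-1 * vip Om psi psi.
have c1 : 0 < `|c| + 1 by rewrite ltr_wpDl.
exists (t + e / (`|c| + 1)); first by rewrite ltrDl divr_gt0.
move=> s /andP[ts sr]; rewrite distrC.
have := time_lipschitz (ltW t0) (ltW ts) ltr01 Lpsi; rewrite -/c => H.
have : (s - t) * c <= e.
  apply: (@le_trans _ _ ((s - t) * (`|c| + 1))).
    by rewrite ler_wpM2l ?subr_ge0 ?(ltW ts)// (le_trans (ler_norm _))// lerDl.
  by rewrite -ler_pdivlMr// lerBlDl ltW.
lra.
Qed.

(** Weak lower semicontinuity of the norm: for a good time s just after t, |z(t)|^2 <= (z(s), z(t))
    + e/2 <= (K + |z(t)|^2)/2 + e/2. *)
Lemma weak_bound (K t : R) : 0 < t -> vL2 Om (z t) ->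
  (\forall t \ae lam, 0 < t -> vL2 Om (z t) /\ vip Om (z t) (z t) <= K) ->
  vip Om (z t) (z t) <= K.
Proof.
move=> t0 Lz zK; apply/ler_addgt0Pl => e e0.
have e2 : 0 < e / 2 by rewrite divr_gt0.
have [r tr H] := time_weak_cvg t0 e2 Lz.
have [s sr zs] := ae_exists tr zK; have /andP[ts _] := sr.
have [Ls Ks] := zs (lt_trans t0 ts); have := H s sr.
have := vip_young oOm ltr01 Ls Lz; rewrite invr1 !mul1r.
have := ler_norm (vip Om (z t) (z t) - vip Om (z s) (z t)).
have := ler_norm (vip Om (z s) (z t)).
lra.
Qed.

(** The derivative is moved onto the test function, where weak continuity of [z] applies, and the
    bound at t is recovered by duality with L^1. *)
Lemma weak_dx_bound (L t : R) i j : 0 < t -> Hspace Om 1 (z t i) -> vL2 Om (z t) ->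
  (\forall t \ae lam, 0 < t -> (vL2 Om (z t) /\ Hspace Om 1 (z t i)) /\
     \forall x \ae leb d, Om x -> `|dx Om j (z t i) x| <= L) ->
  \forall x \ae leb d, Om x -> `|dx Om j (z t i) x| <= L.
Proof.
move=> t0 Ht Lz zL; apply: (norm_le_of_test oOm fOm); first exact: dx_L2.
move=> phi tphi; have tphi' := test_fun_partial j tphi.
have Lphi := test_fun_L2 mOm fOm tphi; have Lphi' := test_fun_L2 mOm fOm tphi'.
apply/ler_addgt0Pl => e e0.
pose psi : vfield R d := fun k x => if k == i then partial j phi x else 0.
have Lpsi : vL2 Om psi by exact: vL2_single.
have [r tr H] := time_weak_cvg t0 e0 Lpsi.
have [s sr zs] := ae_exists tr zL; have /andP[ts _] := sr.
have [[Ls Hs] Hx] := zs (lt_trans t0 ts).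
have Hts := H s sr; rewrite !vip_single (dx_test j Ht tphi) (dx_test j Hs tphi) in Hts.
apply: (norm_le_of_dist Hts); rewrite -RintegralZl//; last by apply: Int_abs; exact: L2_Int.
apply: I_abs_le_ae => //.
- by apply: L2M => //; exact: dx_L2.
- by apply: IntZ => //; apply: Int_abs; exact: L2_Int.
- by apply: filterS Hx => x /[apply] ?; rewrite normrM ler_wpM2r.
Qed.

End time.

(** * Energy estimates *)

Section real_estimates.
Context {R : realType}.

Lemma sqB_le_of_young (x y z : R) : 2 * `|z| <= 1 * x + 1^-1 * y ->
  x - z - (z - y) <= 2 * x + 2 * y.
Proof. by rewrite invr1; have := ler_norm (- z); rewrite normrN; lra. Qed.

(** The Young weight k d / m in [convect_bound] produces c = (d L)^2 and spends exactly m/k on the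
    tested field. *)
Lemma convect_coef (d m k L x y : R) : 0 < d -> 0 < m -> 0 < k ->
  d * (k * d / m * L ^+ 2 * x + (k * d / m)^-1 * y) =
  k * (d * L) ^+ 2 / m * x + m / k * y.
Proof. by move=> d0 m0 k0; field; rewrite !gt_eqF. Qed.

Lemma self_bound (dt K x : R) : dt <= 1 -> 0 <= K -> 0 <= x ->
  2 * `|x| <= dt * (1 * K + 1^-1 * x) -> x <= K.
Proof.
move=> dt1 K0 x0; rewrite (ger0_norm x0) invr1 !mul1r.
have : dt * (K + x) <= K + x by rewrite ler_piMl// addr_ge0.
lra.
Qed.

(** Budget of the nudging [m * Ne]: the interpolation error [X4] takes m/4; the time difference
    [X2], the convection [X3], w_t in [X5] and grad q in [X6] take m/8 each; m/4 is left. [X4] also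
    uses half of the viscosity, and [X1] is split evenly between old and new error. *)
Lemma error_energy_real (dt m nu c Ne Nt Nb G D K1 Kq X1 X2 X3 X4 X5 X6 Xd Xc Xg Xn Y Z : R) :
  0 < dt -> 0 < m -> 0 <= c -> 0 <= nu * G ->
  dt^-1 * Xd + Xc + nu * Xg + m * Xn = X5 + Y + X6 + nu * Z ->
  Xd = Ne - X1 + X2 -> Xc = Y + X3 -> Xg = G + Z -> Xn = Ne + X4 ->
  2 * `|X1| <= 1 * Nt + 1^-1 * Ne ->
  2 * `|X2| <= dt * (4 / m * K1 + (4 / m)^-1 * Ne) ->
  2 * `|X3| <= 4 * c / m * Nb + m / 4 * Ne ->
  Nb <= 2 * Nt + 2 * K1 ->
  2 * `|X4| <= 2 * D + 2^-1 * Ne -> m * D <= nu / 2 * G ->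
  2 * `|X5| <= 4 / m * K1 + (4 / m)^-1 * Ne ->
  2 * `|X6| <= 4 / m * Kq + (4 / m)^-1 * Ne ->
  ((2 * dt)^-1 + m / 4) * Ne <=
  ((2 * dt)^-1 + 4 * c / m) * Nt + (4 * K1 + 2 * Kq + 4 * c * K1) / m.
Proof.
move=> dt0 m0 c0 G0 + dE cE gE nE; rewrite {}dE {}cE {}gE {}nE => eqn.
have -> : (4 / m)^-1 = m / 4 by rewrite invf_div.
rewrite !invfM invr1.
have di0 : 0 < dt^-1 by rewrite invr_gt0.
have mi0 : 0 < m^-1 by rewrite invr_gt0.
have cm0 : 0 <= 4 * c / m by apply: divr_ge0; [exact: mulr_ge0|exact: ltW].
move=> H1 H2 H3 H3' H4 H4' H5 H6.
have h1 : dt^-1 * X1 <= dt^-1 * ((Nt + Ne) / 2).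
  by rewrite ler_pM2l//; have := ler_norm X1; lra.
have h2 : - (dt^-1 * X2) <= (4 / m * K1 + m / 4 * Ne) / 2.
  move: H2; rewrite -ler_pdivrMl// => H2.
  have : dt^-1 * (- X2) <= dt^-1 * `|X2| by rewrite ler_pM2l// -normrN ler_norm.
  lra.
have h3 : 4 * c / m * Nb <= 4 * c / m * (2 * Nt + 2 * K1) by rewrite ler_wpM2l.
have h4 : m * (2 * `|X4|) <= m * (2 * D + 2^-1 * Ne) by rewrite ler_pM2l.
have h4' : m * (- X4) <= m * `|X4| by rewrite ler_pM2l// -normrN ler_norm.
have h3' := ler_norm (- X3); rewrite normrN in h3'.
have h5 := ler_norm X5; have h6 := ler_norm X6.
lra.
Qed.

(** The interpolation error now brings the gradient of u - w, at most 2 G + 2 Gw. Weight 3/2 makes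
    it cost 3/4 of the viscous term, and [X7] a further 1/8; weight 2, as in the error estimate,
    would use up the viscosity before [X7]. *)
Lemma velocity_energy_real (dt m nu c Nu Nt Nw G Gw Ge D K1 Kq Kw Kg X1 X2 X3 X4 X5 X6 X7 Xd Xc Xn : R) :
  0 < dt -> 1 <= m -> 0 <= c -> 0 < nu -> 0 <= G -> 0 <= Nu ->
  0 <= K1 -> 0 <= Kq -> 0 <= Kw -> 0 <= Kg -> Nw <= Kw -> Gw <= Kg ->
  dt^-1 * Xd + Xc + nu * G + m * Xn = X4 + X6 + X5 + nu * X7 ->
  Xd = Nu - X1 -> Xc = 0 -> Xn = Nu - X2 + X3 ->
  2 * `|X1| <= 1 * Nt + 1^-1 * Nu ->
  2 * `|X2| <= 4 * Nw + 4^-1 * Nu ->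
  2 * `|X3| <= 3 / 2 * D + (3 / 2)^-1 * Nu -> m * D <= nu / 2 * Ge ->
  Ge <= 2 * G + 2 * Gw ->
  2 * `|X4| <= 8 / m * K1 + (8 / m)^-1 * Nu ->
  2 * `|X5| <= 8 / m * Kq + (8 / m)^-1 * Nu ->
  2 * `|X6| <= 8 * c / m * Nw + m / 8 * Nu ->
  2 * `|X7| <= 4 * Gw + 4^-1 * G ->
  ((2 * dt)^-1 + m / 4) * Nu <= (2 * dt)^-1 * Nt +
  m * (2 * Kw + 3 * nu * Kg + 4 * K1 + 4 * Kq + 4 * c * Kw).
Proof.
move=> dt0 m1 c0 nu0 G0 Nu0 K10 Kq0 Kw0 Kg0 wK gK + dE cE nE; rewrite {}dE {}cE {}nE => eqn.
have m0 : 0 < m by lra.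
have -> : (8 / m)^-1 = m / 8 by rewrite invf_div.
have -> : (3 / 2 : R)^-1 = 2 / 3 by rewrite invf_div.
rewrite !invfM invr1 => H1 H2 H3 H3' H3'' H4 H5 H6 H7.
have di0 : 0 < dt^-1 by rewrite invr_gt0.
have mi0 : 0 < m^-1 by rewrite invr_gt0.
have mi1 : m^-1 <= 1 by rewrite invf_le1.
(* All constants are brought to the common factor m, the rate of the damping. *)
have mm (x : R) : 0 <= x -> m^-1 * x <= m * x.
  by move=> x0; rewrite ler_wpM2r//; lra.
have h1 : dt^-1 * X1 <= dt^-1 * ((Nt + Nu) / 2).
  by rewrite ler_pM2l//; have := ler_norm X1; lra.
have h2 : m * X2 <= m * ((4 * Kw + 4^-1 * Nu) / 2).
  by rewrite ler_pM2l//; have := ler_norm X2; lra.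
have h3 : m * (2 * `|X3|) <= m * (3 / 2 * D + 2 / 3 * Nu) by rewrite ler_pM2l.
have h3' : m * (- X3) <= m * `|X3| by rewrite ler_pM2l// -normrN ler_norm.
have h3'' : nu * Ge <= nu * (2 * G + 2 * Kg) by rewrite ler_pM2l//; lra.
have h7 : nu * X7 <= nu * ((4 * Kg + 4^-1 * G) / 2).
  by rewrite ler_pM2l//; have := ler_norm X7; lra.
have h6 : 8 * c / m * Nw <= 8 * c / m * Kw.
  by rewrite ler_wpM2l//; apply: divr_ge0; [exact: mulr_ge0|exact: ltW].
have k1 := mm _ K10; have k2 := mm _ Kq0.
have k3 := mm _ (mulr_ge0 c0 Kw0).
have k4 : nu * Kg <= m * (nu * Kg) by rewrite ler_peMl// mulr_ge0// ltW.
have k7 : 0 <= nu * Kg by rewrite mulr_ge0// ltW.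
have k5 : 0 <= m * Nu by rewrite mulr_ge0// ltW.
have k6 : 0 <= nu * G by rewrite mulr_ge0// ltW.
have h4 := ler_norm X4; have h5 := ler_norm X5; have h6' := ler_norm X6.
clear wK gK H1 H2 H7 m1 mi1 di0 mi0; lra.
Qed.

End real_estimates.

(** * Estimates for one time step *)

Section energy.
Context {R : realType} {d : nat}.
Variable Om : set 'rV[R]_d.
Hypothesis oOm : open Om.
Hypothesis fOm : (leb d Om < +oo)%E.
Local Notation E := 'rV[R]_d.
Local Notation mu := (leb d).
Local Notation ip := (ip Om).
Local Notation vip := (vip Om).
Local Notation gradip := (gradip Om).
Implicit Types (p q r phi : E -> R) (u v w b e : vfield R d).

Let mOm : measurable Om.
Proof. exact: open_measurable_row. Qed.

Definition grad_bound (L : R) w :=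
  forall i j, \forall x \ae mu, Om x -> `|dx Om j (w i) x| <= L.

Lemma convect_term_L2 L b w i j : vL2 Om b -> Xspace Om w -> grad_bound L w ->
  L2 Om (fun x => b j x * dx Om j (w i) x).
Proof.
move=> Lb Xw wL; under eq_fun do rewrite mulrC.
by apply: (L2M_bounded_ae mOm (Lb j) _ (wL i j)); exact: L2_meas (Xspace_dx _ _ Xw).
Qed.

Lemma convect_L2 L b w : vL2 Om b -> Xspace Om w -> grad_bound L w ->
  vL2 Om (convect Om b w).
Proof. by move=> Lb Xw wL i; apply: L2_sum => // j; exact: convect_term_L2 wL. Qed.

(** Young's inequality for each of the d^2 products of a component of [b] with one of [e]: every
    component occurs d times, hence the factor d. *)
Lemma convect_bound (L be : R) b w e : 0 < be -> vL2 Om b -> vL2 Om e ->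
  Xspace Om w -> grad_bound L w ->
  2 * `|vip (convect Om b w) e| <= d%:R * (be * L ^+ 2 * vip b b + be^-1 * vip e e).
Proof.
move=> be0 Lb Le Xw wL; have Lt i j := convect_term_L2 i j Lb Xw wL.
rewrite (vipE oOm (convect_L2 Lb Xw wL) Le).
have -> : \sum_i ip (convect Om b w i) (e i) =
    \sum_i \sum_j ip (fun x => b j x * dx Om j (w i) x) (e i).
  apply: eq_bigr => i _; rewrite ipC ip_sumr//.
  by apply: eq_bigr => j _; rewrite ipC.
apply: (@le_trans _ _ (\sum_i \sum_j (be * L ^+ 2 * ip (b j) (b j) + be^-1 * ip (e i) (e i)))).
  apply: (@le_trans _ _ (\sum_i \sum_j 2 * `|ip (fun x => b j x * dx Om j (w i) x) (e i)|)).
    under [leRHS]eq_bigr do rewrite -mulr_sumr.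
    rewrite -mulr_sumr ler_pM2l//; apply: le_trans (ler_norm_sum _ _ _) _.
    by apply: ler_sum => i _; exact: ler_norm_sum.
  apply: ler_sum => i _; apply: ler_sum => j _.
  apply: le_trans (ip_young mOm be0 (Lt i j) (Le i)) _; rewrite lerD2r -mulrA ler_pM2l//.
  rewrite -RintegralZl//; last exact: L2M.
  apply: I_le_ae => //; [exact: L2M|by apply: IntZ => //; exact: L2M|].
  apply: filterS (wL i j) => x /[apply] H.
  rewrite mulrACA mulrC -!expr2 ler_wpM2r ?sqr_ge0//.
  by rewrite -(real_normK (num_real _)) lerXn2r// nnegrE// (le_trans _ H).
have -> : \sum_i \sum_j (be * L ^+ 2 * ip (b j) (b j) + be^-1 * ip (e i) (e i)) =
    d%:R * (be * L ^+ 2 * \sum_j ip (b j) (b j)) + d%:R * (be^-1 * \sum_i ip (e i) (e i)).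
  under eq_bigr do rewrite big_split /= -mulr_sumr sumr_const card_ord -[X in _ + X]mulr_natl.
  by rewrite big_split/= sumr_const card_ord -[X in X + _]mulr_natl -!mulr_sumr.
by rewrite -mulrDr -!vipE.
Qed.

Lemma gradipC u v : gradip u v = gradip v u.
Proof. by apply: eq_bigr => i _; apply: eq_bigr => j _; rewrite ipC. Qed.

Lemma gradip_ge0 u : 0 <= gradip u u.
Proof. by apply: sumr_ge0 => i _; apply: sumr_ge0 => j _; exact: ip_ge0. Qed.

Lemma gradipBl u v w : Xspace Om u -> Xspace Om v -> Xspace Om w ->
  gradip (u - v) w = gradip u w - gradip v w.
Proof.
move=> Xu Xv Xw; rewrite /Defs.gradip -sumrB; apply: eq_bigr => i _.
rewrite -sumrB; apply: eq_bigr => j _.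
rewrite -ipBl; [|exact: mOm|exact: Xspace_dx|exact: Xspace_dx|exact: Xspace_dx].
apply: ip_ae => //.
- exact: L2_meas (Xspace_dx i j (XspaceB oOm fOm Xu Xv)).
- by apply: L2_meas; apply: L2B => //; exact: Xspace_dx.
- exact: L2_meas (Xspace_dx i j Xw).
- by apply: dxB => //; exact: H10_Hspace.
Qed.

Lemma gradip_bound L w : Xspace Om w -> grad_bound L w ->
  gradip w w <= d%:R * (d%:R * (L ^+ 2 * fine (mu Om))).
Proof.
move=> Xw wL; apply: (@le_trans _ _ (\sum_(i < d) \sum_(j < d) (L ^+ 2 * fine (mu Om)))); last first.
  by rewrite !sumr_const card_ord -[leLHS]mulr_natl -[X in _ * X <= _]mulr_natl.
apply: ler_sum => i _; apply: ler_sum => j _.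
rewrite -Rintegral_cst//; apply: I_le_ae => //.
- by apply: L2M => //; exact: Xspace_dx.
- by apply: (@Int_bounded _ _ _ mOm fOm _ `|L ^+ 2|).
apply: filterS (wL i j) => x /[apply] H; rewrite -expr2.
by rewrite -(real_normK (num_real _)) lerXn2r// nnegrE// (le_trans _ H).
Qed.

Lemma gradip_young (a : R) u v : 0 < a -> Xspace Om u -> Xspace Om v ->
  2 * `|gradip u v| <= a * gradip u u + a^-1 * gradip v v.
Proof.
move=> a0 Xu Xv; rewrite /Defs.gradip !mulr_sumr -big_split/=.
apply: (@le_trans _ _ (\sum_i \sum_j 2 * `|ip (dx Om j (u i)) (dx Om j (v i))|)).
  under [leRHS]eq_bigr do rewrite -mulr_sumr.
  rewrite -mulr_sumr ler_pM2l//; apply: le_trans (ler_norm_sum _ _ _) _.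
  by apply: ler_sum => i _; exact: ler_norm_sum.
apply: ler_sum => i _; rewrite !mulr_sumr -big_split/=; apply: ler_sum => j _.
by apply: ip_young => //; exact: Xspace_dx.
Qed.

(* Otherwise unification unfolds it down to integrals. *)
#[local] Opaque Defs.gradip.

Lemma gradipBr u v w : Xspace Om u -> Xspace Om v -> Xspace Om w ->
  gradip w (u - v) = gradip w u - gradip w v.
Proof. by move=> Xu Xv Xw; rewrite gradipC (gradipBl Xu Xv Xw) !(gradipC w). Qed.

Lemma gradip_sqB_le u v : Xspace Om u -> Xspace Om v ->
  gradip (u - v) (u - v) <= 2 * gradip u u + 2 * gradip v v.
Proof.
move=> Xu Xv; have XB := XspaceB oOm fOm Xu Xv.
rewrite (gradipBl Xu Xv XB) (gradipBr Xu Xv Xu) (gradipBr Xu Xv Xv).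
by rewrite (gradipC v u); exact: sqB_le_of_young (gradip_young ltr01 Xu Xv).
Qed.

Section convection.
Variables (b u : vfield R d).
Hypotheses (Yb : Yspace Om b) (Xu : Xspace Om u).
Hypothesis ibu : forall v, Xspace Om v -> Int Om (fun x => \sum_i convect Om b u i x * v i x).

Let Lb : vL2 Om b. Proof. by case: Yb. Qed.
Let Db : divfree Om b. Proof. by case: Yb. Qed.

(** Integrability is given for the sum over components; a test field with a single nonzero component
    isolates one term. *)
Let Int_comp i p : H10 Om p -> Int Om (fun x => convect Om b u i x * p x).
Proof.
move=> Hp; have := ibu (Xspace_single oOm fOm i Hp).
rewrite (_ : (fun x => _) = (fun x => convect Om b u i x * p x))//.
by apply/funext => x; rewrite sum_single.
Qed.

Lemma convect_skew : vip (convect Om b u) u = 0.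
Proof.
rewrite /Defs.vip I_sum//; last by move=> i; exact: Int_comp.
rewrite big1// => i _; apply: (skew_symmetric oOm fOm) => //.
exact: Int_comp.
Qed.

(** This is (b . grad e, e) = 0 for e = u - w. Its integrand is integrable as a difference: the part
    with u by hypothesis, the part with w because grad w is bounded. *)
Lemma convect_skew_diff L w : Xspace Om w -> grad_bound L w ->
  vip (convect Om b u) (u - w) = vip (convect Om b w) (u - w).
Proof.
move=> Xw wL; have Xe := XspaceB oOm fOm Xu Xw; have Le := Xspace_vL2 Xe.
have Lc := convect_L2 Lb Xw wL.
have i1 i := Int_comp i (Xe i); have i2 i := L2M mOm (Lc i) (Le i).
rewrite /Defs.vip (I_sum mOm _ i1) (I_sum mOm _ i2).
apply: eq_bigr => i _; apply/eqP; rewrite -subr_eq0; apply/eqP.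
have mS : measurable_fun Om (fun x => \sum_j b j x * dx Om j ((u - w) i) x).
  apply: measurable_sum => j; apply: measurable_funM; first exact: L2_meas.
  exact: L2_meas (Xspace_dx _ _ Xe).
have ae : \forall x \ae mu, Om x ->
    convect Om b u i x * (u - w) i x - convect Om b w i x * (u - w) i x =
    (\sum_j b j x * dx Om j ((u - w) i) x) * (u - w) i x.
  have H j := dxB oOm fOm j (H10_Hspace (Xu i)) (H10_Hspace (Xw i)).
  have {}H : \forall x \ae mu, forall j, Om x ->
      dx Om j ((u - w) i) x = dx Om j (u i) x - dx Om j (w i) x.
    exact: filter_forall.
  apply: filterS H => x H Ox; rewrite -mulrBl -sumrB; congr (_ * _).
  by apply: eq_bigr => j _; rewrite -mulrBr (H j Ox).
have mP : measurable_fun Om (fun x => (\sum_j b j x * dx Om j ((u - w) i) x) * (u - w) i x).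
  by apply: measurable_funM => //; exact: L2_meas.
have iB := IntB mOm (i1 i) (i2 i).
rewrite -(RintegralB mOm (i1 i) (i2 i)) (I_ae mOm (Int_meas iB) mP ae).
by apply: (skew_symmetric oOm fOm) => //; exact: Int_ae ae iB.
Qed.

End convection.

Lemma step2_contract dt u ut p : 0 < dt -> vL2 Om u -> cda_step2 Om dt u ut p ->
  vip ut ut <= vip u u.
Proof.
move=> dt0 Lu s2; have Yut : Yspace Om ut by case: s2.
have [Lut _ _] := Yut; have := step2_orth oOm fOm dt0 s2 Yut.
rewrite vipBl// => /eqP; rewrite subr_eq0 => /eqP o1.
have Ld := vL2B oOm Lu Lut; have := vip_ge0 Om (u - ut).
rewrite (vipBl oOm Lu Lut Ld) (vipBr oOm Lu Lut Lu) (vipBr oOm Lu Lut Lut) (vipC _ ut u) -o1.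
by move: (vip u u) (vip ut ut) => x y; lra.
Qed.

Section one_step.
Variables (dt m nu CI H L K1 Kq : R) (IH : vfield R d -> vfield R d)
  (F : vfield R d -> R) (w0 w wt ut u : vfield R d) (q : E -> R).
Hypotheses (d0 : (0 < d)%N) (dt0 : 0 < dt) (m0 : 0 < m) (nu0 : 0 < nu).
Hypothesis mH : m * (CI * H) ^+ 2 <= nu / 2.
Hypothesis IH_L2 : forall v, Xspace Om v -> vL2 Om (IH v).
Hypothesis IH_err : forall v, Xspace Om v ->
  vip (IH v - v) (IH v - v) <= (CI * H) ^+ 2 * gradip v v.
Hypotheses (Xw : Xspace Om w) (wL : grad_bound L w).
Hypotheses (Lwt : vL2 Om wt) (wtK : vip wt wt <= K1).
Hypotheses (Hq : Hspace Om 1 q) (qK : vip (fun i => dx Om i q) (fun i => dx Om i q) <= Kq).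
Hypothesis nse : forall v, Xspace Om v ->
  vip wt v + vip (convect Om w w) v - ip q (wdiv Om v) + nu * gradip w v = F v.
Hypothesis Yut : Yspace Om ut.
Hypothesis step : cda_step1 Om dt m nu IH F w ut u.

Let Xu : Xspace Om u. Proof. by case: step. Qed.
Let Lu : vL2 Om u. Proof. exact: Xspace_vL2. Qed.
Let Lw : vL2 Om w. Proof. exact: Xspace_vL2. Qed.
Let Lut : vL2 Om ut. Proof. by case: Yut. Qed.
Let Xe : Xspace Om (u - w). Proof. exact: XspaceB. Qed.
Let Le : vL2 Om (u - w). Proof. exact: Xspace_vL2. Qed.
Let LIe : vL2 Om (IH (u - w) - (u - w)). Proof. by apply: vL2B => //; exact: IH_L2. Qed.
Let Lq : vL2 Om (fun i => dx Om i q). Proof. by move=> i; exact: dx_L2. Qed.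
Let ibu : forall v, Xspace Om v -> Int Om (fun x => \sum_i convect Om ut u i x * v i x).
Proof. by move=> v Xv; have [_ /(_ v Xv) []] := step. Qed.

(** The scheme and the Navier-Stokes equations share the forcing, which is eliminated between
    them. *)
Let balance v : Xspace Om v ->
  dt^-1 * vip (u - ut) v + vip (convect Om ut u) v + nu * gradip u v
    + m * vip (IH (u - w)) v =
  vip wt v + vip (convect Om w w) v + vip (fun i => dx Om i q) v + nu * gradip w v.
Proof.
move=> Xv; have [_ /(_ v Xv) [_ ->]] := step.
by rewrite -nse// ip_wdiv_X// opprK.
Qed.

Let nudge v : vL2 Om v ->
  vip (IH (u - w)) v = vip (u - w) v + vip (IH (u - w) - (u - w)) v.
Proof. by move=> Lv; rewrite (vipBl oOm (IH_L2 Xe) Le Lv) [RHS]addrC subrK. Qed.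

(** Here the smallness of mu H^2 is spent: the interpolation error costs half of the viscosity. *)
Let nudge_err : m * vip (IH (u - w) - (u - w)) (IH (u - w) - (u - w)) <=
  nu / 2 * gradip (u - w) (u - w).
Proof.
apply: (@le_trans _ _ (m * ((CI * H) ^+ 2 * gradip (u - w) (u - w)))).
  by rewrite ler_pM2l// IH_err.
by rewrite mulrA ler_wpM2r// gradip_ge0.
Qed.

Let d0R : 0 < d%:R :> R. Proof. by rewrite ltr0n. Qed.

(** In this section [w] and [w0] stand for w^(n+1) and w^n, not for the trajectory and the initial
    datum. *)
Lemma error_energy : vL2 Om w0 ->
  (forall a psi, 0 < a -> vL2 Om psi ->
    2 * `|vip (w - w0) psi| <= dt * (a * K1 + a^-1 * vip psi psi)) ->
  dt <= 1 ->
  ((2 * dt)^-1 + m / 4) * vip (u - w) (u - w) <=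
  ((2 * dt)^-1 + 4 * (d%:R * L) ^+ 2 / m) * vip (ut - w0) (ut - w0) +
  (4 * K1 + 2 * Kq + 4 * (d%:R * L) ^+ 2 * K1) / m.
Proof.
move=> Lw0 wlip dt1; set e := u - w.
set Ne := vip e e; set et := ut - w0.
have Let : vL2 Om et by exact: vL2B.
have Ldw : vL2 Om (w - w0) by exact: vL2B.
have Lb : vL2 Om (ut - w) by exact: vL2B.
have K10 : 0 <= K1 by apply: le_trans wtK; exact: vip_ge0.
have Ndw : vip (w - w0) (w - w0) <= K1.
  exact: (self_bound dt1 K10 (vip_ge0 Om (w - w0)) (wlip _ _ ltr01 Ldw)).
(* The convecting field lags one step behind: ut^n - w^(n+1) is the old error minus the increment of
   w. *)
have Nb : vip (ut - w) (ut - w) <= 2 * vip et et + 2 * K1.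
  have -> : ut - w = et - (w - w0) by rewrite /et opprB addrA subrK.
  apply: le_trans (vip_sqB_le oOm Let Ldw) _; rewrite lerD2l ler_pM2l//.
have gE : gradip u e = gradip e e + gradip w e.
  by rewrite {2}/e (gradipBl Xu Xw Xe) subrK.
have cE : vip (convect Om ut u) e = vip (convect Om w w) e + vip (convect Om (ut - w) w) e.
  rewrite (convect_skew_diff Yut Xu ibu Xw wL) -/e.
  have -> : convect Om (ut - w) w = convect Om ut w - convect Om w w.
    apply/funext => i; apply/funext => x; rewrite !fctE -sumrB.
    by apply: eq_bigr => j _; rewrite -mulrBl.
  by rewrite (vipBl oOm (convect_L2 Lut Xw wL) (convect_L2 Lw Xw wL) Le) addrC subrK.
have dE : vip (u - ut) e = Ne - vip et e + vip (w - w0) e.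
  have -> : u - ut = e - et + (w - w0).
    rewrite /e /et; apply/funext => i; apply/funext => x.
    rewrite -[LHS]/(u i x - ut i x) -[RHS]/(u i x - w i x - (ut i x - w0 i x) + (w i x - w0 i x)).
    ring.
  have -> : e - et + (w - w0) = e - et - (w0 - w) by rewrite (opprB w0 w).
  rewrite (vipBl oOm _ _ Le); [|exact: vL2B|exact: vL2B].
  rewrite (vipBl oOm Le Let Le) (vipBl oOm Lw0 Lw Le) (vipBl oOm Lw Lw0 Le) /Ne /e.
  ring.
have a0 : 0 < 4 / m by rewrite divr_gt0.
have be0 : 0 < 4 * d%:R / m by rewrite divr_gt0// mulr_gt0.
have H3 := convect_bound be0 Lb Le Xw wL.
have H4 := vip_young oOm (ltr0Sn R 1) LIe Le.
have H5 := le_trans (vip_young oOm a0 Lwt Le) (lerD (ler_wpM2l (ltW a0) wtK) (lexx _)).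
have H6 := le_trans (vip_young oOm a0 Lq Le) (lerD (ler_wpM2l (ltW a0) qK) (lexx _)).
have H1 := vip_young oOm ltr01 Let Le.
have G0 : 0 <= nu * gradip e e by rewrite mulr_ge0 ?gradip_ge0// ltW.
apply: (error_energy_real dt0 m0 (sqr_ge0 _) G0 (balance Xe) dE cE gE (nudge Le) H1
  (wlip _ _ a0 Le) _ Nb H4 nudge_err H5 H6).
by rewrite -(convect_coef _ _ _ d0R m0 (ltr0Sn R 3)).
Qed.

(** The scheme's convection vanishes completely when tested with [u], so the coefficient of
    [vip ut ut] has no growth term, whatever the size of c against m^2. *)
Lemma velocity_energy (Kw Kg : R) : 1 <= m -> vip w w <= Kw -> gradip w w <= Kg ->
  ((2 * dt)^-1 + m / 4) * vip u u <= (2 * dt)^-1 * vip ut ut +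
  m * (2 * Kw + 3 * nu * Kg + 4 * K1 + 4 * Kq + 4 * (d%:R * L) ^+ 2 * Kw).
Proof.
move=> m1 wK gK; set e := u - w; set Nu := vip u u.
have K10 : 0 <= K1 by apply: le_trans wtK; exact: vip_ge0.
have Kq0 : 0 <= Kq by apply: le_trans qK; exact: vip_ge0.
have Kw0 : 0 <= Kw by apply: le_trans wK; exact: vip_ge0.
have Kg0 : 0 <= Kg by apply: le_trans gK; exact: gradip_ge0.
have nE : vip (IH (u - w)) u = Nu - vip w u + vip (IH e - e) u.
  by rewrite (nudge Lu) (vipBl oOm Lu Lw Lu).
have a0 : 0 < 8 / m by rewrite divr_gt0.
have be0 : 0 < 8 * d%:R / m by rewrite divr_gt0// mulr_gt0.
have a32 : 0 < 3 / 2 :> R by rewrite divr_gt0.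
have H1 := vip_young oOm ltr01 Lut Lu.
have H2 := vip_young oOm (ltr0Sn R 3) Lw Lu.
have H3 := vip_young oOm a32 LIe Lu.
have H4 := le_trans (vip_young oOm a0 Lwt Lu) (lerD (ler_wpM2l (ltW a0) wtK) (lexx _)).
have H5 := le_trans (vip_young oOm a0 Lq Lu) (lerD (ler_wpM2l (ltW a0) qK) (lexx _)).
have H6 := convect_bound be0 Lw Lu Xw wL.
have H7 := gradip_young (ltr0Sn R 3) Xw Xu.
apply: (velocity_energy_real dt0 m1 (sqr_ge0 (d%:R * L)) nu0 (gradip_ge0 u) (vip_ge0 Om u)
  K10 Kq0 Kw0 Kg0 wK gK
  (balance Xu) (vipBl oOm Lu Lut Lu) (convect_skew Yut Xu ibu) nE H1 H2 H3 nudge_err (gradip_sqB_le Xu Xw) H4 H5 _ H7).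
by rewrite -(convect_coef _ _ _ d0R m0 (ltr0Sn R 7)).
Qed.

End one_step.

End energy.

Ltac nonneg := repeat first
  [assumption | exact: ler0n | exact: ltW | exact: vip_ge0 | exact: sqr_ge0
  | apply: addr_ge0 | apply: mulr_ge0].

(** * Bounds uniform in the number of steps *)

Section uniform_bounds.
Context {R : realType}.

(** The level X = 8K/m^2 is chosen so that K/m = (m/8) X: half of the damping m/4 pays for the
    growth 4c/m, the other half for the source. *)
Lemma contraction_bound (A m c Nt Ne K : R) : 0 < A -> 0 < m -> 0 <= c -> 0 <= K ->
  32 * c <= m ^+ 2 -> Nt <= 8 * K / m ^+ 2 ->
  (A + m / 4) * Ne <= (A + 4 * c / m) * Nt + K / m -> Ne <= 8 * K / m ^+ 2.
Proof.
move=> A0 m0 c0 K0 cm NtX; set X := 8 * K / m ^+ 2 => H.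
have X0 : 0 <= X by apply: divr_ge0; nonneg.
have KX : K / m = m / 8 * X by rewrite /X; field; rewrite gt_eqF.
have cm8 : 4 * c / m <= m / 8 by rewrite ler_pdivrMr// -mulrAC -expr2; lra.
have cm0 : 0 <= 4 * c / m by apply: divr_ge0; [exact: mulr_ge0|exact: ltW].
have : (A + 4 * c / m) * Nt <= (A + m / 8) * X.
  apply: (@le_trans _ _ ((A + 4 * c / m) * X)).
    by rewrite ler_wpM2l// addr_ge0// ltW.
  by rewrite ler_wpM2r// lerD2l.
rewrite KX in H => H'.
have P : 0 < A + m / 4 by rewrite addr_gt0// divr_gt0.
rewrite -(ler_pM2l P); lra.
Qed.

(** [Nu] is at most the mean of [Nt] and [4 * C0] with weights [A] and [m / 4]. *)
Lemma damping_bound (A m Nt Nu C0 B : R) : 0 < A -> 0 < m -> Nt <= B -> 4 * C0 <= B ->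
  (A + m / 4) * Nu <= A * Nt + m * C0 -> Nu <= B.
Proof.
move=> A0 m0 NtB CB H.
have P : 0 < A + m / 4 by rewrite addr_gt0// divr_gt0.
rewrite -(ler_pM2l P); apply: le_trans H _.
have h1 : A * Nt <= A * B by rewrite ler_pM2l.
have h2 : m * (4 * C0) <= m * B by rewrite ler_pM2l.
lra.
Qed.

Context {d : nat}.
Variable Om : set 'rV[R]_d.
Hypothesis oOm : open Om.
Hypothesis fOm : (leb d Om < +oo)%E.
Local Notation vip := (vip Om).

Variables (nu : R) (f : R -> vfield R d -> R) (w0 : vfield R d)
    (w wt : R -> vfield R d) (q : R -> sfield R d) (L Kw K1 Kq : R).
Hypotheses (d0 : (0 < d)%N) (nu0 : 0 < nu).
Hypotheses (Xw0 : Xspace Om w0) (Dw0 : divfree Om w0).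
Hypothesis nse : navier_stokes Om nu f w0 w wt q.
Hypothesis wL : forall t, 0 < t -> grad_bound Om L (w t).
Hypothesis wK : forall t, 0 < t -> vip (w t) (w t) <= Kw.
Hypothesis wtK : forall t, 0 < t -> vip (wt t) (wt t) <= K1.
Hypothesis qK : forall t, 0 < t -> Hspace Om 1 (q t) /\
  vip (fun i => dx Om i (q t)) (fun i => dx Om i (q t)) <= Kq.

Let Kg := d%:R * (d%:R * (L ^+ 2 * fine (leb d Om))).
Let c := (d%:R * L) ^+ 2.
Let K := 4 * K1 + 2 * Kq + 4 * c * K1.
Let C0 := 2 * Kw + 3 * nu * Kg + 4 * K1 + 4 * Kq + 4 * c * Kw.
(** The level of [damping_bound], enlarged by the initial energy so that the induction can start. *)
Let B := vip w0 w0 + 4 * C0.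

Let w00 : w 0 = w0. Proof. by case: nse. Qed.
Let Xw t : 0 <= t -> Xspace Om (w t).
Proof. by move=> t0; case: nse => _ _ /(_ t t0) []. Qed.
Let Dw t : 0 <= t -> divfree Om (w t).
Proof. by move=> t0; case: nse => _ _ /(_ t t0) []. Qed.
Let Lwt t : 0 <= t -> vL2 Om (wt t).
Proof. by move=> t0; case: nse => _ _ /(_ t t0) []. Qed.
Let Lw t : 0 <= t -> vL2 Om (w t).
Proof. by move=> t0; apply: Xspace_vL2; exact: Xw. Qed.
Let Yw t : 0 <= t -> Yspace Om (w t).
Proof. by move=> t0; apply: (Yspace_X oOm fOm); [exact: Xw|exact: Dw]. Qed.

Let K10 : 0 <= K1. Proof. exact: le_trans (vip_ge0 Om _) (wtK ltr01). Qed.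
Let Kq0 : 0 <= Kq. Proof. exact: le_trans (vip_ge0 Om _) (qK ltr01).2. Qed.
Let Kw0 : 0 <= Kw. Proof. exact: le_trans (vip_ge0 Om _) (wK ltr01). Qed.
Let c0 : 0 <= c. Proof. exact: sqr_ge0. Qed.
Let Kg0 : 0 <= Kg.
Proof. by apply: le_trans (gradip_ge0 Om (w 1)) (gradip_bound oOm fOm (Xw ler01) (wL ltr01)). Qed.
Let Kpos : 0 <= K. Proof. by rewrite /K; nonneg. Qed.

Section run.
Variables (dt m CI H : R) (IH : vfield R d -> vfield R d)
  (u ut : nat -> vfield R d) (p : nat -> sfield R d).
Hypotheses (dt0 : 0 < dt) (dt1 : dt <= 1) (dtm : dt ^- 2 <= m).
Hypothesis mH : m * (CI * H) ^+ 2 <= nu / 2.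
Hypothesis IH_L2 : forall v, Xspace Om v -> vL2 Om (IH v).
Hypothesis IH_err : forall v, Xspace Om v ->
  vip (IH v - v) (IH v - v) <= (CI * H) ^+ 2 * gradip Om v v.
Hypothesis cda : cda_projection Om dt m nu IH f w0 w u ut p.

Let t n : R := n%:R * dt.
Let t0 n : 0 <= t n. Proof. by apply: mulr_ge0 => //; exact: ltW. Qed.
Let tS n : 0 < t n.+1. Proof. exact: mulr_gt0. Qed.
Let tD n : t n.+1 - t n = dt. Proof. by rewrite /t -mulrBl -natrB// subSnn mul1r. Qed.
Let s1 n : cda_step1 Om dt m nu IH (f (t n.+1)) (w (t n.+1)) (ut n) (u n.+1).
Proof. by case: cda => _ _ /(_ n) []. Qed.
Let s2 n : cda_step2 Om dt (u n.+1) (ut n.+1) (p n.+1).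
Proof. by case: cda => _ _ /(_ n) []. Qed.
Let u0 : u 0%N = w0. Proof. by case: cda. Qed.
Let ut0 : ut 0%N = w0. Proof. by case: cda. Qed.
Let Xu n : Xspace Om (u n).
Proof. by case: n => [|n]; [rewrite u0; exact: Xw0|case: (s1 n)]. Qed.
Let Lu n : vL2 Om (u n). Proof. exact: (Xspace_vL2 (Xu n)). Qed.
Let Yut n : Yspace Om (ut n).
Proof. by case: n => [|n]; [rewrite ut0; exact: (Yspace_X oOm fOm Xw0 Dw0)|case: (s2 n)]. Qed.
Let Lut n : vL2 Om (ut n). Proof. by case: (Yut n). Qed.

Let m1 : 1 <= m.
Proof.
by apply: le_trans dtm; rewrite invf_ge1 ?exprn_gt0// exprn_ile1// ltW. Qed.
Let m0 : 0 < m. Proof. exact: lt_le_trans m1. Qed.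
Let A0 : 0 < (2 * dt)^-1. Proof. by rewrite invr_gt0 mulr_gt0. Qed.

Let nse_at n v : Xspace Om v ->
  vip (wt (t n.+1)) v + vip (convect Om (w (t n.+1)) (w (t n.+1))) v
  - ip Om (q (t n.+1)) (wdiv Om v) + nu * gradip Om (w (t n.+1)) v = f (t n.+1) v.
Proof. by move=> Xv; case: nse => _ _ _ _ /(_ _ v (tS n) Xv). Qed.

Lemma projection_error_le n :
  vip (ut n - w (t n)) (ut n - w (t n)) <= vip (u n - w (t n)) (u n - w (t n)).
Proof.
case: n => [|n]; first by rewrite u0 ut0.
exact: (step2_le oOm fOm dt0 (Lu n.+1) (s2 n) (Yw (t0 n.+1))).
Qed.

Let wlip n a psi : 0 < a -> vL2 Om psi ->
  2 * `|vip (w (t n.+1) - w (t n)) psi| <= dt * (a * K1 + a^-1 * vip psi psi).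
Proof.
move=> a0 Lpsi; have [_ wwt _ _ _] := nse.
have wtae : \forall tau \ae (@lebesgue_measure R), 0 < tau ->
    vL2 Om (wt tau) /\ vip (wt tau) (wt tau) <= K1.
  by apply: aeW => tau tau0; split; [exact: (Lwt (ltW tau0))|exact: wtK].
have tt : t n <= t n.+1 by rewrite -subr_ge0 tD ltW.
have := time_lipschitz oOm wwt wtae (t0 n) tt a0 Lpsi.
by rewrite tD -(vipBl oOm (Lw (t0 n.+1)) (Lw (t0 n)) Lpsi).
Qed.

Lemma error_small : 32 * c <= m ^+ 2 -> forall n,
  vip (u n - w (t n)) (u n - w (t n)) <= 8 * K / m ^+ 2.
Proof.
move=> cm; elim=> [|n IHn].
  have X0 : 0 <= 8 * K / m ^+ 2 by apply: divr_ge0; nonneg.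
  apply: le_trans X0; rewrite u0 /t mul0r w00.
  have Lw0 := Xspace_vL2 Xw0.
  by rewrite (vipBl oOm Lw0 Lw0 (vL2B oOm Lw0 Lw0)) subrr.
have {}IHn := le_trans (projection_error_le n) IHn.
apply: (contraction_bound A0 m0 c0 Kpos cm IHn).
exact: (error_energy oOm fOm d0 dt0 m0 nu0 mH IH_L2 IH_err (Xw (t0 n.+1)) (wL (tS n))
  (Lwt (t0 n.+1)) (wtK (tS n)) (qK (tS n)).1 (qK (tS n)).2 (@nse_at n) (Yut n) (s1 n)
  (Lw (t0 n)) (@wlip n) dt1).
Qed.

Lemma velocity_bounded n : vip (u n) (u n) <= B.
Proof.
elim: n => [|n IHn]; first by rewrite u0 lerDl; nonneg.
have CB : 4 * C0 <= B by rewrite lerDr vip_ge0.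
have {}IHn : vip (ut n) (ut n) <= B.
  case: n IHn => [|n] IHn; first by rewrite ut0 -u0.
  exact: le_trans (step2_contract oOm fOm dt0 (Lu n.+1) (s2 n)) IHn.
apply: (damping_bound A0 m0 IHn CB).
exact: (velocity_energy oOm fOm d0 dt0 m0 nu0 mH IH_L2 IH_err (Xw (t0 n.+1)) (wL (tS n))
  (Lwt (t0 n.+1)) (wtK (tS n)) (qK (tS n)).1 (qK (tS n)).2 (@nse_at n) (Yut n) (s1 n) m1
  (wK (tS n)) (gradip_bound oOm fOm (Xw (t0 n.+1)) (wL (tS n)))).
Qed.

Lemma error_bound n : (0 < n)%N ->
  vip (u n - w (t n)) (u n - w (t n)) <= (8 * K + (2 * B + 2 * Kw) * (32 * c)) * dt ^+ 2.
Proof.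
move=> n0; have dt20 : 0 < dt ^+ 2 by exact: exprn_gt0.
have B0 : 0 <= B by rewrite /B; nonneg.
have E0 : 0 <= 2 * B + 2 * Kw by nonneg.
have mm : m <= m ^+ 2 by rewrite expr2 ler_peMl// ltW.
have [cm|cm] := leP (32 * c) (m ^+ 2).
  apply: le_trans (error_small cm n) _.
  apply: (@le_trans _ _ (8 * K * dt ^+ 2)).
    apply: ler_wpM2l; first by nonneg.
    rewrite invf_ple ?posrE// ?exprn_gt0//.
    exact: le_trans dtm mm.
  by apply: ler_wpM2r; [exact: ltW|rewrite lerDl; nonneg].
have tn : 0 < t n by rewrite mulr_gt0// ltr0n.
apply: le_trans (vip_sqB_le oOm (Lu n) (Lw (t0 n))) _.
apply: (@le_trans _ _ (2 * B + 2 * Kw)).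
  by rewrite lerD// ler_pM2l// ?velocity_bounded// wK.
(* From dt^-2 <= m <= m^2 < 32 c: the time step is bounded below, so a bounded error is already of
   order dt. *)
have h : 1 <= 32 * c * dt ^+ 2.
  rewrite -ler_pdivrMr// mul1r; apply: (le_trans dtm); apply: (le_trans mm).
  exact: ltW.
rewrite [leRHS]mulrDl -(mulrA _ (32 * c)); apply: (@le_trans _ _ ((2 * B + 2 * Kw) * (32 * c * dt ^+ 2))).
  by rewrite ler_peMr.
by rewrite lerDr; nonneg.
Qed.

End run.

(** The constant is fixed before the discretisation parameters are introduced; squares are kept
    until the end. *)
Lemma uniform_error_bound : exists2 C1 : R, 0 <= C1 &
  forall (dt m CI H : R) (IH : vfield R d -> vfield R d)
    (u ut : nat -> vfield R d) (p : nat -> sfield R d),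
  0 < dt -> dt <= 1 -> dt ^- 2 <= m -> m * (CI * H) ^+ 2 <= nu / 2 ->
  (forall v, Xspace Om v -> vL2 Om (IH v)) ->
  (forall v, Xspace Om v ->
    vip (IH v - v) (IH v - v) <= (CI * H) ^+ 2 * gradip Om v v) ->
  cda_projection Om dt m nu IH f w0 w u ut p ->
  forall n, (0 < n)%N ->
  [/\ vL2 Om (ut n - w (n%:R * dt)), vL2 Om (u n - w (n%:R * dt)),
    vip (ut n - w (n%:R * dt)) (ut n - w (n%:R * dt)) <=
      vip (u n - w (n%:R * dt)) (u n - w (n%:R * dt)) &
    vip (u n - w (n%:R * dt)) (u n - w (n%:R * dt)) <= C1 * dt ^+ 2].
Proof.
exists (8 * K + (2 * B + 2 * Kw) * (32 * c)).
  have B0 : 0 <= B by rewrite /B; nonneg.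
  by nonneg.
move=> dt m CI H IH u ut p dt0 dt1 dtm mH hL herr cda n n0; split.
- case: n n0 => // n _; apply: (vL2B oOm); last by apply: Lw; rewrite mulr_ge0// ltW.
  by case: cda => _ _ /(_ n) [_ [[]]].
- case: n n0 => // n _; apply: (vL2B oOm); last by apply: Lw; rewrite mulr_ge0// ltW.
  by apply: Xspace_vL2; case: cda => _ _ /(_ n) [[]].
- exact: (projection_error_le dt0 cda n).
- exact: (error_bound dt0 dt1 dtm mH hL herr cda n0).
Qed.

End uniform_bounds.

(** * Passage from extended-real norms and the final estimate *)

Section extended_reals.
Context {R : realType}.

Lemma sqr_ereal_ge0 (x : \bar R) : (0 <= x ^+ 2)%E.
Proof.
rewrite expe2; case: x => [r||]; rewrite ?mulyy ?mulNyNy ?leey//.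
by rewrite -EFinM lee_fin -expr2 sqr_ge0.
Qed.

Lemma Linf_norm_ge0 (V : zmodType) (N : V -> \bar R) (z : R -> V) :
  (forall v, (0 <= N v)%E) -> (0 <= Linf_norm N z)%E.
Proof.
move=> N0; rewrite /Linf_norm.
have [t /andP[t0 _]] := ae_exists (@ltr01 R)
  (ess_sup_ge (@lebesgue_measure R) ((N \o z) \_ `]0, +oo[)).
rewrite /patch mem_set /=; last by rewrite in_itv/= t0.
exact: le_trans.
Qed.

End extended_reals.

(** The summands before the gradient term are nonnegative, so a finite bound on the sum bounds that
    term. *)
Lemma Cw_gradnorm_lty (R : realType) (d : nat) (Om : set 'rV[R]_d)
    (w wt wtt : R -> vfield R d) (m : R) : (Cw Om w wt wtt <= m%:E)%E ->
  (Linf_norm (gradnorm_Linf Om) w < +oo)%E.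
Proof.
rewrite /Cw; set a := (_ ^+ 2)%E; set b := (_ * _)%E; set x := Linf_norm _ w => H.
have ab0 : (0 <= a + b)%E.
  by apply: adde_ge0; [|apply: mule_ge0]; exact: sqr_ereal_ge0.
apply: le_lt_trans (ltry m); apply: le_trans H.
by rewrite leeDr.
Qed.

Lemma interpolation_error (R : realType) (d : nat) (Om : set 'rV[R]_d)
    (H CI rho : R) (k : nat) (M : set (set 'rV[R]_d)) (IH : vfield R d -> vfield R d) :
  open Om -> (leb d Om < +oo)%E -> interpolation Om H CI rho k M IH ->
  (forall v, Xspace Om v -> vL2 Om (IH v)) /\
  (forall v, Xspace Om v -> vip Om (IH v - v) (IH v - v) <= (CI * H) ^+ 2 * gradip Om v v).
Proof.
move=> oOm fOm [_ IHL _ IHerr _].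
have L v : Xspace Om v -> vL2 Om (IH v) by move=> /IHL[].
split=> // v Xv; have Lv := Xspace_vL2 Xv; have LB := vL2B oOm (L v Xv) Lv.
have := IHerr v Xv; rewrite (vnormL2E oOm LB) (gradnormE oOm (fun i => H10_Hspace (Xv i))).
rewrite -EFinM lee_fin => /(sqrt_le_sq (vip_ge0 _ _)).
by rewrite exprMn sqr_sqrtr// gradip_ge0.
Qed.

Theorem theorem3p9 (R : realType) (d : nat) (Om : set 'rV[R]_d) (nu : R)
    (f : R -> vfield R d -> R) (w0 : vfield R d)
    (w wt wtt : R -> vfield R d) (q : R -> sfield R d)
    (CI rho : R) (k : nat) :
  d = 2%N \/ d = 3%N ->
  lipschitz_domain Om ->
  0 < nu -> 0 < CI -> 0 < rho ->
  Linf (normHm1 Om) f ->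
  Xspace Om w0 -> divfree Om w0 ->
  navier_stokes Om nu f w0 w wt q ->
  time_deriv Om wt wtt ->
  Linf (vnormH Om 3) w ->
  Linf (vnormH Om 1) wt ->
  Linf (vnormH Om 1) wtt ->
  Linf (normH Om 1) q ->
  (forall t, 0 < t -> (normH Om 1 (q t) ^+ 2 <= Cq Om q)%E) ->
  exists C : R,
  forall (dt mu H : R) (M : set (set 'rV[R]_d))
    (IH : vfield R d -> vfield R d)
    (u ut : nat -> vfield R d) (p : nat -> sfield R d),
  0 < dt -> 0 <= mu ->
  interpolation Om H CI rho k M IH ->
  cda_projection Om dt mu nu IH f w0 w u ut p ->
  dt <= 1 ->
  dt ^- 2 <= mu ->
  (Cw Om w wt wtt <= mu%:E)%E ->
  mu * H ^+ 2 <= nu / (2 * CI ^+ 2) ->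
  forall n : nat, (0 < n)%N ->
  (vnormL2 Om (ut n - w (n%:R * dt))%R
     <= vnormL2 Om (u n - w (n%:R * dt))%R <= (C * dt)%:E)%E.
Proof.
move=> d23 [_ oOm _ bOm _] nu0 CI0 _ _ Xw0 Dw0 nse wwtt [_ wH3] [_ wtH1] [_ wttH1] [_ qH1] qC.
have d0 : (0 < d)%N by case: d23 => ->.
have fOm : (leb d Om < +oo)%E.
  by apply: leb_bounded_finite => //; exact: open_measurable_row.
(* If grad w is not essentially bounded, [Cw] exceeds every real mu and the claim is vacuous. *)
have [gLt|gLt] := pselect (Linf_norm (gradnorm_Linf Om) w < +oo)%E; last first.
  by exists 0 => dt m H M IH u ut p _ _ _ _ _ _ /Cw_gradnorm_lty.
have [L [_ wgL]] := Linf_ae gLt.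
have [Kw [_ wK3]] := Linf_ae wH3.
have [Kt [_ wtK1]] := Linf_ae wtH1.
have [Ktt [_ wttK1]] := Linf_ae wttH1.
have [_ wwt wreg _ _] := nse.
have wae : \forall t \ae (@lebesgue_measure R), 0 < t ->
    vL2 Om (w t) /\ vip Om (w t) (w t) <= Kw ^+ 2.
  apply: (lebesgue_ae_imp _ wK3) => t /[apply] /(vnormH_bound oOm fOm) [Hw ?]; split=> // i.
  exact: Hspace_L2 (Hw i).
have wtae : \forall t \ae (@lebesgue_measure R), 0 < t ->
    vL2 Om (wt t) /\ vip Om (wt t) (wt t) <= Kt ^+ 2.
  apply: (lebesgue_ae_imp _ wtK1) => t /[apply] /(vnormH_bound oOm fOm) [Hw ?]; split=> // i.
  exact: Hspace_L2 (Hw i).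
have wttae : \forall t \ae (@lebesgue_measure R), 0 < t ->
    vL2 Om (wtt t) /\ vip Om (wtt t) (wtt t) <= Ktt ^+ 2.
  apply: (lebesgue_ae_imp _ wttK1) => t /[apply] /(vnormH_bound oOm fOm) [Hw ?]; split=> // i.
  exact: Hspace_L2 (Hw i).
(* The scheme samples the solution at the times t^n, a null set, so almost-everywhere bounds do not
   suffice; a bound on the time derivative upgrades them to all positive times. *)
have wK t : 0 < t -> vip Om (w t) (w t) <= Kw ^+ 2.
  move=> t0; have [Xw _ _] := wreg t (ltW t0).
  exact: (weak_bound oOm wwt wtae t0 (Xspace_vL2 Xw) wae).
have wtK t : 0 < t -> vip Om (wt t) (wt t) <= Kt ^+ 2.
  move=> t0; have [_ _ Lwt] := wreg t (ltW t0).
  exact: (weak_bound oOm wwtt wttae t0 Lwt wtae).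
have wL t : 0 < t -> grad_bound Om L (w t).
  move=> t0 i j; have [Xw _ _] := wreg t (ltW t0).
  apply: (weak_dx_bound oOm fOm wwt wtae t0 (H10_Hspace (Xw i)) (Xspace_vL2 Xw)).
  apply: (lebesgue_ae_imp2 _ wK3 wgL) => s H1 H2 s0.
  have [Hs _] := vnormH_bound oOm fOm (H1 s0); split; last first.
    exact: gradnorm_Linf_bound (H2 s0) i j.
  split=> [i'|]; first exact: Hspace_L2 (Hs i').
  exact: Hspace_le (Hs i).
have qfin : Cq Om q = (fine (Cq Om q))%:E.
  rewrite fineK// /Cq; have := Linf_norm_ge0 q (fun p => sqrte_ge0 (sqH Om 1 p)).
  move: qH1; rewrite -/(normH Om 1); case: Linf_norm => [r||]//.
(* No regularity in time is assumed of the pressure: its bound at each time comes from [qC]. *)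
have qK t : 0 < t -> Hspace Om 1 (q t) /\
    vip Om (fun i => dx Om i (q t)) (fun i => dx Om i (q t)) <= d%:R * fine (Cq Om q).
  by move=> t0; apply: normH1_dx => //; rewrite -qfin; exact: qC.
have [C1 C10 bound] := uniform_error_bound oOm fOm d0 nu0 Xw0 Dw0 nse wL wK wtK qK.
exists (Num.sqrt C1) => dt m H M IH u ut p dt0 _ int cda dt1 dtm _ mH n n0.
have [IHL IHerr] := interpolation_error oOm fOm int.
have mH' : m * (CI * H) ^+ 2 <= nu / 2.
  have CI2 : 0 < CI ^+ 2 by exact: exprn_gt0.
  have := mH; rewrite -(ler_pM2r CI2) => h.
  have -> : nu / 2 = nu / (2 * CI ^+ 2) * CI ^+ 2 by field; rewrite gt_eqF.
  by rewrite exprMn mulrCA mulrC.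
have [Lut Lu leut leu] := bound _ _ _ _ _ _ _ _ dt0 dt1 dtm mH' IHL IHerr cda n n0.
rewrite (vnormL2E oOm Lut) (vnormL2E oOm Lu) !lee_fin ler_sqrt ?vip_ge0// leut /=.
apply: le_trans (ler_wsqrtr leu) _.
by rewrite sqrtrM// sqrtr_sqr ger0_norm// ltW.
Qed.
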